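(* Let $(b_N)_N$ be a sequence of integers with $0\le b_N\le N-1$ and $b_N\to\infty$ as $N\to\infty$, and let $w_N:=\min(N,2b_N+1)$. Let $(\xi_i)_{i\in\mathbb{N}}$ be an exchangeable sequence of real-valued random variables on $(\Omega,\mathcal{F},\mathbb{P})$ with finite moments of all orders, let $V$ be its limiting empirical variance, and let $(F_N)_N$ and $(F_N^{\mathrm{per}})_N$ be, respectively, a strict and a periodic de Finetti band ensemble with half-widths $b_N$ whose entries are drawn from $(\xi_i)_i$. a) (1) The empirical eigenvalue measures $\mu_N^\omega$ of $F_N^{\mathrm{per}}/\sqrt{w_N}$ converge weakly in probability to the random semicircle measure $\sigma_{V(\omega)}$. (2) If in addition the scaled half-widths $\frac{b_N}{N}$ converge either to $0$ or to $1$ as $N\to\infty$, then the empirical eigenvalue measures $\mu_N^\omega$ of $F_N/\sqrt{w_N}$ converge weakly in probability to $\sigma_{V(\omega)}$. b) Suppose in addition that $\sum_{N:\,b_N\ge1}(N b_N)^{-1}<\infty$. Then both statements (1) and (2) of part a) remain true with weak convergence in probability replaced by weak convergence $\mathbb{P}$-almost surely.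
   Context: An infinite sequence $(\xi_i)_{i\in\mathbb{N}}$ of real random variables is exchangeable if for every $n$ and every permutation $\pi$ of $\{1,\dots,n\}$ the vectors $(\xi_1,\dots,\xi_n)$ and $(\xi_{\pi(1)},\dots,\xi_{\pi(n)})$ have the same distribution. The limiting empirical variance $V$ of such a sequence is the $\mathbb{P}$-almost sure limit (which exists) of $V_n:=\frac1n\sum_{i=1}^n\xi_i^2-\big(\frac1n\sum_{i=1}^n\xi_i\big)^2$ as $n\to\infty$. De Finetti band ensembles with half-widths $b_N$: real symmetric random $N\times N$ matrices $F_N$ (strict) resp. $F_N^{\mathrm{per}}$ (periodic) such that the $(i,j)$ entry is zero whenever $|i-j|>b_N$ (strict) resp. $|i-j|_N>b_N$ (periodic), where $|i|_N:=\min(|i|,N-|i|)$ for $|i|\le N$; for each $N$ the remaining entries with $1\le i\le j\le N$, say $L_N$ many, are filled, in some order and each variable used exactly once, by the first $L_N$ members $\xi_1,\dots,\xi_{L_N}$ of the fixed exchangeable sequence; the entries below the diagonal are determined by symmetry. The eigenvalue distribution measure (empirical eigenvalue measure) of a real symmetric $N\times N$ matrix with eigenvalues $\lambda_1\le\dots\le\lambda_N$ (with multiplicity) is $\frac1N\sum_{j=1}^N\delta_{\lambda_j}$. For $v>0$, $\sigma_v$ is the probability measure on $\mathbb{R}$ with Lebesgue density $\frac{1}{2\pi v}\sqrt{(4v-x^2)_+}$, where $g_+=\max(g,0)$; $\sigma_0:=\delta_0$. Random probability measures $\mu_N^\omega$ on $\mathbb{R}$ converge to $\mu^\omega$ weakly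 in probability if for every bounded continuous $f:\mathbb{R}\to\mathbb{R}$ and every $\epsilon>0$, $\mathbb{P}(|\int f\,d\mu_N^\omega-\int f\,d\mu^\omega|>\epsilon)\to0$ as $N\to\infty$; they converge weakly $\mathbb{P}$-almost surely if there is $\Omega_0\subset\Omega$ with $\mathbb{P}(\Omega_0)=1$ such that for all $\omega\in\Omega_0$ and all bounded continuous $f$, $\int f\,d\mu_N^\omega\to\int f\,d\mu^\omega$. *)

(* Defs.v *)
From HB Require Import structures.
From mathcomp Require Export all_boot all_order all_algebra all_fingroup.
From mathcomp Require Export all_classical all_reals all_analysis.
From mathcomp Require Export measurable_realfun.

Set Implicit Arguments.
Unset Strict Implicit.
Unset Printing Implicit Defensive.
Import Order.TTheory GRing.Theory Num.Theory.
Import numFieldNormedType.Exports.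
Local Open Scope classical_set_scope.
Local Open Scope ring_scope.

Section random_sequences.
Context d (T : measurableType d) (R : realType) (P : probability T R).
Implicit Types (xi : nat -> {RV P >-> R}) (V : {RV P >-> R}).

(* The sequence is indexed from 0. Equality of the two laws is tested on the
   product sigma-algebra of [n.-tuple R]. *)
Definition exchangeable xi : Prop :=
  forall (n : nat) (s : 'S_n) (A : set (n.-tuple R)), measurable A ->
    pushforward P (fun w => [tuple xi i w | i < n]) A =
    pushforward P (fun w => [tuple xi (s i) w | i < n]) A.

Definition finite_moments xi : Prop :=
  forall i k, P.-integrable setT (fun w => ((xi i w) ^+ k)%:E).

Definition empirical_variance xi (n : nat) (w : T) : R :=
  n%:R^-1 * (\sum_(i < n) (xi i w) ^+ 2) -
  (n%:R^-1 * \sum_(i < n) xi i w) ^+ 2.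

Definition limiting_empirical_variance xi V : Prop :=
  {ae P, forall w, empirical_variance xi n w @[n --> \oo] --> V w}.

End random_sequences.

Section band_ensembles.
Context d (T : measurableType d) (R : realType) (P : probability T R).

Definition periodic_abs (N k : nat) : nat := minn k (N - k).

Definition strict_band (b : nat -> nat) (N : nat) : rel 'I_N :=
  fun i j => (`|i%:Z - j%:Z| <= b N)%N.

Definition periodic_band (b : nat -> nat) (N : nat) : rel 'I_N :=
  fun i j => (periodic_abs N `|i%:Z - j%:Z| <= b N)%N.
Arguments strict_band : clear implicits.
Arguments periodic_band : clear implicits.

Definition upper_band (band : forall N, rel 'I_N) (N : nat) :
    {pred 'I_N * 'I_N} :=
  [pred p : 'I_N * 'I_N | (p.1 <= p.2)%N && band N p.1 p.2].
Arguments upper_band : clear implicits.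

(* [e] is the (deterministic, [N]-dependent) order in which the [L_N] positions
   of the upper band receive [xi 0, ..., xi (L_N - 1)], each used once. *)
Definition band_ensemble (xi : nat -> {RV P >-> R})
    (band : forall N, rel 'I_N) (F : forall N, T -> 'M[R]_N) : Prop :=
  forall N : nat, exists2 e : 'I_N * 'I_N -> nat,
    set_bij [set` upper_band band N] `I_#|upper_band band N| e &
    forall (w : T) (i j : 'I_N),
      [/\ ~~ band N i j -> F N w i j = 0,
          (i, j) \in upper_band band N -> F N w i j = xi (e (i, j)) w
        & F N w j i = F N w i j].

Definition strict_de_finetti_band_ensemble (xi : nat -> {RV P >-> R})
    (b : nat -> nat) (F : forall N, T -> 'M[R]_N) := band_ensemble xi (strict_band b) F.

Definition periodic_de_finetti_band_ensemble (xi : nat -> {RV P >-> R})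
    (b : nat -> nat) (F : forall N, T -> 'M[R]_N) := band_ensemble xi (periodic_band b) F.

Definition band_scale (b : nat -> nat) (N : nat) : nat :=
  minn N (2 * b N + 1)%N.

End band_ensembles.

Section spectral_measures.
Context (R : realType).

(* The nondecreasing list of eigenvalues, repeated by algebraic multiplicity.
   Every real symmetric matrix has exactly one such list; the default [::] is
   only reached when the characteristic polynomial does not split over [R]. *)
Definition eigenvalues (N : nat) (A : 'M[R]_N) : seq R :=
  xget [::] [set s | sorted <=%R s /\
                     char_poly A = \prod_(x <- s) ('X - x%:P)].

Definition eigenvalue_measure (N : nat) (A : 'M[R]_N) :
    {measure set (measurableTypeR R) -> \bar R} :=
  mscale ((N%:R : R)^-1)%:nng
    (msum (fun j => \d_((eigenvalues A)`_j : measurableTypeR R)) N).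

Definition semicircle_pdf (v x : R) : R :=
  (2 * pi * v)^-1 * Num.sqrt (Num.max (4 * v - x ^+ 2) 0).

(* The value at [v < 0] is irrelevant: a limiting empirical variance is almost
   surely nonnegative. *)
Definition semicircle (v : R) (A : set (measurableTypeR R)) : \bar R :=
  if 0 < v then (\int[lebesgue_measure]_(x in A) (semicircle_pdf v x)%:E)%E
  else \d_(0 : measurableTypeR R) A.

Section semicircle_measure.
Variable v : R.

Lemma semicircle_pdf_ge0 (x : R) : 0 < v -> 0 <= semicircle_pdf v x.
Proof.
move=> v0; rewrite /semicircle_pdf mulr_ge0 ?sqrtr_ge0// invr_ge0.
by rewrite !mulr_ge0 ?pi_ge0// ltW.
Qed.

Lemma measurable_semicircle_pdf : measurable_fun setT (semicircle_pdf v).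
Proof.
apply: measurable_funM => //.
apply: (measurableT_comp (f := @Num.sqrt R)) => //.
  by apply: continuous_measurable_fun; exact: sqrt_continuous.
apply: measurable_maxr => //.
by apply: measurable_funB => //; exact: measurable_funX.
Qed.

Let semicircle0 : semicircle v set0 = 0%E.
Proof.
by rewrite /semicircle; case: ifP => _; [exact: integral_set0|exact: measure0].
Qed.

Let semicircle_ge0 A : (0 <= semicircle v A)%E.
Proof.
rewrite /semicircle; case: ifPn => // v0.
by apply: integral_ge0 => x _; rewrite lee_fin semicircle_pdf_ge0.
Qed.

Let semicircle_sigma_additive : semi_sigma_additive (semicircle v).
Proof.
rewrite /semicircle; case: (ltP 0 v) => v0; last first.
  exact: measure_semi_sigma_additive.
move=> /= A mA tA mUA.
rewrite ge0_integral_bigcup//=.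
- apply: is_cvg_ereal_nneg_natsum_cond => n _ _.
  by apply: integral_ge0 => x _; rewrite lee_fin semicircle_pdf_ge0.
- by apply/measurable_EFinP/measurable_funTS; exact: measurable_semicircle_pdf.
- by move=> x _; rewrite lee_fin semicircle_pdf_ge0.
Qed.

HB.instance Definition _ := isMeasure.Build _ _ _
  (semicircle v) semicircle0 semicircle_ge0 semicircle_sigma_additive.

End semicircle_measure.

Definition semicircle_measure (v : R) :
  {measure set (measurableTypeR R) -> \bar R} := semicircle v.

End spectral_measures.

Section weak_convergence.
Context d (T : measurableType d) (R : realType) (P : probability T R).
Local Notation measureR := {measure set (measurableTypeR R) -> \bar R}.

Definition weak_cvg (mu_ : nat -> measureR) (mu : measureR) : Prop :=
  forall f : R -> R, continuous f -> bounded_fun f ->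
    \int[mu_ N]_x f x @[N --> \oo] --> \int[mu]_x f x.

Definition weak_cvg_in_probability
    (mu_ : nat -> T -> measureR) (mu : T -> measureR) : Prop :=
  forall f : R -> R, continuous f -> bounded_fun f ->
  forall eps : R, 0 < eps ->
    P [set w | eps < `|\int[mu_ N w]_x f x - \int[mu w]_x f x|]
      @[N --> \oo] --> 0%E.

Definition weak_cvg_almost_surely
    (mu_ : nat -> T -> measureR) (mu : T -> measureR) : Prop :=
  exists Omega0 : set T, [/\ measurable Omega0, P Omega0 = 1%E &
    forall w, Omega0 w -> weak_cvg (mu_ ^~ w) (mu w)].

End weak_convergence.

(* Main.v *)
Require Import Defs.
From mathcomp Require Import spectral.
From mathcomp Require complex.
From mathcomp Require Import zify ring lra.
Set Implicit Arguments.
Unset Strict Implicit.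
Unset Printing Implicit Defensive.
Import Order.TTheory GRing.Theory Num.Theory.
Import numFieldNormedType.Exports.
Local Open Scope classical_set_scope.
Local Open Scope ring_scope.

(** The proof is the method of moments, with exchangeability replaced by sampling
and carried out first almost surely along a sequence of sizes.

Fix an outcome and a number n of observations that is huge compared with the
number of entries of the matrix.  Subtract from all entries in the band the
empirical mean of the first n observations.  The observations become exactly
centred and their second moment is exactly the empirical variance, which tends
to V.  The centring changes the matrix by a multiple of the 0-1 pattern of the
band.  Consecutive rows of that pattern differ in at most four places, so it is
the sum of a matrix of small rank and a matrix of small Frobenius norm, and
its trace norm is negligible ([trace_norm_pattern]).

If the entries were drawn from the n centred observations with replacement,
they would be independent.  The trace of the k-th power is a sum over closed
walks of length k.  A walk that uses some label exactly once has mean zero;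
otherwise it discovers at most k/2 new vertices ([fresh_bound]).  Those that
discover k/2 are the contour walks of trees: their number is governed by ballot
numbers, and they contribute (ballot k 0) V^(k/2), which is the k-th moment of
the semicircle law ([semicircle_moments]).  All others are fewer by a factor
sqrt w ([non_tree_walk_count]), where w is the width of the band.  In the
variance only pairs of walks with a common label survive, and they too discover
one vertex less than they could: the variance of the normalized trace is of
order 1/(N w) ([bad_pair_count]).

The actual entries are drawn without replacement, since by exchangeability all
injective choices of indices have the same law.  At least half of all choices
are injective, so that expectations of nonnegative functions at most double
when one passes from the actual entries to the sampled ones
([sampling_le]).  Applied to the squared deviation of the trace, this shows
that the traces converge almost surely as soon as the sum of 1/(N w) is finite
([band_weak_cvg]).  Resolvents turn this into weak convergence: polynomials in
the functions 1/(1 + (t x - a)^2) approximate every bounded continuous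
function, and their traces are stable under perturbations that are small in
trace norm ([trace_moments_weak_cvg]).

This covers the full sequence of sizes when its sum of 1/(N w) is finite.  In
general every sequence of sizes contains one with a finite sum, and convergence
in probability follows by contradiction ([in_probability_of_subsequences]).
The strict band needs an additional hypothesis only because vertices near
the ends of the diagonal have smaller degrees: if b/N tends to 0 they are rare,
and if b/N tends to 1 their degrees are almost N as well. *)

(** * Walks that discover few vertices *)
Lemma sum_tupleS (R : nmodType) (V : finType) k (F : seq V -> R) :
  \sum_(p : k.+1.-tuple V) F p = \sum_(x : V) \sum_(p : k.-tuple V) F (x :: p).
Proof.
rewrite pair_big /=.
rewrite (reindex (fun xp : V * k.-tuple V => cons_tuple xp.1 xp.2)) //=.
exists (fun p : k.+1.-tuple V => (thead p, behead_tuple p)) => [[x p] _|p _] /=.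
  by rewrite theadE; congr pair; apply: val_inj.
by case/tupleP: p => x p; apply: val_inj; rewrite /= theadE.
Qed.

Lemma sum_tuple0 (R : nmodType) (V : finType) (F : seq V -> R) :
  \sum_(p : 0.-tuple V) F p = F [::].
Proof.
rewrite (eq_bigr (fun=> F [::])); last by move=> p _; rewrite (tuple0 p).
by rewrite sumr_const card_tuple expn0.
Qed.

Lemma sum_pred (R : pzSemiRingType) (V : finType) (A : pred V) :
  \sum_i (A i)%:R = #|A|%:R :> R.
Proof.
rewrite -sumr_const [RHS]big_mkcond /=; apply: eq_bigr => i _.
by rewrite unfold_in; case: (A i).
Qed.

Section walks.
Context (V : finType) (adj : rel V).
Hypothesis adjC : symmetric adj.

Fixpoint fresh (vis p : seq V) : nat :=
  if p is x :: p' then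
    if x \in vis then fresh vis p' else (fresh (x :: vis) p').+1
  else 0.

(** A step either discovers a vertex outside [vis], with at most [w] choices that
are paid for by the weight [w^-1], or returns to one of the at most
[size vis + m] vertices discovered before.  The bound is independent of the
number of vertices. *)
Lemma walk_weight (R : realFieldType) (w : R) m x vis : 0 < w ->
  (forall y, #|adj y|%:R <= w) ->
  \sum_(p : m.-tuple V) (path adj x p)%:R * w^-1 ^+ fresh vis p
    <= (size vis + m).+1%:R ^+ m.
Proof.
move=> w0 degw; elim: m x vis => [|m IH] x vis.
  by rewrite (sum_tuple0 (fun p => (path adj x p)%:R * w^-1 ^+ fresh vis p)) /= mulr1.
rewrite (sum_tupleS m (fun p => (path adj x p)%:R * w^-1 ^+ fresh vis p)) /=.
set B : R := (size vis + m.+1).+1%:R.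
have B0 : 0 <= B by exact: ler0n.
apply: (@le_trans _ _ (\sum_y ((adj x y)%:R * (w^-1 * B ^+ m) + (y \in vis)%:R * B ^+ m))).
  apply: ler_sum => y _; case: (adj x y) => /=; last first.
    rewrite big1; last by move=> p _; rewrite mul0r.
    by rewrite mul0r add0r mulr_ge0 ?exprn_ge0 ?ler0n.
  case: (boolP (y \in vis)) => yv.
    rewrite !mul1r (le_trans (IH _ _)) //.
    rewrite -[leLHS]add0r lerD ?mulr_ge0 ?invr_ge0 ?exprn_ge0 ?(ltW w0) //.
    by rewrite lerXn2r ?nnegrE ?ler0n // ler_nat addnS ltnS leqnSn.
  rewrite mul0r addr0 mul1r.
  under eq_bigr do rewrite exprS mulrCA.
  rewrite -mulr_sumr ler_wpM2l ?invr_ge0 ?(ltW w0) // (le_trans (IH _ _)) //=.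
  by rewrite lerXn2r ?nnegrE ?ler0n // ler_nat addSn addnS.
rewrite big_split /= -!mulr_suml mulrA -mulrDl exprS.
apply: ler_wpM2r; first exact: exprn_ge0.
apply: (@le_trans _ _ (1 + (size vis)%:R)).
  apply: lerD.
    by rewrite ler_pdivrMr // mul1r sum_pred.
  rewrite (sum_pred R (mem vis)) ler_nat.
  exact: card_size.
by rewrite /B addrC natr1 ler_nat; lia.
Qed.

Context (E : eqType) (el : V -> V -> E).
Hypothesis elC : forall x y, el x y = el y x.
Hypothesis el_inj : forall x y x' y', el x y = el x' y' ->
  (x = x' /\ y = y') \/ (x = y' /\ y = x').

Definition walk_edges x p : seq E := pairmap el x p.

Lemma walk_edges_cat x p q : walk_edges x (p ++ q) = walk_edges x p ++ walk_edges (last x p) q.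
Proof. exact: pairmap_cat. Qed.

Definition singles (s : seq E) := count (fun a => count_mem a s == 1%N) s.

Definition supported (s : seq E) (vis : seq V) :=
  forall x y, el x y \in s -> y \in vis.

Lemma supported_cons s vis x z : supported s vis -> x \in vis ->
  supported (el x z :: s) (z :: vis).
Proof.
move=> sup xv u v; rewrite inE => /orP[/eqP/el_inj[[_ ->]|[_ ->]]|/sup].
- by rewrite mem_head.
- by rewrite inE xv orbT.
- by rewrite inE => ->; rewrite orbT.
Qed.

Lemma supported_cons_in s vis x z : supported s vis -> x \in vis -> z \in vis ->
  supported (el x z :: s) vis.
Proof.
by move=> sup xv zv u v; rewrite inE => /orP[/eqP/el_inj[[_ ->]|[_ ->]]|/sup].
Qed.

Lemma singles_cons a s : (singles (a :: s) + (count_mem a s == 1) =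
  singles s + (count_mem a s == 0))%N.
Proof.
rewrite /singles /= eqxx add1n eqSS.
have H c : (count (fun b => (c == b) + count_mem b s == 1)%N s + (count_mem c s == 1) =
  count (fun b => count_mem b s == 1)%N s)%N \/ count_mem c s = 0%N.
  case: (posnP (count_mem c s)) => [->|c0]; [by right|left].
  have -> : count (fun b => count_mem b s == 1)%N s =
    (count (fun b => (c == b) + count_mem b s == 1)%N s +
     count (fun b => (c == b) && (count_mem b s == 1)%N) s)%N.
    rewrite -count_predUI [X in (_ + X)%N](eq_count (a2 := pred0)) ?count_pred0 ?addn0; last first.
      by move=> b /=; case: (c =P b) => _ /=; lia.
    apply: eq_in_count => b /count_memPn/eqP bs /=; case: (c =P b) => [e|_] /=.
      rewrite e in c0; move: c0; lia.
    by rewrite add0n orbF.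
  congr addn; case: eqP => [c1|c1].
    rewrite (eq_count (a2 := pred1 c)) ?c1 // => b /=.
    by rewrite eq_sym; case: eqP => //= ->; rewrite c1.
  rewrite (eq_count (a2 := pred0)) ?count_pred0 // => b /=.
  by case: eqP => //= <-; apply/negbTE/eqP.
case: (H a) => [|c0]; first by lia.
rewrite c0 /= addn0 addnC; congr addn.
apply: eq_in_count => b bs /=; case: (a =P b) => //= ab.
by move/count_memPn: c0; rewrite ab bs.
Qed.

(** A step to a new vertex uses a new label and so creates a single one; any
other step removes at most one single label.  As no label is single in the end,
discoveries make up at most half of the steps. *)
Lemma fresh_bound x vis s p : x \in vis -> supported s vis ->
  (forall a, count_mem a s + count_mem a (walk_edges x p) != 1)%N ->
  (singles s + 2 * fresh vis p <= size p)%N.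
Proof.
elim: p x vis s => [|z p IH] x vis s xv sup tot.
  rewrite /= muln0 addn0 leqn0 /singles (eq_in_count (a2 := pred0)) ?count_pred0 //.
  by move=> a _ /=; apply/negbTE; have := tot a; rewrite addn0.
have tot' a : (count_mem a (el x z :: s) + count_mem a (walk_edges z p) != 1)%N.
  by have := tot a; rewrite /= addnA [X in (X + _)%N]addnC.
have := singles_cons (el x z) s; rewrite /=.
case: ifPn => zv.
  have := IH z vis _ zv (supported_cons_in sup xv zv) tot'.
  lia.
have := IH z (z :: vis) _ (mem_head _ _) (@supported_cons _ _ x z sup xv) tot'.
have : el x z \notin s by apply: contra zv => /sup.
by move=> /count_memPn ->; rewrite /=; lia.
Qed.

(** The walks that attain equality in [fresh_bound], which are the contour walks of
plane trees.  The stack [st] is the way back to the starting point in the tree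
discovered so far: every step discovers a vertex or retraces the last edge. *)
Fixpoint tree_walk (x : V) (st vis p : seq V) : bool :=
  if p is z :: p' then
    if z \notin vis then tree_walk z (x :: st) (z :: vis) p'
    else if st is y :: st' then (z == y) && tree_walk y st' vis p' else false
  else st == [::].

(** The labels used so far are listed in [s]: those on the way back to the root
have been used once, all other labels twice or never. *)
Record stack_inv (x : V) (st vis : seq V) (s : seq E) : Prop := StackInv {
  st_uniq : uniq (x :: st);
  st_sub : {subset x :: st <= vis};
  st_sup : supported s vis;
  st_cnt : forall a, if a \in walk_edges x st then count_mem a s = 1%N
                     else count_mem a s = 0%N \/ count_mem a s = 2%N }.

Lemma stack_inv0 r : stack_inv r [::] [:: r] [::].
Proof. by split => //= a; left. Qed.

Lemma walk_edges_mem a x st : a \in walk_edges x st ->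
  exists u v, [/\ a = el u v, u \in x :: st & v \in st].
Proof.
elim: st x => [|y st IH] x //=; rewrite inE => /orP[/eqP ->|/IH[u [v [-> uy vs]]]].
  by exists x, y; rewrite !mem_head.
by exists u, v; rewrite [in X in [/\ _, X & _]]inE uy orbT inE vs orbT.
Qed.

Lemma walk_edges_notin x z y st : x \notin y :: st -> el x z \notin walk_edges y st.
Proof.
apply: contra => /walk_edges_mem[u [v [/el_inj[[-> _]|[-> _]]] ]] // _.
by move=> h; rewrite inE h orbT.
Qed.

Lemma stack_push x st vis s z : stack_inv x st vis s -> z \notin vis ->
  stack_inv z (x :: st) (z :: vis) (el x z :: s).
Proof.
move=> [su ss sup cnt] zv; split.
- by rewrite cons_uniq su andbT; apply: contra zv => /ss.
- move=> y yz; rewrite inE; apply/orP; move: yz.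
  by rewrite inE => /orP[->|/ss ->]; [left|right].
- by apply: supported_cons => //; apply: ss; rewrite mem_head.
- have a0 : count_mem (el x z) s = 0%N.
    by apply/count_memPn; apply: contra zv => /sup.
  move=> a /=; rewrite inE (elC z) [a == _]eq_sym; case: eqP => [<-|_] /=.
    by rewrite a0.
  by rewrite !add0n; exact: cnt.
Qed.

Lemma stack_pop x y st vis s : stack_inv x (y :: st) vis s ->
  stack_inv y st vis (el x y :: s).
Proof.
move=> [su ss sup cnt]; split.
- by move: su => /=/andP[].
- by move=> z zs; apply: ss; rewrite inE zs orbT.
- by apply: supported_cons_in => //; apply: ss; rewrite !inE eqxx ?orbT.
- move=> a /=; have := cnt a; rewrite inE [a == _]eq_sym; case: eqP => [<- c1|_] /=.
    by rewrite (negbTE (walk_edges_notin y _)); [rewrite c1; right | move: su => /=/andP[]].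
  by rewrite !add0n.
Qed.

Lemma stack_inv_eq1 x st vis s z : stack_inv x st vis s ->
  count_mem (el x z) s = 1%N -> exists st', st = z :: st'.
Proof.
move=> [su ss sup cnt] c1; have := cnt (el x z).
case: ifPn => [+ _|_ []]; rewrite ?c1 //.
case: st su {ss cnt} => [|y st] //= /andP[xs _]; rewrite inE => /orP[|h]; last first.
  by have := walk_edges_notin z xs; rewrite /walk_edges h.
move=> /eqP/el_inj[[_ ->]|[xy _]]; first by exists st.
by move: xs; rewrite xy mem_head.
Qed.

(** Equality forces each step that is not a discovery to remove a single label, and
at the current vertex the only single label leads to the top of the stack. *)
Lemma fresh_eq_tree_walk x st vis s p : stack_inv x st vis s ->
  (forall a, count_mem a s + count_mem a (walk_edges x p) != 1)%N ->
  (singles s + 2 * fresh vis p)%N = size p -> tree_walk x st vis p.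
Proof.
elim: p x st vis s => [|z p IH] x st vis s inv tot.
  rewrite /= => _; case: st inv => // y st [su ss sup cnt].
  have := tot (el x y); have := cnt (el x y); rewrite /= mem_head => ->.
  by rewrite addn0.
have tot' a : (count_mem a (el x z :: s) + count_mem a (walk_edges z p) != 1)%N.
  by have := tot a; rewrite /= addnA [X in (X + _)%N]addnC.
have := singles_cons (el x z) s; rewrite /=.
have xv : x \in vis by apply: (st_sub inv); rewrite mem_head.
case: ifPn => zv /=.
  have B := fresh_bound zv (supported_cons_in (st_sup inv) xv zv) tot'.
  case: (count_mem (el x z) s =P 1%N) => [c1 e1 e2|c1]; last by lia.
  have [st' E'] := stack_inv_eq1 inv c1; rewrite E' eqxx /=.
  rewrite E' in inv; apply: IH (stack_pop inv) tot' _.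
  move: e1 e2; rewrite c1 /=; lia.
have a0 : count_mem (el x z) s = 0%N.
  by apply/count_memPn; apply: contra zv => /(st_sup inv).
move=> e1 e2; apply: IH (stack_push inv zv) tot' _; move: e1 e2; rewrite a0 /=; lia.
Qed.

Lemma tree_walk_cat x st vis s p q : stack_inv x st vis s -> tree_walk x st vis (p ++ q) ->
  exists st' vis' s', [/\ stack_inv (last x p) st' vis' s',
    tree_walk (last x p) st' vis' q, last (last x p) st' = last x st &
    forall a, count_mem a s' = (count_mem a s + count_mem a (walk_edges x p))%N].
Proof.
elim: p x st vis s => [|z p IH] x st vis s inv.
  by move=> g; exists st, vis, s; split => // a; rewrite addn0.
rewrite /=; case: ifPn => zv.
  move=> /(IH _ _ _ _ (stack_push inv zv))[st' [vis' [s' [i g l c]]]].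
  by exists st', vis', s'; split => // a; rewrite c /=; lia.
case: st inv => [|y st] // inv /andP[/eqP ->].
move=> /(IH _ _ _ _ (stack_pop inv))[st' [vis' [s' [i g l c]]]].
by exists st', vis', s'; split => // a; rewrite c /=; lia.
Qed.

(** The stack is empty at the end, so that no label has been used just once. *)
Lemma tree_walk_edge_count r p a : tree_walk r [::] [:: r] p ->
  (count_mem a (walk_edges r p) == 0%N) || (count_mem a (walk_edges r p) == 2).
Proof.
move=> g; have := @tree_walk_cat r [::] [:: r] [::] p [::] (stack_inv0 r).
rewrite cats0 => /(_ g)[st' [vis' [s' [i /= /eqP st0 _ /(_ a) c]]]].
move: i; rewrite st0 => i; have /= := st_cnt i a; rewrite c add0n.
by case=> -> //; rewrite orbT.
Qed.

Lemma closed_bound r p : (forall a, count_mem a (walk_edges r p) != 1%N) ->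
  (2 * fresh [:: r] p <= size p)%N /\
  (~~ tree_walk r [::] [:: r] p -> (2 * fresh [:: r] p < size p)%N).
Proof.
move=> tot.
have sup0 : supported [::] [:: r] by [].
have B := fresh_bound (mem_head r [::]) sup0 tot.
split; first exact: B.
move=> ng; rewrite ltn_neqAle [X in _ && X]B andbT; apply: contra ng => /eqP e.
by apply: fresh_eq_tree_walk (stack_inv0 r) tot _.
Qed.

(** Otherwise the concatenation would be a contour walk.  Its stack is empty when it
comes back to the root after [p], hence [a] has been used twice by then, and
twice in total, and cannot reappear in [q]. *)
Lemma pair_bound r p q a : last r p = r ->
  a \in walk_edges r p -> a \in walk_edges r q ->
  (forall b, count_mem b (walk_edges r (p ++ q)) != 1%N) ->
  (2 * fresh [:: r] (p ++ q) < size (p ++ q))%N.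
Proof.
move=> lp ap aq tot; apply: (proj2 (closed_bound tot)).
apply/negP => g; have := tree_walk_edge_count a g.
have [st' [vis' [s' [i _ + c]]]] := tree_walk_cat (stack_inv0 r) g.
rewrite lp /= => lst; rewrite lp in i.
have st0 : st' = [::].
  case: st' i lst => // y st' i /= l; have := st_uniq i.
  by rewrite cons_uniq -{1}l mem_last.
rewrite st0 in i; have /= := st_cnt i a; rewrite c /= add0n walk_edges_cat count_cat lp.
move: ap aq; rewrite -!has_pred1 !has_count => ap aq; case=> e; first by rewrite e in ap.
rewrite e; move: aq; case: count => // n _.
Qed.

(** The number of nonnegative paths with [k] steps +1 or -1 from height [h] to
height 0; for [h = 0] and even [k] this is a Catalan number. *)
Fixpoint ballot (k h : nat) : nat :=
  if k is k'.+1 then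
    (ballot k' h.+1 + (if h is h'.+1 then ballot k' h' else 0))%N
  else (h == 0%N).

(** The height of the stack follows a ballot path; a discovery has at most [s ^+ 2]
choices and a step back has only one. *)
Lemma tree_walk_count_ub (R : realFieldType) (s : R) k x st vis : 0 < s ->
  (forall y, #|adj y|%:R <= s ^+ 2) ->
  \sum_(p : k.-tuple V) (path adj x p && tree_walk x st vis p)%:R
    <= (ballot k (size st))%:R * s ^+ k * s^-1 ^+ size st.
Proof.
move=> s0 degs; elim: k x st vis => [|k IH] x st vis.
  rewrite (sum_tuple0 (fun p => (path adj x p && tree_walk x st vis p)%:R)) /=.
  by case: st => [|y st'] /=; rewrite ?mulr1 ?mul0r.
rewrite (sum_tupleS k (fun p => (path adj x p && tree_walk x st vis p)%:R)) /=.
have s1 : 0 <= s^-1 by rewrite invr_ge0 ltW.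
set B1 : R := (ballot k (size st).+1)%:R * s ^+ k * s^-1 ^+ (size st).+1.
have B10 : 0 <= B1 by apply: mulr_ge0; [apply: mulr_ge0|]; rewrite ?ler0n ?exprn_ge0 // ltW.
pose B2 : R := (if size st is h.+1 then (ballot k h)%:R * s ^+ k * s^-1 ^+ h else 0).
have B20 : 0 <= B2.
  by rewrite /B2; case: (size st) => // h; rewrite !mulr_ge0 ?ler0n ?exprn_ge0 // ltW.
apply: (@le_trans _ _ (\sum_z ((adj x z)%:R * B1 +
    (if st is y :: _ then z == y else false)%:R * B2))).
  apply: ler_sum => z _; case: (adj x z) => /=; last first.
    rewrite big1 // mul0r add0r mulr_ge0 ?ler0n //.
  case: (boolP (z \notin vis)) => zv; first by rewrite mul1r (le_trans (IH _ _ _)) // lerDl mulr_ge0 ?ler0n.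
  rewrite /B2; case: (st) => [|y st'].
    by rewrite big1 ?mul0r ?addr0 ?mul1r // => p _; rewrite andbF.
  case: eqP => [->|_] /=; last first.
    by rewrite big1 ?mul0r ?addr0 ?mul1r // => p _; rewrite andbF.
  by rewrite !mul1r (le_trans (IH _ _ _)) // lerDr.
rewrite big_split /= -!mulr_suml.
apply: (@le_trans _ _ (s ^+ 2 * B1 + B2)).
  apply: lerD.
    by rewrite ler_wpM2r // sum_pred.
  rewrite -[leRHS]mul1r ler_wpM2r //.
  case: (st) => [|y st']; first by rewrite big1.
  by rewrite (sum_pred R (pred1 y)) card1.
rewrite /B1 /B2 natrD !exprS.
have sn0 : s != 0 by rewrite gt_eqF.
case: (size st) => [|h]; rewrite ?exprS le_eqVlt; apply/orP; left; apply/eqP; field; done.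
Qed.

(** [H h] contains the vertices that the walk can reach at height [h].  Their degree
exceeds [t ^+ 2] by [K] because up to [K] neighbours may have been visited. *)
Lemma tree_walk_count_lb (R : realFieldType) (t : R) (K : nat) (H : nat -> pred V) : 0 < t ->
  (forall h x y, H h x -> adj x y -> H h.+1 y) ->
  (forall h x, H h x -> (h <= K)%N -> t ^+ 2 + K%:R <= #|adj x|%:R) ->
  forall k x st vis,
  path adj x st ->
  (forall i, (i <= size st)%N -> H i (nth x (rev (x :: st)) i)) ->
  (size st + k <= K)%N -> (size vis + k <= K.+1)%N ->
  {subset x :: st <= vis} -> uniq (x :: st) ->
  (ballot k (size st))%:R * t ^+ k * t^-1 ^+ size st <=
  \sum_(p : k.-tuple V) (path adj x p && tree_walk x st vis p)%:R.
Proof.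
move=> t0 Hadj Hdeg; elim=> [|k IH] x st vis pst Hst stK visK sub un.
  rewrite (sum_tuple0 (fun p => (path adj x p && tree_walk x st vis p)%:R)) /=.
  by case: (st) => [|y st'] /=; rewrite ?mulr1 ?mul0r.
rewrite (sum_tupleS k (fun p => (path adj x p && tree_walk x st vis p)%:R)) /=.
have t1 : 0 <= t^-1 by rewrite invr_ge0 ltW.
set B1 : R := (ballot k (size st).+1)%:R * t ^+ k * t^-1 ^+ (size st).+1.
have B10 : 0 <= B1 by apply: mulr_ge0; [apply: mulr_ge0|]; rewrite ?ler0n ?exprn_ge0 // ltW.
pose B2 : R := (if size st is h.+1 then (ballot k h)%:R * t ^+ k * t^-1 ^+ h else 0).
have B20 : 0 <= B2.
  by rewrite /B2; case: (size st) => // h; rewrite !mulr_ge0 ?ler0n ?exprn_ge0 // ltW.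
have xv : x \in vis by apply: sub; rewrite mem_head.
have Hx : H (size st) x.
  by have := Hst _ (leqnn _); rewrite nth_rev //= subnn.
pose hd z := if st is y :: _ then z == y else false.
apply: (@le_trans _ _ (\sum_z ((adj x z && (z \notin vis))%:R * B1 +
    (hd z)%:R * B2))); last first.
  apply: ler_sum => z _; case: (boolP (z \in vis)) => zv /=.
    rewrite andbF mul0r add0r /B2 /hd.
    case: (st) pst Hst stK sub un => [|y st'] pst Hst stK sub' un'.
      by rewrite mul0r; apply: sumr_ge0 => p _; rewrite ler0n.
    case: (z =P y) => [->|_] /=; last first.
      by rewrite mul0r; apply: sumr_ge0 => p _; rewrite ler0n.
    move: pst => /=/andP[axy pst]; rewrite axy mul1r /=.
    apply: IH => //.
    - move=> i ist; have := Hst i (leqW ist).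
      rewrite rev_cons nth_rcons size_rev /= ltnS ist.
      by rewrite (set_nth_default y) ?size_rev.
    - by move: stK; clear; rewrite /=; lia.
    - by move: visK; clear; lia.
    - by move=> u us; apply: sub'; rewrite inE us orbT.
    - by move: un' => /=/andP[].
  have -> : hd z = false.
    rewrite /hd; case: (st) sub => // y st' sub'; apply/negP => /eqP zy.
    by move: zv; rewrite zy sub' // !inE eqxx orbT.
  rewrite mul0r addr0 andbT; case: (boolP (adj x z)) => axz; last first.
    by rewrite mul0r; apply: sumr_ge0 => p _; rewrite ler0n.
  rewrite mul1r; apply: (IH z (x :: st) (z :: vis)) => /=.
  - by rewrite adjC axz.
  - move=> i ist; rewrite rev_cons nth_rcons size_rev /=.
    case: ltnP => h.
      by rewrite (set_nth_default x) ?size_rev //; apply: Hst.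
    have -> : i = (size st).+1 by apply/eqP; rewrite eqn_leq ist h.
    by rewrite eqxx; apply: Hadj axz.
  - by rewrite addSnnS.
  - by rewrite addSnnS.
  - by move=> y; rewrite inE => /orP[/eqP ->|/sub yv]; rewrite inE ?eqxx ?yv ?orbT.
  - by have /= -> := un; rewrite andbT; apply: contra zv => /sub.
rewrite big_split /= -!mulr_suml.
apply: (@le_trans _ _ (t ^+ 2 * B1 + B2)).
  rewrite /B1 /B2 natrD !exprS.
  have sn0 : t != 0 by rewrite gt_eqF.
  case: (size st) => [|h]; rewrite ?exprS le_eqVlt; apply/orP; left; apply/eqP; field; done.
apply: lerD.
  rewrite ler_wpM2r // (sum_pred R (fun z => adj x z && (z \notin vis))).
  have := Hdeg _ _ Hx; have stK' : (size st <= K)%N by lia.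
  move=> /(_ stK') deg.
  rewrite -(lerD2r K%:R) (le_trans deg) // -natrD ler_nat.
  apply: (@leq_trans (#|[pred z | adj x z && (z \notin vis)]| + #|vis|)).
    rewrite -cardUI (leq_trans _ (leq_addr _ _)) // subset_leq_card //.
    by apply/fintype.subsetP => z; rewrite !inE unfold_in => ->; case: (z \in vis).
  by rewrite leq_add2l (leq_trans (card_size _)) // -ltnS (leq_trans _ visK) // addnS ltnS leq_addr.
rewrite -[leLHS]mul1r /B2 /hd; case: (st) => [|y st'] /=; first by rewrite mulr0 mulr_ge0 // sumr_ge0.
apply: ler_wpM2r; first by rewrite !mulr_ge0 ?ler0n ?exprn_ge0 // ltW.
by rewrite (sum_pred R (pred1 y)) card1.
Qed.

End walks.

(** * Closed walks and traces of powers *)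
Lemma sum_tupleD (R : nmodType) (V : finType) k l (F : seq V -> R) :
  \sum_(p : k.-tuple V) \sum_(q : l.-tuple V) F (p ++ q) =
  \sum_(r : (k + l).-tuple V) F r.
Proof.
elim: k F => [|k IH] F.
  by rewrite (sum_tuple0 (fun p => \sum_(q : l.-tuple V) F (p ++ q))).
rewrite (sum_tupleS k (fun p => \sum_(q : l.-tuple V) F (p ++ q))).
rewrite (sum_tupleS (k + l) F); apply: eq_bigr => x _ /=.
exact: (IH (fun s => F (x :: s))).
Qed.

Lemma mx_pow_walk (R : pzRingType) n (A : 'M[R]_n) k i j :
  (A ^+ k) i j =
  \sum_(p : k.-tuple 'I_n) (last i p == j)%:R * \prod_(a <- pairmap A i p) a.
Proof.
elim: k i j => [|k IH] i j.
  rewrite expr0 (sum_tuple0 (fun p => (last i p == j)%:R * \prod_(a <- pairmap A i p) a)) /=.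
  by rewrite big_nil mulr1 !mxE.
rewrite exprS mxE (sum_tupleS k (fun p => (last i p == j)%:R * \prod_(a <- pairmap A i p) a)).
apply: eq_bigr => x _; rewrite IH mulr_sumr; apply: eq_bigr => p _ /=.
by rewrite big_cons; case: eqP => _; rewrite ?mul1r // !mul0r mulr0.
Qed.

Section trace_walks.
Context (R : comPzRingType) (n : nat) (adj : rel 'I_n) (E : eqType)
  (el : 'I_n -> 'I_n -> E) (y : E -> R).

Lemma prod_pairmap (A : 'M[R]_n) i p :
  (forall i j, A i j = (adj i j)%:R * y (el i j)) ->
  \prod_(a <- pairmap A i p) a = (path adj i p)%:R * \prod_(l <- walk_edges el i p) y l.
Proof.
move=> AE; elim: p i => [|x p IH] i /=; first by rewrite !big_nil mulr1.
rewrite !big_cons IH AE.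
by case: (adj i x); rewrite /= ?mul1r ?mul0r // mulrCA.
Qed.

Lemma trace_pow_walk (A : 'M[R]_n) k :
  (forall i j, A i j = (adj i j)%:R * y (el i j)) ->
  \tr (A ^+ k) = \sum_i \sum_(p : k.-tuple 'I_n)
    (path adj i p && (last i p == i))%:R * \prod_(l <- walk_edges el i p) y l.
Proof.
move=> AE; apply: eq_bigr => i _; rewrite mx_pow_walk; apply: eq_bigr => p _.
rewrite prod_pairmap //; case: eqP => _; rewrite ?andbT ?andbF ?mul1r ?mul0r //.
Qed.
End trace_walks.

Section closed_walks.
Context (V : finType) (adj : rel V) (x0 : V).
Context (E : finType) (el : V -> V -> E).
Hypothesis adjC : symmetric adj.
Hypothesis elC : forall x y, el x y = el y x.
Hypothesis el_inj : forall x y x' y', el x y = el x' y' ->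
  (x = x' /\ y = y') \/ (x = y' /\ y = x').

(** Closed walks are stored as cyclic sequences, so that rotation moves the starting
point; it is the last vertex.  The default [x0] concerns only the empty walk. *)
Definition base (c : seq V) := last x0 c.
Definition cycle_edges (c : seq V) := walk_edges el (base c) c.
Definition cycle_path (c : seq V) := path adj (base c) c.

Lemma sum_closed (R : pzSemiRingType) k (G : V -> seq V -> R) :
  \sum_i \sum_(p : k.+1.-tuple V) (last i p == i)%:R * G i p =
  \sum_(c : k.+1.-tuple V) G (base c) c.
Proof.
rewrite exchange_big /=; apply: eq_bigr => c _.
rewrite (bigD1 (base c)) //= big1 ?addr0.
  have -> : last (base c) c = base c by case/tupleP: c => x c.
  by rewrite eqxx mul1r.
move=> i ic; suff -> : (last i c == i) = false by rewrite mul0r.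
apply/negbTE; apply: contra ic => /eqP <-.
by rewrite /base; case/tupleP: c.
Qed.

Lemma base_cat c1 c2 : base (c1 ++ c2) = last (base c1) c2.
Proof. exact: last_cat. Qed.

Lemma last_base c1 c2 : last (base (c1 ++ c2)) c1 = if c1 is [::] then base c2 else base c1.
Proof. by case: c1. Qed.

Lemma cycle_edges_rot s c : perm_eq (cycle_edges (rot s c)) (cycle_edges c).
Proof.
rewrite /rot -{3}(cat_take_drop s c); set c1 := take s c; set c2 := drop s c.
rewrite /cycle_edges !walk_edges_cat !last_base !base_cat.
case: c1 => [|x c1] /=; first by rewrite cats0.
case: c2 => [|z c2] /=; first by rewrite cats0.
exact: (permEl (perm_catC (_ :: _) (_ :: _))).
Qed.

Lemma cycle_path_rot s c : cycle_path (rot s c) = cycle_path c.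
Proof.
rewrite /rot -{3}(cat_take_drop s c); set c1 := take s c; set c2 := drop s c.
rewrite /cycle_path !cat_path !last_base !base_cat.
case: c1 => [|x c1] /=; first by rewrite ?cats0 ?andbT.
case: c2 => [|z c2] /=; first by rewrite ?cats0 ?andbT.
by rewrite andbC.
Qed.

Lemma base_rot u c : u \in c -> base (rot (index u c).+1 c) = u.
Proof.
move=> uc; have ic : (index u c < size c)%N by rewrite index_mem.
rewrite /rot base_cat /base (take_nth x0) // last_rcons nth_index //.
Qed.

Lemma cycle_edges_mem a c : a \in cycle_edges c -> exists u v, [/\ a = el u v, u \in c & v \in c].
Proof.
case: c => [|x c] // /walk_edges_mem [u [v [-> + vc]]].
rewrite inE => /orP[/eqP ->|uc]; last by exists u, v.
by exists (base (x :: c)), v; rewrite vc /base /= mem_last.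
Qed.

Definition no_single (s : seq E) := [forall a, count_mem a s != 1%N].

Lemma no_single_perm s t : perm_eq s t -> no_single s = no_single t.
Proof. by move=> /seq.permP st; apply: eq_forallb => a; rewrite st. Qed.

Definition share (c d : seq V) := has (mem (cycle_edges c)) (cycle_edges d).

(** The pairs of closed walks that contribute to the variance of a trace: with no
common label they are independent, and with a single label they have mean zero. *)
Definition bad_pair (c d : seq V) :=
  [&& cycle_path c, cycle_path d, share c d & no_single (cycle_edges c ++ cycle_edges d)].

Lemma bad_pair_rot s t c d : bad_pair (rot s c) (rot t d) = bad_pair c d.
Proof.
rewrite /bad_pair !cycle_path_rot; congr [&& _, _, _ & _].
  rewrite /share (perm_has _ (cycle_edges_rot t d)); apply: eq_has => a /=.
  exact: (perm_mem (cycle_edges_rot s c)).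
by apply: no_single_perm; apply: perm_cat; apply: cycle_edges_rot.
Qed.

(** An endpoint of a shared label lies on both walks. *)
Lemma bad_pair_meet k (c d : k.-tuple V) : bad_pair c d ->
  exists s t : 'I_k.+1, base (rot s c) = base (rot t d).
Proof.
move=> /and4P[_ _ /hasP[a /cycle_edges_mem[u' [v' [-> uc' vc']]]] + _].
rewrite /= => /cycle_edges_mem[u [v [/el_inj e uc vc]]].
have uc2 : u' \in c by case: e => [[-> _]|[-> _]].
have lt z (e' : k.-tuple V) : z \in e' -> ((index z e').+1 < k.+1)%N.
  by rewrite -index_mem size_tuple ltnS.
exists (Ordinal (lt _ _ uc2)), (Ordinal (lt _ _ uc')).
by rewrite !base_rot.
Qed.

Context (R : rcfType) (w : R).
Hypothesis w1 : 1 <= w.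
Hypothesis degw : forall y, #|adj y|%:R <= w.

Let w0 : 0 < w. Proof. exact: lt_le_trans ltr01 w1. Qed.

(** Markov's inequality for the weights of [walk_weight]. *)
Lemma few_fresh m u x : (\sum_(p : m.-tuple V)
   (path adj x p && (fresh [:: x] p <= u)%N)%:R) <= w ^+ u * m.+2%:R ^+ m.
Proof.
have := @walk_weight V adj R w m x [:: x] w0 degw; rewrite /= add1n => h.
rewrite -(ler_pM2l (exprn_gt0 u w0)) in h; apply: le_trans h.
rewrite mulr_sumr; apply: ler_sum => p _.
case: (path adj x p) => /=; last by rewrite mul0r mulr0.
rewrite mul1r; case: leqP => fu /=; last first.
  by rewrite mulr_ge0 ?exprn_ge0 ?invr_ge0 ?(ltW w0).
rewrite exprVn -(subnK fu) exprD mulfK ?expf_neq0 ?gt_eqF //.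
exact: exprn_ege1.
Qed.

(** Rotate both walks to a common starting point, in at most [k.+2 ^ 2] ways.  Their
concatenation is one closed walk which discovers at most [k] vertices by
[pair_bound].  Compared with the square of [#|V| * w ^ ((k + 1) / 2)], the order
of a trace, this gains the factor [#|V| * w]. *)
Lemma bad_pair_count k :
  \sum_(c : k.+1.-tuple V) \sum_(d : k.+1.-tuple V) (bad_pair c d)%:R <=
  k.+2%:R ^+ 2 * (#|V|%:R * (w ^+ k * (k.+1 + k.+1).+2%:R ^+ (k.+1 + k.+1))) :> R.
Proof.
set K := k.+1.
pose B (c d : seq V) := bad_pair c d && (base c == base d).
have rotbij s : {on [pred _ | true], bijective (fun c : K.-tuple V => [tuple of rot s c])}.
  exists (fun c : K.-tuple V => [tuple of rotr s c]) => c _; apply: val_inj => /=.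
    exact: rotK.
  exact: rotrK.
apply: (@le_trans _ _ (\sum_(s : 'I_K.+1) \sum_(t : 'I_K.+1)
   \sum_(c : K.-tuple V) \sum_(d : K.-tuple V) (B (rot s c) (rot t d))%:R)).
  have -> : \sum_(s < K.+1) \sum_(t < K.+1) \sum_(c : K.-tuple V)
      \sum_(d : K.-tuple V) (B (rot s c) (rot t d))%:R =
    \sum_(c : K.-tuple V) \sum_(d : K.-tuple V) \sum_(s < K.+1) \sum_(t < K.+1)
      (B (rot s c) (rot t d))%:R :> R.
    under eq_bigr do rewrite exchange_big.
    rewrite exchange_big; apply: eq_bigr => c _ /=.
    by rewrite [RHS]exchange_big; apply: eq_bigr => s _; rewrite exchange_big.
  apply: ler_sum => c _; apply: ler_sum => d _ /=.
  case: (boolP (bad_pair c d)) => [bcd|_] /=; last first.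
    by do 2!(apply: sumr_ge0 => ? _); rewrite ler0n.
  have [s [t e]] := bad_pair_meet bcd.
  rewrite (bigD1 s) //= (bigD1 t) //= {1}/B bad_pair_rot bcd e eqxx /=.
  rewrite -addrA lerDl addr_ge0 //.
    by apply: sumr_ge0 => ? _; rewrite ler0n.
  by do 2!(apply: sumr_ge0 => ? _); rewrite ler0n.
set S : R := \sum_(c : K.-tuple V) \sum_(d : K.-tuple V) (B c d)%:R.
have -> : \sum_(s : 'I_K.+1) \sum_(t : 'I_K.+1)
   \sum_(c : K.-tuple V) \sum_(d : K.-tuple V) (B (rot s c) (rot t d))%:R = K.+1%:R ^+ 2 * S.
  rewrite (eq_bigr (fun=> \sum_(t : 'I_K.+1) S)); last first.
    move=> s _; apply: eq_bigr => t _.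
    rewrite /S [RHS](reindex _ (rotbij s)); apply: eq_bigr => c _ /=.
    by rewrite [RHS](reindex _ (rotbij t)).
  by rewrite !sumr_const !card_ord -mulrnA expr2 -natrM mulr_natl.
rewrite ler_wpM2l ?exprn_ge0 ?ler0n //.
apply: (@le_trans _ _ (\sum_(r : V) \sum_(p : (K + K).-tuple V)
   (path adj r p && (fresh [:: r] p <= k)%N)%:R)); last first.
  rewrite mulr_natl -sumr_const; apply: ler_sum => r _; exact: few_fresh.
pose G r c := \sum_(d : K.-tuple V) (path adj r (c ++ d) && (fresh [:: r] (c ++ d) <= k)%N)%:R : R.
have -> : \sum_(r : V) \sum_(p : (K + K).-tuple V)
   (path adj r p && (fresh [:: r] p <= k)%N)%:R = \sum_r \sum_(c : K.-tuple V) G r c :> R.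
  apply: eq_bigr => r _.
  by rewrite -(sum_tupleD K K (fun p => (path adj r p && (fresh [:: r] p <= k)%N)%:R)).
apply: (@le_trans _ _ (\sum_r \sum_(c : K.-tuple V) (last r c == r)%:R * G r c)); last first.
  apply: ler_sum => r _; apply: ler_sum => c _.
  case: eqP; rewrite ?mul1r // mul0r => _.
  by apply: sumr_ge0 => ? _; rewrite ler0n.
rewrite sum_closed; apply: ler_sum => c _; apply: ler_sum => d _.
rewrite ler_nat; case: (boolP (B c d)) => // /andP[/and4P[cc cd sh ns] /eqP rt].
have lc : last (base c) c = base c by case/tupleP: c {cc sh ns rt}.
rewrite cat_path lc [in X in _ && X && _]rt.
rewrite -/(cycle_path c) cc -/(cycle_path d) cd /=.
have /hasP[a ad ac] := sh.
have nss b : count_mem b (walk_edges el (base c) (c ++ d)) != 1%N.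
  by rewrite walk_edges_cat lc {2}rt; move/forallP: ns => /(_ b).
have := pair_bound elC el_inj lc ac _ nss.
rewrite {1}rt => /(_ ad).
rewrite size_cat !size_tuple mul2n /K addnn ltn_double ltnS => ->; done.
Qed.

(** By [closed_bound], [2 * fresh] misses [k] by at least one, which costs a factor
[sqrt w]. *)
Lemma non_tree_walk_count k r : \sum_(p : k.-tuple V)
   [&& path adj r p, no_single (walk_edges el r p) & ~~ tree_walk r [::] [:: r] p]%:R
   <= Num.sqrt w ^+ k.-1 * k.+2%:R ^+ k.
Proof.
set s := Num.sqrt w.
have s2 : s ^+ 2 = w by rewrite sqr_sqrtr // ltW.
have s1 : 1 <= s by rewrite -[leLHS]sqrtr1 ler_wsqrtr.
have s0 : 0 < s by exact: lt_le_trans ltr01 s1.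
have := @walk_weight V adj R w k r [:: r] w0 degw; rewrite /= add1n => h.
rewrite -(ler_pM2l (exprn_gt0 k.-1 s0)) in h; apply: le_trans h.
rewrite mulr_sumr; apply: ler_sum => p _.
case: (path adj r p) => /=; last by rewrite mul0r mulr0.
case: (boolP (_ && _)) => [/andP[/forallP ns ng]|_] /=; last first.
  by rewrite !mulr_ge0 ?exprn_ge0 ?invr_ge0 ?(ltW w0) ?(ltW s0).
have := proj2 (closed_bound elC el_inj ns) ng; rewrite size_tuple => fk.
rewrite mul1r -s2 exprVn -exprM.
have {}fk : (2 * fresh [:: r] p <= k.-1)%N by lia.
rewrite -(subnK fk) exprD mulfK ?expf_neq0 ?gt_eqF //.
exact: exprn_ege1.
Qed.

End closed_walks.

(** * Sampling with replacement *)
Section sampling.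
Context (R : realFieldType) (n : nat) (x : 'I_n -> R) (E : finType).
Hypothesis n0 : (0 < n)%N.

Definition emp_moment (a : nat) : R := n%:R^-1 * \sum_i x i ^+ a.

(** The average over all maps from labels to indices.  Unlike the injective ones,
they make the values at different labels independent. *)
Definition sample (F : {ffun E -> 'I_n} -> R) : R :=
  (n%:R ^+ #|E|)^-1 * \sum_t F t.

Lemma sampleD F G : sample (fun t => F t + G t) = sample F + sample G.
Proof. by rewrite /sample big_split mulrDr. Qed.

Lemma sampleZ c F : sample (fun t => c * F t) = c * sample F.
Proof. by rewrite /sample -mulr_sumr mulrCA. Qed.

Lemma sample_sum (I : finType) (P : pred I) F :
  sample (fun t => \sum_(i | P i) F i t) = \sum_(i | P i) sample (F i).
Proof. by rewrite /sample exchange_big mulr_sumr. Qed.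

Let nn0 : n%:R != 0 :> R. Proof. by rewrite pnatr_eq0 -lt0n. Qed.

Lemma sample_cst c : sample (fun=> c) = c.
Proof.
rewrite /sample sumr_const card_ffun card_ord -[c *+ _]mulr_natl natrX mulrA mulVf ?mul1r //.
by rewrite expf_neq0.
Qed.

Lemma eq_sample F G : F =1 G -> sample F = sample G.
Proof. by move=> FG; rewrite /sample (eq_bigr _ (fun t _ => FG t)). Qed.

Definition monomial (s : seq E) (t : {ffun E -> 'I_n}) : R := \prod_(l <- s) x (t l).

Lemma emp_moment0 : emp_moment 0 = 1.
Proof.
rewrite /emp_moment (eq_bigr (fun=> 1)) // sumr_const card_ord.
by rewrite mulVf.
Qed.

Lemma sample_monomial s : sample (monomial s) = \prod_e emp_moment (count_mem e s).
Proof.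
rewrite /sample /monomial.
have -> : \sum_(t : {ffun E -> 'I_n}) \prod_(l <- s) x (t l) =
          \sum_(t : {ffun E -> 'I_n}) \prod_e x (t e) ^+ count_mem e s.
  apply: eq_bigr => t _; elim: s => [|a s IH].
    by rewrite big_nil big1 // => e _; rewrite expr0.
  rewrite big_cons IH [RHS](bigD1 a) //= eqxx add1n exprS -mulrA [in LHS](bigD1 a) //=.
  congr (_ * (_ * _)); apply: eq_bigr => e ea.
  by rewrite [a == e]eq_sym (negbTE ea) add0n.
rewrite -(bigA_distr_bigA (fun e i => x i ^+ count_mem e s)) /=.
rewrite /emp_moment big_split /=; congr (_ * _).
by rewrite prodr_const exprVn.
Qed.

Lemma sample_monomial_single s : emp_moment 1 = 0 -> ~~ no_single s ->
  sample (monomial s) = 0.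
Proof.
move=> p1 /forallPn[a]; rewrite negbK => /eqP ca.
by rewrite sample_monomial (bigD1 a) //= ca p1 mul0r.
Qed.

Lemma sample_monomial_double s :
  (forall a, (count_mem a s == 0%N) || (count_mem a s == 2)) ->
  sample (monomial s) = emp_moment 2 ^+ (size s)./2.
Proof.
move=> s02; rewrite sample_monomial.
rewrite (eq_bigr (fun e => if e \in s then emp_moment 2 else 1)); last first.
  move=> e _; case: ifPn => [|/count_memPn ->]; last exact: emp_moment0.
  by rewrite -has_pred1 has_count; case/orP: (s02 e) => /eqP ->.
rewrite -big_mkcond prodr_const; congr (_ ^+ _).
suff -> : size s = (#|[pred e in s]| * 2)%N by rewrite muln2 doubleK.
rewrite -sum_nat_const -sum1_size.
have -> : (\sum_(j <- s) 1 = \sum_e count_mem e s)%N.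
  elim: s {s02} => [|a s IH]; first by rewrite big_nil big1.
  rewrite big_cons IH /= big_split /=; congr addn.
  by rewrite (bigD1 a) //= eqxx big1 // => e; rewrite eq_sym => /negbTE ->.
rewrite [RHS]big_mkcond; apply: eq_bigr => e _ /=.
case: ifPn => [|/count_memPn -> //].
by rewrite -has_pred1 has_count; case/orP: (s02 e) => /eqP ->.
Qed.

Lemma sample_monomial_indep s1 s2 : ~~ has (mem s1) s2 ->
  sample (monomial (s1 ++ s2)) = sample (monomial s1) * sample (monomial s2).
Proof.
move=> /hasPn h; rewrite !sample_monomial -big_split; apply: eq_bigr => e _ /=.
rewrite count_cat; case: (boolP (e \in s2)) => [/h /count_memPn ->|/count_memPn ->].
  by rewrite emp_moment0 mul1r.
by rewrite emp_moment0 mulr1 addn0.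
Qed.

Lemma emp_moment_even_ge0 m : ~~ odd m -> 0 <= emp_moment m.
Proof.
move=> em; rewrite mulr_ge0 ?invr_ge0 ?ler0n // sumr_ge0 // => i _.
exact: exprn_even_ge0.
Qed.

Lemma normr_emp_moment a m : ~~ odd m -> (a <= m)%N -> `|emp_moment a| <= 1 + emp_moment m.
Proof.
move=> em am; rewrite -emp_moment0 /emp_moment -mulrDr normrM ger0_norm ?invr_ge0 ?ler0n //.
apply: ler_wpM2l; first by rewrite invr_ge0 ler0n.
rewrite -big_split /= (le_trans (ler_norm_sum _ _ _)) // ler_sum // => i _.
rewrite expr0 normrX; have [x1|x1] := leP `|x i| 1.
  apply: (@le_trans _ _ 1); first exact: exprn_ile1.
  by rewrite lerDl exprn_even_ge0.
rewrite -[x i ^+ m]ger0_norm ?exprn_even_ge0 // normrX.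
apply: (le_trans (ler_weXn2l (ltW x1) am)); lra.
Qed.

Lemma sample_monomial_bound s m : ~~ odd m -> (size s <= m)%N ->
  `|sample (monomial s)| <= (1 + emp_moment m) ^+ size s.
Proof.
move=> em sm; set Q := 1 + emp_moment m.
have Q1 : 1 <= Q by rewrite lerDl emp_moment_even_ge0.
rewrite sample_monomial normr_prod.
have -> : (size s = \sum_e count_mem e s)%N.
  elim: s {sm} => [|a s IH]; first by rewrite big1.
  rewrite /= IH big_split /= -add1n; congr addn.
  by rewrite (bigD1 a) //= eqxx big1 // => e; rewrite eq_sym => /negbTE ->.
rewrite -prodrXr; apply: ler_prod => e _; rewrite normr_ge0 /=.
case E1 : (count_mem e s) => [|c]; first by rewrite emp_moment0 normr1 expr0.
apply: le_trans (normr_emp_moment em _) _.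
  by rewrite -E1 (leq_trans (count_size _ _)).
by rewrite -/Q -[leLHS]expr1 ler_weXn2l.
Qed.

End sampling.

Section sample_trace.
Context (V : finType) (adj : rel V) (x0 : V).
Context (E : finType) (el : V -> V -> E).
Hypothesis adjC : symmetric adj.
Hypothesis elC : forall x y, el x y = el y x.
Hypothesis el_inj : forall x y x' y', el x y = el x' y' ->
  (x = x' /\ y = y') \/ (x = y' /\ y = x').
Context (R : rcfType) (w : R).
Hypothesis w1 : 1 <= w.
Hypothesis degw : forall y, #|adj y|%:R <= w.
Context (n : nat) (x : 'I_n -> R).
Hypothesis n0 : (0 < n)%N.
Hypothesis mean0 : emp_moment x 1 = 0.

Let w0 : 0 < w. Proof. exact: lt_le_trans ltr01 w1. Qed.
Let s := Num.sqrt w.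
Let s2 : s ^+ 2 = w. Proof. by rewrite sqr_sqrtr // ltW. Qed.
Let s1 : 1 <= s. Proof. by rewrite -[leLHS]sqrtr1 ler_wsqrtr. Qed.
Let s0 : 0 < s. Proof. exact: lt_le_trans ltr01 s1. Qed.

Definition walk_sum k (y : E -> R) : R := \sum_i \sum_(p : k.-tuple V)
    (path adj i p && (last i p == i))%:R * \prod_(l <- walk_edges el i p) y l.

Lemma walk_sumE k y : walk_sum k.+1 y = \sum_(c : k.+1.-tuple V)
  (cycle_path adj x0 c)%:R * \prod_(l <- cycle_edges x0 el c) y l.
Proof.
rewrite -(sum_closed x0 k (fun i p => (path adj i p)%:R * \prod_(l <- walk_edges el i p) y l)).
apply: eq_bigr => i _; apply: eq_bigr => p _.
by rewrite mulrA -natrM mulnb andbC.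
Qed.

Let T k (t : {ffun E -> 'I_n}) := walk_sum k (fun l => x (t l)).

Lemma size_walk_edges i p : size (walk_edges el i p) = size p.
Proof. exact: size_pairmap. Qed.

(** After expanding the square over pairs of closed walks only the [bad_pair]s
survive. *)
Lemma sample_var k m : ~~ odd m -> (k.+1 + k.+1 <= m)%N ->
  sample (fun t => (T k.+1 t - sample (T k.+1)) ^+ 2) <=
  2 * (1 + emp_moment x m) ^+ (k.+1 + k.+1) *
  (k.+2%:R ^+ 2 * (#|V|%:R * (w ^+ k * (k.+1 + k.+1).+2%:R ^+ (k.+1 + k.+1)))).
Proof.
move=> em km; set K := k.+1; set M := sample (T K).
pose cc (c : seq V) := cycle_path adj x0 c.
pose mo (c : seq V) := @monomial R n x E (cycle_edges x0 el c).
have ME : M = \sum_(c : K.-tuple V) (cc c)%:R * sample (mo c).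
  rewrite /M (eq_sample (fun t => walk_sumE k (fun l => x (t l)))).
  by rewrite sample_sum; apply: eq_bigr => c _; rewrite sampleZ.
have -> : sample (fun t => (T K t - M) ^+ 2) = sample (fun t => T K t ^+ 2) - M ^+ 2.
  rewrite (@eq_sample _ _ _ _ (fun t => T K t ^+ 2 + ((- 2 * M) * T K t + M ^+ 2))).
    by rewrite sampleD sampleD sampleZ sample_cst // -/M; ring.
  by move=> t; ring.
have -> : sample (fun t => T K t ^+ 2) = \sum_(c : K.-tuple V) \sum_(d : K.-tuple V)
    (cc c && cc d)%:R * sample (@monomial R n x E (cycle_edges x0 el c ++ cycle_edges x0 el d)).
  rewrite (@eq_sample _ _ _ _ (fun t => \sum_(c : K.-tuple V) \sum_(d : K.-tuple V)
    (cc c && cc d)%:R * monomial x (cycle_edges x0 el c ++ cycle_edges x0 el d) t)).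
    rewrite sample_sum; apply: eq_bigr => c _.
    by rewrite sample_sum; apply: eq_bigr => d _; rewrite sampleZ.
  move=> t; rewrite /T walk_sumE expr2 mulr_suml; apply: eq_bigr => c _.
  rewrite mulr_sumr; apply: eq_bigr => d _.
  by rewrite mulrACA -natrM mulnb /monomial big_cat.
have -> : M ^+ 2 = \sum_(c : K.-tuple V) \sum_(d : K.-tuple V)
    (cc c && cc d)%:R * (sample (mo c) * sample (mo d)).
  rewrite expr2 ME mulr_suml; apply: eq_bigr => c _.
  rewrite mulr_sumr; apply: eq_bigr => d _.
  by rewrite mulrACA -natrM mulnb.
rewrite -sumrB; set B := 2 * _.
apply: (@le_trans _ _ (B * \sum_(c : K.-tuple V) \sum_(d : K.-tuple V)
    (bad_pair adj x0 el c d)%:R)); last first.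
  apply: ler_wpM2l; last exact: bad_pair_count.
  by rewrite mulr_ge0 ?exprn_ge0 // addr_ge0 ?emp_moment_even_ge0.
rewrite mulr_sumr; apply: ler_sum => c _; rewrite -sumrB mulr_sumr.
apply: ler_sum => d _; rewrite -mulrBr.
have B0 : 0 <= B by rewrite mulr_ge0 ?exprn_ge0 // addr_ge0 ?emp_moment_even_ge0.
rewrite /bad_pair -/(cc c) -/(cc d).
case: (cc c) => /=; last by rewrite mul0r mulr0.
case: (cc d) => /=; last by rewrite mul0r mulr0.
rewrite mul1r.
case: (boolP (share _ _ _ _)) => [sh|nsh] /=; last first.
  by rewrite mulr0 sample_monomial_indep // subrr.
case: (boolP (no_single _)) => ns /=; last first.
  rewrite mulr0 sample_monomial_single //.
  case: (boolP (no_single (cycle_edges x0 el c))) => nc; last first.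
    by rewrite [sample (mo c)]sample_monomial_single // mul0r subrr.
  case: (boolP (no_single (cycle_edges x0 el d))) => nd; last first.
    by rewrite [sample (mo d)]sample_monomial_single // mulr0 subrr.
  case/negP: ns; apply/forallP => a; rewrite count_cat.
  move/forallP: nc => /(_ a); move/forallP: nd => /(_ a).
  by case: (count_mem a _) => [|[|?]] //; case: (count_mem a _) => [|[|?]].
have szc (c' : K.-tuple V) : size (cycle_edges x0 el c') = K by rewrite size_walk_edges size_tuple.
rewrite mulr1 (le_trans (ler_norm _)) // (le_trans (ler_normB _ _)) //.
rewrite /B mulr_natl mulr2n lerD //.
  rewrite (le_trans (sample_monomial_bound _ n0 em _)) // ?size_cat ?szc //.
rewrite normrM exprD; apply: ler_pM => //.
  by rewrite (le_trans (sample_monomial_bound _ n0 em _)) ?szc // (leq_trans _ km) // leq_addr.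
by rewrite (le_trans (sample_monomial_bound _ n0 em _)) ?szc // (leq_trans _ km) // leq_addr.
Qed.

Definition tree_walk_total k : R := \sum_i \sum_(p : k.-tuple V)
  (path adj i p && tree_walk i [::] [:: i] p)%:R.

Lemma tree_walk_closed (i : V) st vis p : tree_walk i st vis p -> last i p = last i st.
Proof.
elim: p i st vis => [|z p IH] i st vis /=; first by move/eqP->.
case: ifPn => zv; first by move/IH.
by case: st => // y st /andP[/eqP -> /IH ->].
Qed.

(** Walks with a single label have mean zero, the contour walks of trees all have
the mean [emp_moment x 2 ^+ k./2], and the remaining ones are rare. *)
Lemma sample_mean k m : (0 < k)%N -> ~~ odd m -> (k <= m)%N ->
  `|sample (T k) - tree_walk_total k * emp_moment x 2 ^+ k./2| <=
  (1 + emp_moment x m) ^+ k * (#|V|%:R * (s ^+ k.-1 * k.+2%:R ^+ k)).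
Proof.
move=> k0 em km.
have -> : sample (T k) - tree_walk_total k * emp_moment x 2 ^+ k./2 =
  \sum_i \sum_(p : k.-tuple V) ([&& path adj i p, last i p == i, no_single (walk_edges el i p)
     & ~~ tree_walk i [::] [:: i] p]%:R * sample (@monomial R n x E (walk_edges el i p))).
  rewrite /T /walk_sum sample_sum /tree_walk_total mulr_suml -sumrB.
  apply: eq_bigr => i _; rewrite sample_sum mulr_suml -sumrB.
  apply: eq_bigr => p _; rewrite sampleZ -/(monomial _ _).
  case: (path adj i p); rewrite ?mul0r ?subrr //=.
  case: (boolP (tree_walk _ _ _ _)) => g /=.
    have gc a := tree_walk_edge_count elC el_inj a g.
    rewrite (tree_walk_closed g) eqxx /= andbF mul0r !mul1r.
    by rewrite (sample_monomial_double _ n0 gc) size_walk_edges size_tuple subrr.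
  rewrite mul0r subr0 andbT; case: (last i p == i); rewrite ?mul0r //= mul1r.
  case: (boolP (no_single _)) => ns; rewrite ?mul1r // mul0r.
  by rewrite sample_monomial_single.
apply: le_trans (ler_norm_sum _ _ _) _.
rewrite mulrCA mulr_natl -sumr_const; apply: ler_sum => i _.
apply: le_trans (ler_norm_sum _ _ _) _.
apply: (@le_trans _ _ ((1 + emp_moment x m) ^+ k * \sum_(p : k.-tuple V)
   [&& path adj i p, no_single (walk_edges el i p) & ~~ tree_walk i [::] [:: i] p]%:R)); last first.
  apply: ler_wpM2l; last exact: non_tree_walk_count.
  by rewrite exprn_ge0 // addr_ge0 ?emp_moment_even_ge0.
rewrite mulr_sumr; apply: ler_sum => p _.
rewrite normrM mulrC normr_nat; apply: ler_pM; rewrite ?normr_ge0 ?ler0n //.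
  rewrite -{2}(size_tuple p) -(size_walk_edges i p).
  by apply: sample_monomial_bound => //; rewrite size_walk_edges size_tuple.
rewrite ler_nat; case: (path adj i p) => //=; case: (last i p == i) => //=.
Qed.

Lemma tree_walk_total_ub k : tree_walk_total k <= (ballot k 0)%:R * s ^+ k * #|V|%:R.
Proof.
rewrite mulr_natr -sumr_const; apply: ler_sum => i _.
have := @tree_walk_count_ub V adj R s k i [::] [:: i] s0.
rewrite /= expr0 mulr1; apply=> y; by rewrite s2.
Qed.

Lemma tree_walk_total_lb k (t : R) (G : pred V) (H : V -> nat -> pred V) : 0 < t ->
  (forall r, r \in G -> H r 0 r) ->
  (forall r h x y, H r h x -> adj x y -> H r h.+1 y) ->
  (forall r h x, r \in G -> H r h x -> (h <= k)%N -> t ^+ 2 + k%:R <= #|adj x|%:R) ->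
  (ballot k 0)%:R * t ^+ k * #|G|%:R <= tree_walk_total k.
Proof.
move=> t0 H0 HS Hd; rewrite mulr_natr -sumr_const big_mkcond.
apply: ler_sum => i _; case: ifP => iG; last by apply: sumr_ge0 => ? _; rewrite ler0n.
have := @tree_walk_count_lb V adj adjC R t k (H i) t0 (HS i) _ k i [::] [:: i].
rewrite /= expr0 mulr1; apply=> //; last by move=> [|] // _; apply: H0.
by move=> h y; apply: Hd.
Qed.

End sample_trace.

(** * Resolvents and the trace norm *)
Section diagonalization.
Import complex.
Local Open Scope complex_scope.

(** The spectral theorem over [R[i]] makes [A] similar to a real diagonal matrix, and
real matrices that are similar over [R[i]] are similar over [R]. *)
Lemma symmetric_diagonalizable (R : rcfType) n (A : 'M[R]_n) : A^T = A ->
  exists2 P : 'M[R]_n, P \in unitmx & exists d : 'rV[R]_n,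
    P *m A = diag_mx d *m P.
Proof.
move=> As; pose rc : {rmorphism R -> R[i]} := real_complex R.
pose AC := map_mx rc A.
have rcreal (x : R) : rc x \is Num.real by rewrite complex_real.
have ACr : AC \is a mxOver Num.real by apply/mxOverP => i j; rewrite mxE.
have ACh : AC \is hermsymmx.
  apply: realsym_hermsym => //; apply/is_hermitianmxP.
  rewrite expr0 scale1r; apply/matrixP => i j; rewrite !mxE.
  by rewrite -{1}As mxE.
have /hermitian_normalmx/orthomx_spectralP Ae := ACh.
have dr := hermitian_spectral_diag_real ACh.
have Dr : diag_mx (spectral_diag AC) \is a mxOver Num.real.
  apply/mxOverP => i j; rewrite mxE; case: eqP => _; rewrite ?mulr1n ?mulr0n ?real0 //.
  by move/mxOverP: dr; apply.
have sim : similar_in unitmx AC (diag_mx (spectral_diag AC)).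
  exists (spectralmx AC); first exact: spectral_unit.
  move: Ae (spectral_unit AC); set Q := spectralmx AC; set D := diag_mx _ => Ae Qu.
  apply/eqP; rewrite conjumx // [in X in X = _]Ae.
  by rewrite !mulmxA mulmxV // mul1mx mulmxK.
have [Q /andP[/= Qr Qu] /eqP QA] := real_similar sim ACr Dr.
pose P := map_mx (@complex.Re R) Q.
have QE : Q = map_mx rc P.
  apply/matrixP => i j; rewrite !mxE; symmetry; apply: RRe_real.
  by move/mxOverP: Qr; apply.
exists P; first by move: Qu; rewrite QE map_unitmx.
exists (map_mx (@complex.Re R) (spectral_diag AC)).
have DE : diag_mx (spectral_diag AC) = map_mx rc (diag_mx (map_mx (@complex.Re R) (spectral_diag AC))).
  rewrite map_diag_mx; congr diag_mx; apply/matrixP => i j; rewrite !mxE.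
  by symmetry; apply: RRe_real; move/mxOverP: dr; apply.
have {}QA : Q *m AC = diag_mx (spectral_diag AC) *m Q.
  by rewrite -QA conjumx // mulmxKV.
move: QA; rewrite QE {1}DE -!map_mxM => /matrixP QA.
by apply/matrixP => i j; move: (QA i j); rewrite !mxE => /complexI.
Qed.

End diagonalization.

Section resolvent.
Context (R : realFieldType) (n : nat).
Implicit Types (A B C D E K P : 'M[R]_n) (u v : 'cV[R]_n).

Definition normsq v : R := \sum_i v i 0 ^+ 2.

Lemma normsqE v : normsq v = (v^T *m v) 0 0.
Proof. by rewrite mxE; apply: eq_bigr => i _; rewrite mxE expr2. Qed.

Lemma normsq_ge0 v : 0 <= normsq v.
Proof. by apply: sumr_ge0 => i _; exact: sqr_ge0. Qed.

Definition contraction K := forall v, normsq (K *m v) <= normsq v.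

Lemma contractionM K1 K2 : contraction K1 -> contraction K2 -> contraction (K1 *m K2).
Proof. by move=> c1 c2 v; rewrite -mulmxA; apply: le_trans (c1 _) (c2 _). Qed.

Lemma contraction1 : contraction 1%:M.
Proof. by move=> v; rewrite mul1mx. Qed.

(** A real substitute for the resolvent: both it and its product with [A] are
contractions when [A] is symmetric. *)
Definition resolvent A := invmx (1%:M + A *m A).

Lemma diag_resolvent_unit P A d : P \in unitmx -> P *m A = diag_mx d *m P ->
  1%:M + A *m A \in unitmx /\
  P *m resolvent A = diag_mx (\row_i (1 + d 0 i ^+ 2)^-1) *m P.
Proof.
move=> Pu PA.
have PA2 : P *m (1%:M + A *m A) = diag_mx (\row_i (1 + d 0 i ^+ 2)) *m P.
  rewrite mulmxDr mulmx1 mulmxA PA -mulmxA PA mulmxA mulmx_diag.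
  have -> : diag_mx (\row_i (1 + d 0 i ^+ 2)) = 1%:M + diag_mx (\row_j (d 0 j * d 0 j)).
    by apply/matrixP => i j; rewrite !mxE; case: eqP => [->|]; rewrite ?mulr1n ?mulr0n ?addr0 // expr2.
  by rewrite mulmxDl mul1mx.
have d0 i : 1 + d 0 i ^+ 2 != 0.
  by rewrite gt_eqF // ltr_pwDl // sqr_ge0.
pose e := \row_i (1 + d 0 i ^+ 2)^-1.
have eD : diag_mx e *m diag_mx (\row_i (1 + d 0 i ^+ 2)) = 1%:M.
  rewrite mulmx_diag; apply/matrixP => i j; rewrite !mxE; case: eqP => [->|]; rewrite ?mulr1n ?mulr0n //.
  by rewrite mulVf.
have u : 1%:M + A *m A \in unitmx.
  have : P *m (1%:M + A *m A) \in unitmx.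
    by rewrite PA2 unitmx_mul Pu andbT; have [] := mulmx1_unit eD.
  by rewrite unitmx_mul => /andP[].
split=> //.
rewrite -/e -[LHS]mul1mx -eD -[LHS]mulmxA [X in _ *m X]mulmxA -PA2.
by rewrite -[X in _ *m X]mulmxA mulmxV // mulmx1.
Qed.

Lemma diag_exp P A d k : P *m A = diag_mx d *m P ->
  P *m A ^+ k = diag_mx (\row_i d 0 i ^+ k) *m P.
Proof.
move=> PA; elim: k => [|k IH].
  rewrite expr0 mulmx1 -[LHS]mul1mx; congr (_ *m _).
  by apply/matrixP => i j; rewrite !mxE expr0.
rewrite exprS mulmxA PA -mulmxA IH mulmxA mulmx_diag; congr (diag_mx _ *m _).
by apply/matrixP => i j; rewrite !mxE exprS.
Qed.

Lemma diag_trace P A d : P \in unitmx -> P *m A = diag_mx d *m P ->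
  \tr A = \sum_i d 0 i.
Proof.
move=> Pu PA; have -> : A = invmx P *m (diag_mx d *m P) by rewrite -PA mulKmx.
by rewrite mxtrace_mulC -mulmxA mulmxV // mulmx1 mxtrace_diag.
Qed.

Lemma diag_char_poly P A d : P \in unitmx -> P *m A = diag_mx d *m P ->
  char_poly A = \prod_i ('X - (d 0 i)%:P).
Proof.
move=> Pu PA.
have -> : char_poly A = char_poly (diag_mx d).
  rewrite /char_poly.
  have e : map_mx polyC P *m char_poly_mx A = char_poly_mx (diag_mx d) *m map_mx polyC P.
    rewrite /char_poly_mx mulmxBr mulmxBl -!map_mxM PA; congr (_ - _).
    by rewrite scalar_mxC.
  have := congr1 determinant e; rewrite !det_mulmx [RHS]mulrC.
  apply: mulfI; rewrite det_map_mx polyC_eq0 -unitfE.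
  by rewrite -unitmxE.
rewrite char_poly_trig; last first.
  by apply: diag_mx_is_trig.
by apply: eq_bigr => i _; rewrite mxE eqxx mulr1n.
Qed.

Section symmetric.
Context (A : 'M[R]_n) (As : A^T = A) (Au : 1%:M + A *m A \in unitmx).

Lemma resolvent_split v : normsq v =
  normsq (resolvent A *m v) + 2 * normsq (A *m resolvent A *m v) + normsq (A *m A *m resolvent A *m v).
Proof.
set u := resolvent A *m v.
have -> : A *m resolvent A *m v = A *m u by rewrite mulmxA.
have -> : A *m A *m resolvent A *m v = A *m A *m u by rewrite !mulmxA.
have {1}-> : v = u + A *m A *m u.
  by rewrite -{1}[u]mul1mx -mulmxDl /u /resolvent mulKVmx.
clearbody u; rewrite !normsqE.
have -> : (A *m u)^T *m (A *m u) = u^T *m (A *m A *m u).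
  by rewrite trmx_mul As !mulmxA.
have -> : (u + A *m A *m u)^T = u^T + (A *m A *m u)^T by rewrite linearD.
rewrite mulmxDl !mulmxDr.
have E (X Y : 'M[R]_1) : (X + Y) 0 0 = X 0 0 + Y 0 0 by rewrite mxE.
rewrite !E.
have -> : (A *m A *m u)^T *m u = u^T *m (A *m A *m u).
  by rewrite !trmx_mul As !mulmxA.
by ring.
Qed.

Lemma resolvent_contraction : contraction (resolvent A).
Proof.
move=> v; rewrite (resolvent_split v).
have := normsq_ge0 (A *m resolvent A *m v); have := normsq_ge0 (A *m A *m resolvent A *m v).
lra.
Qed.

Lemma resolvent_mul_contraction : contraction (A *m resolvent A).
Proof.
move=> v; rewrite (resolvent_split v).
have := normsq_ge0 (A *m resolvent A *m v); have := normsq_ge0 (A *m A *m resolvent A *m v).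
have := normsq_ge0 (resolvent A *m v); lra.
Qed.

Lemma resolvent_comm : A *m resolvent A = resolvent A *m A.
Proof.
rewrite -[LHS](mulKmx Au) -[in RHS]/(resolvent A) -/(resolvent A); congr (_ *m _).
rewrite !mulmxA mulmxDl mul1mx -{1}[A]mulmx1 -!mulmxA -!mulmxDr.
by rewrite -mulmxA mulmxV // mulmx1.
Qed.
End symmetric.

(** The trace norm, bounded through its duality with the operator norm. *)
Definition trace_norm_le E (d : R) :=
  forall K, contraction K -> `|\tr (K *m E)| <= d.

Lemma trace_norm_leD E F d e : trace_norm_le E d -> trace_norm_le F e ->
  trace_norm_le (E + F) (d + e).
Proof.
move=> hE hF K cK; rewrite mulmxDr mxtraceD (le_trans (ler_normD _ _)) //.
by rewrite lerD ?hE ?hF.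
Qed.

Lemma trace_norm_leZ E d c : trace_norm_le E d -> trace_norm_le (c *: E) (`|c| * d).
Proof.
by move=> hE K cK; rewrite -scalemxAr mxtraceZ normrM ler_wpM2l ?hE.
Qed.

Lemma trace_norm_leM E d K1 K2 : contraction K1 -> contraction K2 ->
  trace_norm_le E d -> trace_norm_le (K1 *m E *m K2) d.
Proof.
move=> c1 c2 hE K cK; rewrite mulmxA mxtrace_mulC !mulmxA.
by apply: hE; do 2?apply: contractionM.
Qed.

Lemma trace_norm_le0 : trace_norm_le 0 0.
Proof. by move=> K _; rewrite mulmx0 linear0 normr0. Qed.

(** The difference is [resolvent A] times [B^2 - A^2 = (B - A) B + A (B - A)] times
[resolvent B], where each unbounded factor is absorbed by a resolvent. *)
Lemma resolvent_diff A B d : A^T = A -> B^T = B ->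
  1%:M + A *m A \in unitmx -> 1%:M + B *m B \in unitmx ->
  trace_norm_le (B - A) d -> trace_norm_le (resolvent A - resolvent B) (d + d).
Proof.
move=> As Bs Au Bu h.
have -> : resolvent A - resolvent B =
   resolvent A *m (B - A) *m (B *m resolvent B) + (A *m resolvent A) *m (B - A) *m resolvent B.
  rewrite (resolvent_comm Au).
  have -> : resolvent A *m (B - A) *m (B *m resolvent B) + resolvent A *m A *m (B - A) *m resolvent B =
    resolvent A *m ((B - A) *m B + A *m (B - A)) *m resolvent B.
    by move: (B - A) => D'; rewrite mulmxDr mulmxDl !mulmxA.
  have -> : (B - A) *m B + A *m (B - A) = (1%:M + B *m B) - (1%:M + A *m A).
    by rewrite mulmxBl mulmxBr addrA subrK opprD addrACA subrr add0r.
  rewrite mulmxBr mulmxBl.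
  by rewrite /resolvent mulmxK // mulVmx // mul1mx.
apply: trace_norm_leD; apply: trace_norm_leM => //;
  by [exact: resolvent_contraction|exact: resolvent_mul_contraction].
Qed.

Lemma contraction_exp K k : contraction K -> contraction (K ^+ k).
Proof.
move=> cK; elim: k => [|k IH]; first by rewrite expr0; exact: contraction1.
by rewrite exprS; exact: contractionM.
Qed.

Lemma exp_diff K L d k : contraction K -> contraction L ->
  trace_norm_le (K - L) d -> trace_norm_le (K ^+ k - L ^+ k) (k%:R * d).
Proof.
move=> cK cL h; elim: k => [|k IH].
  by rewrite !expr0 subrr mul0r; exact: trace_norm_le0.
have -> : K ^+ k.+1 - L ^+ k.+1 = K *m (K ^+ k - L ^+ k) *m 1%:M + 1%:M *m (K - L) *m L ^+ k.
  by rewrite !exprS mulmx1 mul1mx mulmxBl mulmxBr addrA subrK.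
rewrite -natr1 mulrDl mul1r; apply: trace_norm_leD; apply: trace_norm_leM => //;
  by [exact: contraction1|exact: contraction_exp].
Qed.

Lemma trace_resolvent_diff A B d k : A^T = A -> B^T = B ->
  1%:M + A *m A \in unitmx -> 1%:M + B *m B \in unitmx ->
  trace_norm_le (B - A) d ->
  `|\tr (resolvent A ^+ k) - \tr (resolvent B ^+ k)| <= k%:R * (d + d).
Proof.
move=> As Bs Au Bu h.
have := exp_diff k (resolvent_contraction As Au) (resolvent_contraction Bs Bu) (resolvent_diff As Bs Au Bu h).
by move=> /(_ _ contraction1); rewrite mul1mx linearB.
Qed.

Lemma trace_norm_le_trans E d e : d <= e -> trace_norm_le E d -> trace_norm_le E e.
Proof. by move=> de h K cK; apply: le_trans (h _ cK) de. Qed.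

Lemma trace_norm_le_sum (I : finType) (F : I -> 'M[R]_n) (d : R) :
  (forall i, trace_norm_le (F i) d) -> trace_norm_le (\sum_i F i) (#|I|%:R * d).
Proof.
move=> h K cK; rewrite mulmx_sumr linear_sum /= (le_trans (ler_norm_sum _ _ _)) //.
by rewrite mulr_natl -sumr_const ler_sum // => i _; exact: h.
Qed.

(** The Cauchy-Schwarz inequality; the square root of [s * t] is passed as [r], since
the field may have no square roots. *)
Lemma dot_bound (I : finType) (a b : I -> R) (s t r : R) :
  \sum_i a i ^+ 2 <= s -> \sum_i b i ^+ 2 <= t -> 0 < t -> 0 < r -> r ^+ 2 = s * t ->
  `|\sum_i a i * b i| <= r.
Proof.
move=> hs ht t0 r0 rst.
suff H (e : R) : `|e| = 1 -> e * (\sum_i a i * b i) <= r.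
  have := H 1 (normr1 _); rewrite mul1r => h1.
  have := H (-1) (normrN1 _); rewrite mulN1r => h2.
  by rewrite ler_norml; apply/andP; split; lra.
move=> e1.
have e2 : e ^+ 2 = 1 by rewrite -real_normK ?num_real // e1 expr1n.
have : \sum_i (e * t * a i - r * b i) ^+ 2 >= 0.
  by apply: sumr_ge0 => i _; exact: sqr_ge0.
have -> : \sum_i (e * t * a i - r * b i) ^+ 2 =
  t ^+ 2 * (\sum_i a i ^+ 2) + r ^+ 2 * (\sum_i b i ^+ 2) -
  2 * t * r * (e * \sum_i a i * b i).
  rewrite !mulr_sumr -big_split /= -sumrB; apply: eq_bigr => i _.
  have -> : (e * t * a i - r * b i) ^+ 2 = e ^+ 2 * t ^+ 2 * a i ^+ 2
     + r ^+ 2 * b i ^+ 2 - 2 * t * r * (e * (a i * b i)) by ring.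
  by rewrite e2 mul1r.
rewrite subr_ge0 => h.
have : 2 * t * r * (e * \sum_i a i * b i) <= 2 * t * r * r.
  apply: le_trans h _.
  apply: (@le_trans _ _ (t ^+ 2 * s + r ^+ 2 * t)).
    by rewrite lerD // ler_wpM2l // ?sqr_ge0.
  rewrite le_eqVlt; apply/orP; left; apply/eqP.
  have -> : t ^+ 2 * s = t * r ^+ 2 by rewrite rst; ring.
  by ring.
by rewrite ler_pM2l // !mulr_gt0.
Qed.

Lemma trace_norm_rank1 u v s t r : normsq u <= s -> normsq v <= t ->
  0 < t -> 0 < r -> r ^+ 2 = s * t -> trace_norm_le (u *m v^T) r.
Proof.
move=> us vt t0 r0 rst K cK.
rewrite mulmxA mxtrace_mulC.
have -> : \tr (v^T *m (K *m u)) = \sum_i (K *m u) i 0 * v i 0.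
  rewrite /mxtrace big_ord1 [LHS]mxE.
  by apply: eq_bigr => i _; rewrite [v^T _ _]mxE mulrC.
apply: (@dot_bound _ _ _ s t r _ vt) => //.
exact: le_trans (cK u) us.
Qed.

Lemma contraction_frobenius K : contraction K -> \sum_i \sum_j K i j ^+ 2 <= n%:R.
Proof.
move=> cK; rewrite exchange_big /= -[n in leRHS]card_ord -sumr_const.
apply: ler_sum => j _.
have := cK (delta_mx j 0); rewrite /normsq.
have -> : \sum_i (delta_mx j 0 : 'cV[R]_n) i 0 ^+ 2 = 1.
  rewrite (bigD1 j) //= mxE !eqxx expr1n big1 ?addr0 // => i ij.
  by rewrite mxE (negbTE ij) expr0n.
apply: le_trans; apply: ler_sum => i _.
by rewrite -colE mxE.
Qed.

Lemma trace_norm_frobenius E e r : \sum_i \sum_j E i j ^+ 2 <= e -> 0 < e ->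
  0 < r -> r ^+ 2 = n%:R * e -> trace_norm_le E r.
Proof.
move=> Ee e0 r0 rne K cK.
have -> : \tr (K *m E) = \sum_(p : 'I_n * 'I_n) K p.1 p.2 * E p.2 p.1.
  by rewrite -(pair_big xpredT xpredT (fun i j => K i j * E j i)); apply: eq_bigr => i _; rewrite mxE.
apply: (dot_bound (s := n%:R) (t := e)) => //.
  by rewrite -(pair_big xpredT xpredT (fun i j => K i j ^+ 2)); exact: contraction_frobenius.
rewrite -(pair_big xpredT xpredT (fun i j => E j i ^+ 2)) exchange_big.
exact: Ee.
Qed.

End resolvent.

(** * Weierstrass approximation *)
Section weierstrass.
Context {R : realType}.
Implicit Types (f : R -> R) (g : nat -> R) (x : R).

(** The mean of [g] at a binomial variable with parameters [n] and [x], by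
conditioning on the first trial. *)
Fixpoint bernstein_at (x : R) (n : nat) (g : nat -> R) : R :=
  if n is m.+1 then
    x * bernstein_at x m (fun k => g k.+1) + (1 - x) * bernstein_at x m g
  else g 0.

Fixpoint bernstein (n : nat) (g : nat -> R) : {poly R} :=
  if n is m.+1 then
    'X * bernstein m (fun k => g k.+1) + (1 - 'X) * bernstein m g
  else (g 0)%:P.

Lemma horner_bernstein n g x : (bernstein n g).[x] = bernstein_at x n g.
Proof. by elim: n g => [|n IH] g /=; rewrite !hornerE // !IH. Qed.

Lemma bernstein_at_le x n g h : 0 <= x <= 1 -> (forall k, g k <= h k) ->
  bernstein_at x n g <= bernstein_at x n h.
Proof.
move=> /andP[x0 x1]; elim: n g h => [|n IH] g h gh //=.
by rewrite lerD // ler_wpM2l ?subr_ge0 ?IH // => k; exact: gh.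
Qed.

Lemma bernstein_at_affine x n (a c : R) g :
  bernstein_at x n (fun k => a * g k + c) = a * bernstein_at x n g + c.
Proof.
by elim: n g => [|n IH] g //=; rewrite (IH g) (IH (g \o S)) /=; ring.
Qed.

(** The second moment of the binomial distribution around [c]. *)
Lemma bernstein_at_var x n c :
  bernstein_at x n (fun k => (k%:R - c) ^+ 2) = n%:R * (x * (1 - x)) + (n%:R * x - c) ^+ 2.
Proof.
elim: n c => [|n IH] c /=; first by ring.
have -> : bernstein_at x n (fun k => (k.+1%:R - c) ^+ 2) =
  bernstein_at x n (fun k => (k%:R - (c - 1)) ^+ 2).
  by congr bernstein_at; apply: funext => k; rewrite -natr1; ring.
by rewrite !IH -natr1; ring.
Qed.

(** Uniform continuity in the form that suits Bernstein's proof: the second term is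
controlled by the variance of the binomial distribution. *)
Lemma quadratic_modulus f (M a b eps : R) : continuous f -> (forall x, `|f x| <= M) -> 0 < eps ->
  exists C : R, 0 <= C /\
    forall x y, a <= x <= b -> `|f x - f y| <= eps + C * (x - y) ^+ 2.
Proof.
move=> cf fM e0.
have M0 : 0 <= M by apply: le_trans (fM 0).
have e20 : 0 < eps / 2 by rewrite divr_gt0.
have H : \forall C \near +oo, `[a, b] `<=`
    (fun x => forall y, `|f x - f y| <= eps + C * (x - y) ^+ 2).
  apply: (compact_near_coveringP _).1; first exact: segment_compact.
  move=> x _.
  have [dl /= d0 dP] : exists2 d : R, 0 < d & forall z, `|x - z| < d -> `|f x - f z| < eps / 2.
    have /cvgrPdist_lt/(_ _ e20)/nbhs_ballP[d /= d0 dP] := cf x.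
    by exists d => // z xz; exact: (dP z).
  near=> x' C => y.
  have xx' : `|x - x'| < dl / 2.
    by near: x'; apply: (nbhsx_ballx x (dl / 2)); rewrite divr_gt0.
  have C0 : M * 8 / dl ^+ 2 <= C by near: C; apply: nbhs_pinfty_ge; rewrite num_real.
  have C0' : 0 <= C by apply: le_trans C0; rewrite !mulr_ge0 ?invr_ge0 ?exprn_ge0 // ltW.
  have [xy|xy] := ltP `|x' - y| (dl / 2).
    rewrite -[leLHS]addr0 /= lerD //; last by apply: mulr_ge0 => //; exact: sqr_ge0.
    have -> : f x' - f y = (f x - f y) - (f x - f x') by ring.
    have h1 : `|f x - f y| < eps / 2.
      apply: dP; have -> : x - y = (x - x') + (x' - y) by ring.
      by rewrite (le_lt_trans (ler_normD _ _)) // [ltRHS](splitr dl) ltrD.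
    have h2 : `|f x - f x'| < eps / 2.
      by apply: dP; apply: lt_trans xx' _; rewrite ltr_pdivrMr // ltr_pMr // ltr1n.
    by rewrite (le_trans (ler_normB _ _)) // [leRHS](splitr eps) lerD // ltW.
  apply: (le_trans (ler_normB _ _)); apply: (@le_trans _ _ (M + M)); first exact: lerD.
  rewrite -[leLHS]add0r /=; apply: lerD; first exact: ltW.
  apply: (@le_trans _ _ (M * 8 / dl ^+ 2 * (dl / 2) ^+ 2)).
    have -> : M * 8 / dl ^+ 2 * (dl / 2) ^+ 2 = M + M by field; rewrite gt_eqF.
    by [].
  have dd : 0 <= dl / 2 by rewrite divr_ge0 // ltW.
  apply: ler_pM => //.
  - by rewrite !mulr_ge0 ?invr_ge0 ?exprn_ge0 // ltW.
  - exact: exprn_ge0.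
  by rewrite -[leRHS]real_normK ?num_real // lerXn2r ?nnegrE ?normr_ge0.
have [C [C0 HC]] : exists C : R, 0 <= C /\ (`[a, b] `<=`
    (fun x => forall y, `|f x - f y| <= eps + C * (x - y) ^+ 2)).
  near (pinfty_nbhs R) => C; exists C; split; first by near: C; apply: nbhs_pinfty_ge; rewrite num_real.
  by near: C.
exists C; split=> // x y xab; apply: HC; by rewrite /= in_itv.
Unshelve. all: by end_near. Qed.

Lemma weierstrass01 f (M eps : R) : continuous f -> (forall x, `|f x| <= M) -> 0 < eps ->
  exists p : {poly R}, forall x, 0 <= x <= 1 -> `|f x - p.[x]| <= eps.
Proof.
move=> cf fM e0; have e20 : 0 < eps / 2 by rewrite divr_gt0.
have [C [C0 HC]] := quadratic_modulus 0 1 cf fM e20.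
pose n := (Num.truncn (C / (eps / 2))).+1.
have n0 : 0 < n%:R :> R by rewrite ltr0n.
have Cn : C / n%:R <= eps / 2.
  rewrite ler_pdivrMr // mulrC -ler_pdivrMr // ltW // /n.
  exact: truncnS_gt.
exists (bernstein n (fun k => f (k%:R / n%:R))) => x x01.
have bnd : bernstein_at x n (fun k => eps / 2 + C * (x - k%:R / n%:R) ^+ 2) <= eps.
  have -> : bernstein_at x n (fun k => eps / 2 + C * (x - k%:R / n%:R) ^+ 2) =
     bernstein_at x n (fun k => (C / n%:R ^+ 2) * (k%:R - n%:R * x) ^+ 2 + eps / 2).
    congr bernstein_at; apply: funext => k; rewrite addrC; congr (_ + _).
    by field; rewrite gt_eqF.
  rewrite bernstein_at_affine bernstein_at_var subrr expr0n addr0.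
  rewrite [leRHS](splitr eps) lerD2r.
  apply: le_trans Cn.
  have -> : C / n%:R ^+ 2 * (n%:R * (x * (1 - x))) = C / n%:R * (x * (1 - x)).
    by field; rewrite gt_eqF.
  rewrite ler_piMr ?divr_ge0 ?ler0n //.
  by move/andP: x01 => [x0 x1]; nra.
rewrite horner_bernstein ler_norml; apply/andP; split.
  rewrite lerNl opprB (le_trans _ bnd) //.
  have -> : bernstein_at x n (fun k => f (k%:R / n%:R)) - f x =
     bernstein_at x n (fun k => 1 * f (k%:R / n%:R) + - f x).
    by rewrite bernstein_at_affine mul1r.
  apply: bernstein_at_le => // k; rewrite mul1r (le_trans _ (HC x _ x01)) //.
  by rewrite -normrN opprB ler_norm.
rewrite (le_trans _ bnd) //.
have -> : f x - bernstein_at x n (fun k => f (k%:R / n%:R)) =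
     bernstein_at x n (fun k => -1 * f (k%:R / n%:R) + f x).
  by rewrite bernstein_at_affine mulN1r addrC.
apply: bernstein_at_le => // k; rewrite mulN1r addrC (le_trans _ (HC x _ x01)) //.
exact: ler_norm.
Qed.

Lemma weierstrass f (M K eps : R) : continuous f -> (forall x, `|f x| <= M) ->
  0 < K -> 0 < eps ->
  exists p : {poly R}, forall x, `|x| <= K -> `|f x - p.[x]| <= eps.
Proof.
move=> cf fM K0 e0.
pose g y := f (2 * K * y - K).
have cg : continuous g.
  move=> y; apply: (@continuous_comp _ _ _ (fun y : R => 2 * K * y - K) f); last exact: cf.
  apply: continuousB; last exact: cst_continuous.
  by apply: continuousM; [exact: cst_continuous | exact: cvg_id].
have [p pP] := weierstrass01 cg (fun x => fM _) e0.
exists (p \Po ((2 * K)^-1 *: ('X + K%:P))) => x xK.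
rewrite horner_comp !hornerE.
have := pP ((2 * K)^-1 * (x + K)).
rewrite /g.
have -> : 2 * K * ((2 * K)^-1 * (x + K)) - K = x by field; rewrite gt_eqF.
apply; move: xK; rewrite ler_norml => /andP[x1 x2].
have K2 : 0 < 2 * K by rewrite mulr_gt0.
apply/andP; split; first by rewrite mulr_ge0 ?invr_ge0 ?(ltW K2) //; lra.
by rewrite mulrC ler_pdivrMr //; lra.
Qed.

End weierstrass.

(** * Criteria for weak convergence *)
Section moments.
Context {R : realType}.
Local Notation measureR := {measure set (measurableTypeR R) -> \bar R}.
Implicit Types (mu nu : measureR) (f g h : R -> R).

Definition has_moments mu : Prop := mu setT = 1%E /\
  forall k, mu.-integrable setT (fun x : R => (x ^+ k)%:E).

Definition bounded_by f (M : R) := forall x, `|f x| <= M.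

Lemma integrable_cst mu (c : R) : mu setT = 1%E -> mu.-integrable setT (EFin \o cst c).
Proof.
move=> mu1; apply/integrableP; split; first exact/measurable_EFinP/measurable_cst.
rewrite (eq_integral (cst `|c|%:E)) //.
by rewrite integral_cst //= mu1 mule1 ltry.
Qed.

Lemma integrable_bounded mu f M : mu setT = 1%E -> continuous f -> bounded_by f M ->
  mu.-integrable setT (EFin \o f).
Proof.
move=> mu1 cf fM.
apply: (le_integrable measurableT _ _ (g := cst M%:E)).
- by apply/measurable_EFinP; apply: continuous_measurable_fun.
- move=> x _ /=; rewrite lee_fin (le_trans (fM x)) //; exact: ler_norm.
- exact: integrable_cst.
Qed.

Lemma Rintegral_close mu f g h : mu.-integrable setT (EFin \o f) ->
  mu.-integrable setT (EFin \o g) -> mu.-integrable setT (EFin \o h) ->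
  (forall x, `|f x - g x| <= h x) ->
  `|\int[mu]_x f x - \int[mu]_x g x| <= \int[mu]_x h x.
Proof.
move=> intf intg inth fgh.
have intfg : mu.-integrable setT (EFin \o (fun x => f x - g x)).
  by have := integrableB measurableT intf intg; apply: eq_integrable.
rewrite -RintegralB //.
apply: (le_trans (le_normr_Rintegral measurableT intfg)).
apply: le_Rintegral => //.
by have := integrable_abse intfg; apply: eq_integrable.
Qed.

Lemma RintegralC mu (c : R) : mu setT = 1%E -> \int[mu]_x c = c.
Proof. by move=> mu1; rewrite Rintegral_cst // mu1 mulr1. Qed.

Lemma integrable_affine mu f (a c : R) : mu setT = 1%E -> mu.-integrable setT (EFin \o f) ->
  mu.-integrable setT (EFin \o (fun x => a + c * f x)).
Proof.
move=> mu1 intf.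
have : mu.-integrable setT (EFin \o (fun x => c * f x)).
  by have := integrableZl measurableT c intf; apply: eq_integrable.
have : mu.-integrable setT (EFin \o cst a).
  exact: integrable_cst.
by move=> h1 h2; have := integrableD measurableT h1 h2; apply: eq_integrable.
Qed.

Lemma Rintegral_affine mu f (a c : R) : mu setT = 1%E -> mu.-integrable setT (EFin \o f) ->
  \int[mu]_x (a + c * f x) = a + c * \int[mu]_x f x.
Proof.
move=> mu1 intf.
have h2 : mu.-integrable setT (EFin \o (fun x => c * f x)).
  by have := integrableZl measurableT c intf; apply: eq_integrable.
have h1 : mu.-integrable setT (EFin \o cst a).
  exact: integrable_cst.
by rewrite RintegralD // RintegralC // RintegralZl.
Qed.

Lemma integrable_sum_fun mu n (F : nat -> R -> R) : mu setT = 1%E ->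
  (forall i, mu.-integrable setT (EFin \o F i)) ->
  mu.-integrable setT (EFin \o (fun x => \sum_(i < n) F i x)) /\
  \int[mu]_x (\sum_(i < n) F i x) = \sum_(i < n) \int[mu]_x F i x.
Proof.
move=> mu1 intF; elim: n => [|n [IH1 IH2]].
  rewrite big_ord0; split; last first.
    rewrite (_ : (fun x => _) = cst 0) ?RintegralC //.
    by apply: funext => x; rewrite big_ord0.
  rewrite (_ : (fun x => \sum_(i < 0) F i x) = cst 0); last first.
    by apply: funext => x; rewrite big_ord0.
  exact: integrable_cst.
have E : (fun x => \sum_(i < n.+1) F i x) = (fun x => \sum_(i < n) F i x + F n x).
  by apply: funext => x; rewrite big_ord_recr.
rewrite E; split.
  by have := integrableD measurableT IH1 (intF n); apply: eq_integrable.
by rewrite RintegralD // IH2 big_ord_recr.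
Qed.

Lemma Rintegral_horner mu (p : {poly R}) : has_moments mu ->
  mu.-integrable setT (EFin \o (fun x => p.[x])) /\
  \int[mu]_x p.[x] = \sum_(i < size p) p`_i * \int[mu]_x (x ^+ i).
Proof.
move=> [mu1 im].
have H i : mu.-integrable setT (EFin \o (fun x => p`_i * x ^+ i)).
  by have := integrableZl measurableT p`_i (im i); apply: eq_integrable.
have [h1 h2] := integrable_sum_fun (size p) mu1 H.
have E : (fun x => p.[x]) = (fun x => \sum_(i < size p) p`_i * x ^+ i).
  by apply: funext => x; rewrite horner_coef.
rewrite E; split=> //; rewrite h2; apply: eq_bigr => i _.
by rewrite RintegralZl //; exact: im.
Qed.

Lemma pow_tail (p : {poly R}) (M : R) : exists D : R, exists q : nat, 0 <= D /\
  forall x : R, 1 <= `|x| -> M + `|p.[x]| <= D * x ^+ (2 * q).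
Proof.
pose D := `|M| + \sum_(i < size p) `|p`_i|.
exists D, (size p); split.
  by rewrite addr_ge0 // sumr_ge0.
move=> x x1.
have x2 : x ^+ (2 * size p) = `|x| ^+ (2 * size p) by rewrite -normrX ger0_norm // exprn_even_ge0 // oddM.
have x21 : 1 <= `|x| ^+ (2 * size p) by rewrite exprn_ege1.
rewrite x2 /D mulrDl lerD //.
  by rewrite (le_trans (ler_norm _)) // ler_peMr.
rewrite horner_coef (le_trans (ler_norm_sum _ _ _)) // mulr_suml ler_sum // => i _.
rewrite normrM ler_wpM2l // normrX ler_weXn2l //.
by rewrite (leq_trans (ltnW (ltn_ord i))) // leq_pmull.
Qed.

Lemma cvg_sum_ord n (F : nat -> nat -> R) (l : nat -> R) :
  (forall i, F i j @[j --> \oo] --> l i) ->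
  \sum_(i < n) F i j @[j --> \oo] --> \sum_(i < n) l i.
Proof.
move=> H; elim: n => [|n IH].
  rewrite big_ord0 (_ : (fun j => _) = cst 0); first exact: cvg_cst.
  by apply: funext => j; rewrite big_ord0.
rewrite big_ord_recr (_ : (fun j => _) = (fun j => \sum_(i < n) F i j + F n j)).
  exact: cvgD.
by apply: funext => j; rewrite big_ord_recr.
Qed.

(** On [-K, K] with [K = rho + 1] the function is close to a polynomial [p].
Outside, the error is at most a multiple of [x ^ (2 * (q + l)) / K ^ (2 * l)], and
the limit of its integral is of order [(rho / K) ^ (2 * l)]. *)
Lemma moments_weak_cvg (mu_ : nat -> measureR) mu (rho : R) :
  (forall j, has_moments (mu_ j)) -> has_moments mu -> 1 <= rho ->
  (forall k, \int[mu]_x (x ^+ (2 * k)) <= rho ^+ (2 * k)) ->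
  (forall k, \int[mu_ j]_x (x ^+ k) @[j --> \oo] --> \int[mu]_x (x ^+ k)) ->
  forall f M, continuous f -> bounded_by f M ->
  \int[mu_ j]_x f x @[j --> \oo] --> \int[mu]_x f x.
Proof.
move=> hm_ hm rho1 growth cvgm f M cf fM.
have M0 : 0 <= M by apply: le_trans (fM 0).
apply/cvgrPdist_le => e e0.
pose e4 := e / 8; have e40 : 0 < e4 by rewrite divr_gt0.
pose K := rho + 1; have K0 : 0 < K by rewrite /K; lra.
have K1 : 1 <= K by rewrite /K; lra.
have [p pP] := weierstrass cf fM K0 e40.
have [D [q [D0 DP]]] := pow_tail p M.
have r1 : `|(rho / K) ^+ 2| < 1.
  have q0 : 0 <= rho / K by rewrite divr_ge0 //; lra.
  have q1 : rho / K < 1 by rewrite ltr_pdivrMr // mul1r /K; lra.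
  by rewrite ger0_norm ?sqr_ge0 // expr2; nra.
have [l lP] : exists l : nat, D * rho ^+ (2 * q) * ((rho / K) ^+ 2) ^+ l <= e4.
  have c : D * rho ^+ (2 * q) * ((rho / K) ^+ 2) ^+ l @[l --> \oo] -->
      D * rho ^+ (2 * q) * 0 by apply: cvgMr; exact: cvg_expr.
  have [l _ /(_ l (leqnn l))] := (@cvgrPdist_le _ _ _ _ _ _ _).1 c _ e40.
  by rewrite mulr0 sub0r normrN => /(le_trans (ler_norm _)); exists l.
(* Outside [-K, K] the bound [D x ^ (2 q)] may be multiplied by [(x / K) ^ (2 l)], which exceeds 1. *)
pose W := K^-1 ^+ (2 * l) * D.
have W0 : 0 <= W by rewrite mulr_ge0 // exprn_ge0 // invr_ge0 ltW.
pose g x := e4 + W * x ^+ (2 * (q + l)).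
have fpg x : `|f x - p.[x]| <= g x.
  have [xK|xK] := leP `|x| K.
    rewrite (le_trans (pP x xK)) // lerDl mulr_ge0 // exprn_even_ge0 // oddM //.
  have x1 : 1 <= `|x| by rewrite (le_trans K1) // ltW.
  apply: (le_trans (ler_normB _ _)); apply: (@le_trans _ _ (M + `|p.[x]|)).
    by rewrite lerD.
  apply: (le_trans (DP x x1)).
  rewrite /g /W -[leLHS]add0r; apply: lerD; first exact: ltW.
  rewrite [K^-1 ^+ _ * D]mulrC -mulrA ler_wpM2l //.
  rewrite mulnDr exprD mulrCA ler_peMr //.
    by rewrite exprn_even_ge0 // oddM.
  rewrite -exprMn exprM exprn_ege1 // exprMn exprVn -[x ^+ 2]real_normK ?num_real //.
  rewrite mulrC ler_pdivlMr ?exprn_gt0 // mul1r lerXn2r ?nnegrE ?(ltW K0) //.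
  exact: ltW.
have Wm : W * \int[mu]_x (x ^+ (2 * (q + l))) <= e4.
  apply: le_trans lP; apply: (@le_trans _ _ (W * rho ^+ (2 * (q + l)))).
    by rewrite ler_wpM2l.
  have -> : ((rho / K) ^+ 2) ^+ l = rho ^+ (2 * l) * K^-1 ^+ (2 * l).
    by rewrite -exprM exprMn.
  by rewrite /W mulnDr exprD le_eqVlt; apply/orP; left; apply/eqP; ring.
have close nu : has_moments nu -> `|\int[nu]_x f x - \int[nu]_x p.[x]| <=
   e4 + W * \int[nu]_x (x ^+ (2 * (q + l))).
  move=> hn; have [n1 nm] := hn; have [ip _] := Rintegral_horner p hn.
  rewrite -Rintegral_affine //; last exact: nm.
  apply: Rintegral_close => //; first exact: integrable_bounded fM.
  by apply: integrable_affine => //; exact: nm.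
have cp : \int[mu_ j]_x p.[x] @[j --> \oo] --> \int[mu]_x p.[x].
  rewrite (Rintegral_horner p hm).2.
  rewrite (_ : (fun j => _) = (fun j => \sum_(i < size p) p`_i * \int[mu_ j]_x (x ^+ i))); last first.
    by apply: funext => j; rewrite (Rintegral_horner p (hm_ j)).2.
  apply: (@cvg_sum_ord (size p) (fun i j => p`_i * \int[mu_ j]_x (x ^+ i))
    (fun i => p`_i * \int[mu]_x (x ^+ i))) => i.
  by apply: cvgMr; exact: cvgm.
have cW : W * \int[mu_ j]_x (x ^+ (2 * (q + l))) @[j --> \oo] -->
   W * \int[mu]_x (x ^+ (2 * (q + l))) by apply: cvgMr; exact: cvgm.
near=> j.
have h1 : `|\int[mu]_x p.[x] - \int[mu_ j]_x p.[x]| <= e4.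
  by near: j; move/cvgrPdist_le: cp; apply.
have h2 : `|W * \int[mu]_x (x ^+ (2 * (q + l))) - W * \int[mu_ j]_x (x ^+ (2 * (q + l)))| <= e4.
  by near: j; move/cvgrPdist_le: cW; apply.
have h3 := close _ hm; have h4 := close _ (hm_ j).
move: h1 h2 h3 h4; rewrite !ler_norml => /andP[h1 h1'] /andP[h2 h2'] /andP[h3 h3'] /andP[h4 h4'].
have -> : e = 8 * e4 by rewrite /e4; field.
by apply/andP; split; lra.
Unshelve. all: by end_near. Qed.

(** The powers of these functions serve as test functions, because their integrals
against eigenvalue measures are traces of powers of resolvents. *)
Definition cauchy (t a x : R) : R := (1 + (t * x - a) ^+ 2)^-1.

Lemma cauchy01 t a x : 0 < cauchy t a x <= 1.
Proof.
have h := sqr_ge0 (t * x - a).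
rewrite invr_gt0 invf_le1 ?ltr_pwDl // lerDl h; by [].
Qed.

Lemma continuous_cauchy_exp t a k : continuous (fun x => cauchy t a x ^+ k).
Proof.
move=> x; apply: (@continuous_comp _ _ _ (cauchy t a) (fun y => y ^+ k)); last exact: exprn_continuous.
apply: continuousV; first by rewrite gt_eqF // ltr_pwDl // sqr_ge0.
apply: continuousD; first exact: cst_continuous.
apply: (@continuous_comp _ _ _ (fun x => t * x - a) (fun y => y ^+ 2)); last exact: exprn_continuous.
apply: continuousB; last exact: cst_continuous.
by apply: continuousM; [exact: cst_continuous | exact: cvg_id].
Qed.

Lemma cauchy_exp_bounded t a k : bounded_by (fun x => cauchy t a x ^+ k) 1.
Proof.
move=> x; have /andP[c0 c1] := cauchy01 t a x.
by rewrite ger0_norm ?exprn_ge0 ?(ltW c0) // exprn_ile1 // ltW.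
Qed.

Lemma Rintegral_horner_cauchy mu t a (p : {poly R}) : mu setT = 1%E ->
  mu.-integrable setT (EFin \o (fun x => p.[cauchy t a x])) /\
  \int[mu]_x p.[cauchy t a x] = \sum_(i < size p) p`_i * \int[mu]_x (cauchy t a x ^+ i).
Proof.
move=> mu1.
have ic i : mu.-integrable setT (EFin \o (fun x => cauchy t a x ^+ i)).
  apply: integrable_bounded (@cauchy_exp_bounded t a i) => //.
  exact: continuous_cauchy_exp.
have H i : mu.-integrable setT (EFin \o (fun x => p`_i * cauchy t a x ^+ i)).
  by have := integrableZl measurableT p`_i (ic i); apply: eq_integrable.
have [h1 h2] := integrable_sum_fun (size p) mu1 H.
have E : (fun x => p.[cauchy t a x]) = (fun x => \sum_(i < size p) p`_i * cauchy t a x ^+ i).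
  by apply: funext => x; rewrite horner_coef.
rewrite E; split=> //; rewrite h2; apply: eq_bigr => i _.
by rewrite RintegralZl //; exact: ic.
Qed.

(** On [-K, K] the function [cauchy 1 (- (K + 1))] is injective; [G] is [f] composed
with an extension of its inverse. *)
Lemma factor_through_cauchy f M K : continuous f -> bounded_by f M -> 0 < K ->
  exists2 G : R -> R, continuous G /\ bounded_by G M &
    forall x, `|x| <= K -> G (cauchy 1 (- (K + 1)) x) = f x.
Proof.
move=> cf fM K0.
pose y0 : R := (1 + (2 * K + 1) ^+ 2)^-1.
have y00 : 0 < y0 by rewrite invr_gt0 ltr_pwDl // sqr_ge0.
pose s y : R := Num.sqrt ((Num.max y y0)^-1 - 1) - (K + 1).
exists (fun y => f (s y)); first split.
- move=> y; apply: (@continuous_comp _ _ _ s f); last exact: cf.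
  apply: continuousB; last exact: cst_continuous.
  apply: (@continuous_comp _ _ _ (fun y => (Num.max y y0)^-1 - 1) (@Num.sqrt R)); last exact: sqrt_continuous.
  apply: continuousB; last exact: cst_continuous.
  apply: continuousV; first by rewrite gt_eqF // lt_max y00 orbT.
  by apply: continuous_max; [exact: cvg_id | exact: cst_continuous].
- by move=> y; exact: fM.
move=> x; rewrite ler_norml => /andP[x1 x2]; congr f; rewrite /s.
have -> : Num.max (cauchy 1 (- (K + 1)) x) y0 = cauchy 1 (- (K + 1)) x.
  apply/max_idPl; rewrite lef_pV2 ?posrE ?ltr_pwDl ?sqr_ge0 // lerD2l.
  by rewrite mul1r opprK lerXn2r ?nnegrE; lra.
rewrite /cauchy invrK mul1r opprK addrAC subrr add0r sqrtr_sqr ger0_norm; lra.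
Qed.

(** On [-K, K] the function [f] is close to a polynomial in [cauchy 1 (- (K + 1))].
The error outside is bounded through [1 - cauchy K^-1 0], again a test function,
whose integral against [mu] is small by Chebyshev's inequality. *)
Lemma cauchy_weak_cvg (mu_ : nat -> measureR) mu :
  (forall j, mu_ j setT = 1%E) -> has_moments mu ->
  (forall t a k, \int[mu_ j]_x (cauchy t a x ^+ k) @[j --> \oo] -->
     \int[mu]_x (cauchy t a x ^+ k)) ->
  forall f M, continuous f -> bounded_by f M ->
  \int[mu_ j]_x f x @[j --> \oo] --> \int[mu]_x f x.
Proof.
move=> m1_ hm cvgc f M cf fM; have [m1 im] := hm.
have M0 : 0 <= M by apply: le_trans (fM 0).
apply/cvgrPdist_le => e e0.
pose e4 := e / 16; have e40 : 0 < e4 by rewrite divr_gt0.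
pose V := \int[mu]_x (x ^+ 2).
have V0 : 0 <= V by apply: Rintegral_ge0 => x _; exact: sqr_ge0.
(* Chebyshev: the mass outside [-K, K] is at most [V / K2], which [4 * M] must not spoil. *)
pose K2 := 1 + 4 * M * V / e4.
have K20 : 1 <= K2 by rewrite lerDl divr_ge0 ?mulr_ge0 // ltW.
pose K := Num.sqrt K2.
have KK : K ^+ 2 = K2 by rewrite sqr_sqrtr // (le_trans _ K20).
have K1 : 1 <= K by rewrite -[leLHS]sqrtr1 ler_wsqrtr.
have K0 : 0 < K by apply: lt_le_trans K1.
have [G [cG GM] GE] := factor_through_cauchy cf fM K0.
have [p pP] := weierstrass01 cG GM e40.
pose ca := cauchy 1 (- (K + 1)).
have close nu : nu setT = 1%E -> `|\int[nu]_x f x - \int[nu]_x p.[ca x]| <=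
    e4 + 4 * M + (- (4 * M)) * \int[nu]_x (cauchy K^-1 0 x ^+ 1).
  move=> n1.
  have ic : nu.-integrable setT (EFin \o (fun x => cauchy K^-1 0 x ^+ 1)).
    apply: integrable_bounded (@cauchy_exp_bounded K^-1 0 1) => //.
    exact: continuous_cauchy_exp.
  rewrite -Rintegral_affine //.
  apply: Rintegral_close; first exact: integrable_bounded fM.
  - exact: (Rintegral_horner_cauchy 1 (- (K + 1)) p n1).1.
  - exact: integrable_affine.
  move=> x; have /andP[c0 c1] := cauchy01 1 (- (K + 1)) x.
  have hp := pP (ca x); have {}hp := hp (introT andP (conj (ltW c0) c1)).
  have /andP[d0 d1] := cauchy01 K^-1 0 x.
  rewrite expr1; have [xK|xK] := leP `|x| K.
    rewrite -(GE x xK) (le_trans hp) // -addrA lerDl mulNr subr_ge0.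
    by rewrite ler_piMr // mulr_ge0.
  have d2 : cauchy K^-1 0 x <= 2^-1.
    rewrite lef_pV2 ?posrE ?ltr_pwDl ?sqr_ge0 //.
    have : 1 <= (K^-1 * x - 0) ^+ 2.
      rewrite subr0 exprMn exprVn -[x ^+ 2]real_normK ?num_real // mulrC.
      by rewrite ler_pdivlMr ?exprn_gt0 // mul1r lerXn2r ?nnegrE ?(ltW K0) // ltW.
    lra.
  have -> : f x - p.[ca x] = (f x - G (ca x)) + (G (ca x) - p.[ca x]) by ring.
  apply: (le_trans (ler_normD _ _)).
  have := le_trans (ler_normB (f x) (G (ca x))) (lerD (fM x) (GM (ca x))).
  nra.
have cp : \int[mu_ j]_x p.[ca x] @[j --> \oo] --> \int[mu]_x p.[ca x].
  rewrite (Rintegral_horner_cauchy 1 (- (K + 1)) p m1).2.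
  rewrite (_ : (fun j => _) = (fun j => \sum_(i < size p) p`_i * \int[mu_ j]_x (ca x ^+ i))); last first.
    by apply: funext => j; rewrite (Rintegral_horner_cauchy 1 (- (K + 1)) p (m1_ j)).2.
  apply: (@cvg_sum_ord (size p) (fun i j => p`_i * \int[mu_ j]_x (ca x ^+ i))
    (fun i => p`_i * \int[mu]_x (ca x ^+ i))) => i.
  by apply: cvgMr; exact: cvgc.
have cW : - (4 * M) * \int[mu_ j]_x (cauchy K^-1 0 x ^+ 1) @[j --> \oo] -->
   - (4 * M) * \int[mu]_x (cauchy K^-1 0 x ^+ 1) by apply: cvgMr; exact: cvgc.
have tail : 4 * M + (- (4 * M)) * \int[mu]_x (cauchy K^-1 0 x ^+ 1) <= e4.
  have ic : mu.-integrable setT (EFin \o (fun x => cauchy K^-1 0 x ^+ 1)).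
    apply: integrable_bounded (@cauchy_exp_bounded K^-1 0 1) => //.
    exact: continuous_cauchy_exp.
  have h : \int[mu]_x (1 + (-1) * cauchy K^-1 0 x ^+ 1) <= \int[mu]_x (0 + K2^-1 * x ^+ 2).
    apply: le_Rintegral => //; [exact: integrable_affine | apply: integrable_affine => //; exact: im |].
    move=> x _; rewrite expr1 add0r mulN1r /cauchy subr0 exprMn exprVn KK.
    have u0 : 0 <= K2^-1 * x ^+ 2.
      by rewrite mulr_ge0 ?sqr_ge0 // invr_ge0 (le_trans _ K20).
    move: (K2^-1 * x ^+ 2) u0 => u u0.
    have -> : 1 - (1 + u)^-1 = u * (1 + u)^-1 by field; rewrite gt_eqF //; lra.
    by rewrite ler_piMr // invf_le1; lra.
  move: h; rewrite !Rintegral_affine //; last exact: im.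
  rewrite -/V add0r mulN1r => h.
  have : 4 * M * (1 - \int[mu]_x cauchy K^-1 0 x ^+ 1) <= 4 * M * (K2^-1 * V).
    by rewrite ler_wpM2l // mulr_ge0.
  have : 4 * M * (K2^-1 * V) <= e4.
    rewrite mulrCA mulrC ler_pdivrMr ?(lt_le_trans _ K20) //.
    rewrite /K2 mulrDr mulr1 mulrCA mulfV ?gt_eqF // mulr1 lerDr ltW //.
  lra.
near=> j.
have h1 : `|\int[mu]_x p.[ca x] - \int[mu_ j]_x p.[ca x]| <= e4.
  by near: j; move/cvgrPdist_le: cp; apply.
have h2 : `|- (4 * M) * \int[mu]_x (cauchy K^-1 0 x ^+ 1) -
    - (4 * M) * \int[mu_ j]_x (cauchy K^-1 0 x ^+ 1)| <= e4.
  by near: j; move/cvgrPdist_le: cW; apply.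
have h3 := close _ m1; have h4 := close _ (m1_ j).
move: h1 h2 h3 h4; rewrite !ler_norml => /andP[h1 h1'] /andP[h2 h2'] /andP[h3 h3'] /andP[h4 h4'].
have -> : e = 16 * e4 by rewrite /e4; field.
by apply/andP; split; lra.
Unshelve. all: by end_near. Qed.

End moments.

(** * Eigenvalue measures *)
Section eigenvalue_measures.
Context {R : realType}.

(** The characteristic polynomial determines the list of its roots up to order, so
the eigenvalues are the diagonal entries [d], sorted. *)
Lemma sum_eigenvalues n (A P : 'M[R]_n) (d : 'rV[R]_n) (f : R -> R) :
  P \in unitmx -> P *m A = diag_mx d *m P ->
  \sum_(j < n) f (eigenvalues A)`_j = \sum_i f (d 0 i).
Proof.
move=> Pu PA; pose s := [seq d 0 i | i <- enum 'I_n].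
have cs : char_poly A = \prod_(x <- s) ('X - x%:P).
  by rewrite (diag_char_poly Pu PA) big_map big_enum.
have [_ ce] : sorted <=%R (eigenvalues A) /\
    char_poly A = \prod_(x <- eigenvalues A) ('X - x%:P).
  rewrite /eigenvalues; case: xgetP => [t -> //|/(_ (sort <=%R s))] [].
  split; first exact: sort_le_sorted.
  by rewrite cs; apply: perm_big; rewrite perm_sym perm_sort.
have pe : perm_eq (eigenvalues A) s by apply: prod_XsubC_eq; rewrite -ce -cs.
have -> : \sum_i f (d 0 i) = \sum_(x <- s) f x by rewrite big_map big_enum.
rewrite -(perm_big _ pe) (big_nth 0) big_mkord.
have -> // : size (eigenvalues A) = n.
by rewrite (perm_size pe) size_map size_enum_ord.
Qed.

Lemma ge0_integral_eigenvalue n (A : 'M[R]_n) (g : R -> R) :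
  measurable_fun setT g -> (forall x, 0 <= g x) ->
  (\int[eigenvalue_measure A]_x (g x)%:E)%E =
  (n%:R^-1 * \sum_(j < n) g (eigenvalues A)`_j)%:E.
Proof.
move=> mg g0; have mg' : measurable_fun setT (EFin \o g) by exact/measurable_EFinP.
rewrite /eigenvalue_measure ge0_integral_mscale //; last by move=> x _; rewrite lee_fin.
rewrite ge0_integral_measure_sum //; last by move=> x _; rewrite lee_fin.
rewrite EFinM -sumEFin; congr (_ * _)%E; apply: eq_bigr => i _.
by rewrite integral_dirac // diracT mul1e.
Qed.

Lemma eigenvalue_measureT n (A : 'M[R]_n) : (0 < n)%N ->
  eigenvalue_measure A setT = 1%E.
Proof.
move=> n0; rewrite -[LHS]mul1e -integral_cst //.
rewrite (@ge0_integral_eigenvalue _ _ (cst 1)) //.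
by rewrite sumr_const card_ord mulVf // pnatr_eq0 -lt0n.
Qed.

Lemma integrable_eigenvalue n (A : 'M[R]_n) (f : R -> R) :
  measurable_fun setT f -> (eigenvalue_measure A).-integrable setT (EFin \o f).
Proof.
move=> mf; apply/integrableP; split; first exact/measurable_EFinP.
under eq_integral do rewrite /= .
rewrite (@ge0_integral_eigenvalue _ _ (fun x => `|f x|)) ?ltry //.
exact: measurableT_comp.
Qed.

Lemma Rintegral_eigenvalue n (A : 'M[R]_n) (f : R -> R) : measurable_fun setT f ->
  \int[eigenvalue_measure A]_x f x = n%:R^-1 * \sum_(j < n) f (eigenvalues A)`_j.
Proof.
move=> mf.
have mp : measurable_fun setT (fun x => Num.max (f x) 0) by exact: measurable_maxr.
have mn : measurable_fun setT (fun x => Num.max (- f x) 0).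
  by apply: measurable_maxr => //; exact: measurable_funN.
have -> : f = (fun x => Num.max (f x) 0 - Num.max (- f x) 0).
  apply: funext => x; rewrite /Num.max; case: ltP => h1; case: ltP => h2; lra.
rewrite RintegralB //; [|exact: (integrable_eigenvalue A mp)|exact: (integrable_eigenvalue A mn)].
rewrite /Rintegral !ge0_integral_eigenvalue //=; try by move=> x; rewrite le_max lexx orbT.
by rewrite -mulrBr -sumrB.
Qed.

Lemma has_moments_eigenvalue n (A : 'M[R]_n) : (0 < n)%N ->
  has_moments (eigenvalue_measure A).
Proof.
move=> n0; split; first exact: eigenvalue_measureT.
by move=> k; apply: (@integrable_eigenvalue n A (fun x => x ^+ k)); exact: exprn_measurable.
Qed.

Lemma moment_eigenvalue n (A : 'M[R]_n) k : A^T = A ->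
  \int[eigenvalue_measure A]_x (x ^+ k) = n%:R^-1 * \tr (A ^+ k).
Proof.
move=> As; rewrite (@Rintegral_eigenvalue _ _ (fun x => x ^+ k)); last exact: exprn_measurable.
have [P Pu [d PA]] := symmetric_diagonalizable As.
rewrite (sum_eigenvalues (fun x => x ^+ k) Pu PA) (diag_trace Pu (diag_exp k PA)).
by congr (_ * _); apply: eq_bigr => i _; rewrite mxE.
Qed.

Lemma cauchy_eigenvalue n (A : 'M[R]_n) t a k : A^T = A ->
  \int[eigenvalue_measure A]_x (cauchy t a x ^+ k) =
  n%:R^-1 * \tr (resolvent (t *: A - a%:M) ^+ k) /\
  1%:M + (t *: A - a%:M) *m (t *: A - a%:M) \in unitmx.
Proof.
move=> As; have mf : measurable_fun setT (fun x : R => cauchy t a x ^+ k).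
  by apply: continuous_measurable_fun; exact: continuous_cauchy_exp.
rewrite (Rintegral_eigenvalue A mf).
have [P Pu [d PA]] := symmetric_diagonalizable As.
have PA' : P *m (t *: A - a%:M) = diag_mx (\row_i (t * d 0 i - a)) *m P.
  rewrite mulmxBr -scalemxAr PA scalemxAl scalar_mxC -mulmxBl; congr (_ *m _).
  by apply/matrixP => i j; rewrite !mxE; case: eqP => [->|_]; rewrite ?mulr1n ?mulr0n ?mulr0 ?subrr.
have [u PR] := diag_resolvent_unit Pu PA'.
split=> //; rewrite (sum_eigenvalues (fun x => cauchy t a x ^+ k) Pu PA).
rewrite (diag_trace Pu (diag_exp k PR)).
by congr (_ * _); apply: eq_bigr => i _; rewrite !mxE.
Qed.

Lemma tr_shift n (A : 'M[R]_n) t a : A^T = A -> (t *: A - a%:M)^T = t *: A - a%:M.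
Proof. by move=> As; rewrite linearB linearZ /= As tr_scalar_mx. Qed.

(** The moments of the [A_ j] determine the limit of their eigenvalue measures.  The
test functions [cauchy t a ^+ k] detect the weak limit and, unlike moments, are
insensitive to the perturbation, which is small in trace norm only. *)
Theorem trace_moments_weak_cvg (N_ : nat -> nat) (A_ B_ : forall j, 'M[R]_(N_ j))
    (mu : {measure set (measurableTypeR R) -> \bar R}) (rho : R) :
  (forall j, (0 < N_ j)%N) -> (forall j, (A_ j)^T = A_ j) -> (forall j, (B_ j)^T = B_ j) ->
  has_moments mu -> 1 <= rho ->
  (forall k, \int[mu]_x (x ^+ (2 * k)) <= rho ^+ (2 * k)) ->
  (forall k, (N_ j)%:R^-1 * \tr (A_ j ^+ k) @[j --> \oo] --> \int[mu]_x (x ^+ k)) ->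
  (forall e : R, 0 < e -> \forall j \near \oo,
     trace_norm_le (B_ j - A_ j) (e * (N_ j)%:R)) ->
  forall f M, continuous f -> bounded_by f M ->
  \int[eigenvalue_measure (B_ j)]_x f x @[j --> \oo] --> \int[mu]_x f x.
Proof.
move=> N0 As Bs hm rho1 growth cA cE.
apply: cauchy_weak_cvg => //; first by move=> j; exact: eigenvalue_measureT.
move=> t a k.
have cAc : \int[eigenvalue_measure (A_ j)]_x (cauchy t a x ^+ k) @[j --> \oo] -->
     \int[mu]_x (cauchy t a x ^+ k).
  apply: (moments_weak_cvg (rho := rho) _ hm rho1 growth _ _ (@cauchy_exp_bounded R t a k)).
  - by move=> j; exact: has_moments_eigenvalue.
  - move=> l; rewrite (_ : (fun j => _) = (fun j => (N_ j)%:R^-1 * \tr (A_ j ^+ l))) //.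
    by apply: funext => j; rewrite moment_eigenvalue.
  - exact: continuous_cauchy_exp.
apply/cvgrPdist_le => e e0.
(* A positive Lipschitz constant of the test function with respect to the trace norm. *)
pose L := (2 * k%:R + 1) * (`|t| + 1).
have L0 : 0 < L by rewrite mulr_gt0 // ?ltr_pwDr // mulr_ge0.
have e20 : 0 < e / 2 by rewrite divr_gt0.
near=> j.
have h1 : `|\int[mu]_x (cauchy t a x ^+ k) - \int[eigenvalue_measure (A_ j)]_x (cauchy t a x ^+ k)| <= e / 2.
  by near: j; move/cvgrPdist_le: cAc; apply.
have tn : trace_norm_le (B_ j - A_ j) (e / 2 / L * (N_ j)%:R).
  by near: j; apply: cE; rewrite divr_gt0.
have tri (x y z : R) : `|x - y| <= e / 2 -> `|y - z| <= e / 2 -> `|x - z| <= e.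
  by rewrite !ler_norml => /andP[? ?] /andP[? ?]; apply/andP; split; lra.
apply: tri h1 _.
have [eA uA] := cauchy_eigenvalue t a k (As j).
have [eB uB] := cauchy_eigenvalue t a k (Bs j).
have sub (x x' y y' : R) : x = x' -> y = y' -> `|x' - y'| <= e / 2 -> `|x - y| <= e / 2.
  by move=> -> ->.
apply: sub eA eB _.
rewrite -mulrBr normrM ger0_norm ?invr_ge0 ?ler0n //.
have Nj : 0 < (N_ j)%:R :> R by rewrite ltr0n.
rewrite mulrC ler_pdivrMr //.
have tn' : trace_norm_le ((t *: B_ j - a%:M) - (t *: A_ j - a%:M)) (`|t| * (e / 2 / L * (N_ j)%:R)).
  have -> : (t *: B_ j - a%:M) - (t *: A_ j - a%:M) = t *: (B_ j - A_ j).
    by rewrite scalerBr opprB addrA subrK.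
  exact: trace_norm_leZ.
apply: (le_trans (trace_resolvent_diff k (tr_shift t a (As j)) (tr_shift t a (Bs j)) uA uB tn')).
have -> : k%:R * (`|t| * (e / 2 / L * (N_ j)%:R) + `|t| * (e / 2 / L * (N_ j)%:R)) =
  ((2 * k%:R) * `|t| / L) * (e / 2 * (N_ j)%:R) by field; rewrite gt_eqF.
apply: ler_piMl; first by apply: mulr_ge0; apply: ltW.
rewrite ler_pdivrMr // mul1r /L.
by apply: ler_pM; rewrite ?lerDl ?mulr_ge0.
Unshelve. all: by end_near. Qed.

End eigenvalue_measures.

Section flat_pattern.
Context (R : rcfType) (n : nat) (adj : rel 'I_n.+1) (w c m : nat).
Hypothesis w0 : (0 < w)%N.
Hypothesis c0 : (0 < c)%N.
Hypothesis m0 : (0 < m)%N.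
Hypothesis degw : forall i, (#|adj i| <= w)%N.
Hypothesis flat : forall i i' : 'I_n.+1, (i' <= i)%N ->
  (#|[pred j | adj i j != adj i' j]| <= c * (i - i'))%N.

Definition pattern_mx : 'M[R]_n.+1 := \matrix_(i, j) (adj i j)%:R.

Definition block_rep (i : 'I_n.+1) : 'I_n.+1 := inord (i %/ m * m).

Lemma block_repE i : block_rep i = (i %/ m * m)%N :> nat.
Proof. by rewrite inordK // (leq_ltn_trans (leq_trunc_div _ _)). Qed.

(** Replace each row by the first row of its block of [m] consecutive rows.  The
result is a sum of one matrix of rank one for each block, and by flatness the
error has few nonzero entries. *)
Lemma trace_norm_pattern : trace_norm_le pattern_mx
  ((n.+1 %/ m).+1%:R * Num.sqrt (m * w)%:R + Num.sqrt (n.+1 * (n.+1 * (c * m)))%:R).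
Proof.
pose u (q : 'I_(n.+1 %/ m).+1) : 'cV[R]_n.+1 := \col_i (i %/ m == q)%N%:R.
pose v (q : 'I_(n.+1 %/ m).+1) : 'cV[R]_n.+1 := \col_j (adj (inord (q * m)) j)%:R.
have -> : pattern_mx = \sum_q u q *m (v q)^T + \matrix_(i, j) ((adj i j)%:R - (adj (block_rep i) j)%:R).
  apply/matrixP => i j; rewrite !mxE summxE.
  have iq : (i %/ m < (n.+1 %/ m).+1)%N by rewrite ltnS leq_div2r // ltnW.
  rewrite (bigD1 (Ordinal iq)) //= big1 ?addr0; last first.
    move=> q /eqP qi; rewrite mxE big_ord1 !mxE.
    case: eqP => [e|_]; last by rewrite mul0r.
    by case: qi; apply: val_inj.
  by rewrite mxE big_ord1 !mxE eqxx mul1r addrC subrK.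
apply: trace_norm_leD.
  rewrite -[X in X%:R * _]card_ord; apply: trace_norm_le_sum => q.
  apply: (@trace_norm_rank1 _ _ _ _ m%:R w%:R).
  - rewrite /normsq (eq_bigr (fun i : 'I_n.+1 => (i %/ m == q)%N%:R)); last first.
      by move=> i _; rewrite mxE -natrX; case: eqP.
    rewrite -natr_sum ler_nat -big_mkcond sum1_card.
    have inj : {in [pred i : 'I_n.+1 | (i %/ m == q)%N] &, injective (fun i : 'I_n.+1 => Ordinal (ltn_pmod i m0))}.
      move=> i i'; rewrite !inE => /eqP iq /eqP iq' [] e; apply: val_inj => /=.
      by rewrite (divn_eq i m) (divn_eq i' m) iq iq' e.
    by rewrite -(card_in_image inj) (leq_trans (max_card _)) // card_ord.
  - rewrite /normsq (eq_bigr (fun j : 'I_n.+1 => (adj (inord (q * m)) j)%:R)); last first.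
      by move=> i _; rewrite mxE -natrX; case: adj.
    rewrite -natr_sum ler_nat -big_mkcond sum1_card.
    exact: degw.
  - by rewrite ltr0n.
  - by rewrite sqrtr_gt0 ltr0n muln_gt0 m0.
  - by rewrite sqr_sqrtr ?ler0n // natrM.
apply: (@trace_norm_frobenius _ _ _ (n.+1 * (c * m))%:R).
- rewrite [leRHS]natrM mulr_natl -[n.+1 in leRHS]card_ord -sumr_const ler_sum // => i _.
  have ri : (block_rep i <= i)%N by rewrite block_repE leq_trunc_div.
  apply: (@le_trans _ _ (#|[pred j | adj i j != adj (block_rep i) j]|%:R)).
    rewrite -sum1_card natr_sum [leRHS]big_mkcond ler_sum // => j _.
    rewrite mxE inE; case: (adj i j); case: (adj _ j); rewrite /= ?subrr ?expr0n ?subr0 ?sub0r ?sqrrN ?expr1n //.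
  rewrite ler_nat (leq_trans (flat ri)) // leq_pmul2l // block_repE.
  by rewrite {1}(divn_eq i m) addKn ltnW // ltn_pmod.
- by rewrite ltr0n !muln_gt0 c0 m0.
- by rewrite sqrtr_gt0 ltr0n !muln_gt0 c0 m0.
- by rewrite sqr_sqrtr ?ler0n // natrM.
Qed.

End flat_pattern.

(** * Moments of the semicircle law *)
Section density.
Context d (T : measurableType d) (R : realType) (mu nu : {measure set T -> \bar R}).
Context (p : T -> R) (mp : measurable_fun setT p) (p0 : forall x, 0 <= p x).
Hypothesis nuE : forall A, measurable A -> nu A = (\int[mu]_(x in A) (p x)%:E)%E.
Import HBNNSimple.

Let mpE : measurable_fun setT (EFin \o p). Proof. exact/measurable_EFinP. Qed.

Let integral_density_nnsfun (f : {nnsfun T >-> R}) :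
  (\int[nu]_x (f x)%:E = \int[mu]_x ((f x)%:E * (p x)%:E))%E.
Proof.
under [LHS]eq_integral do rewrite fimfunE -fsumEFin//.
rewrite [LHS]ge0_integral_fsum//; last 2 first.
  - by move=> r; exact/measurable_EFinP/measurableT_comp.
  - by move=> n x _; rewrite EFinM nnfun_muleindic_ge0.
under [RHS]eq_integral.
  move=> x xD; rewrite fimfunE -fsumEFin// ge0_mule_fsuml; last first.
    by move=> r; rewrite EFinM nnfun_muleindic_ge0.
  over.
rewrite [RHS]ge0_integral_fsum//; last 2 first.
  - move=> r; apply: emeasurable_funM => //.
    exact/measurable_EFinP/measurableT_comp.
  - by move=> n x _; apply: mule_ge0; rewrite ?lee_fin // -lee_fin EFinM nnfun_muleindic_ge0.
apply: eq_fsbigr => r _.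
rewrite integralZl_indic_nnsfun //= integral_indic // setIT nuE //.
under [RHS]eq_integral do rewrite EFinM -muleA.
have [r0|r0] := ltP r 0.
  have e : f @^-1` [set r] = set0 by exact: preimage_nnfun0.
  rewrite e integral_set0 mule0 (eq_integral (cst 0%E)) ?integral0 // => x _.
  by rewrite indicE in_set0 mul0e mule0.
rewrite ge0_integralZl //; last 2 first.
  - apply: emeasurable_funM => //; exact/measurable_EFinP/measurable_indic.
  - by move=> x _; rewrite mule_ge0 // lee_fin.
congr (_ * _)%E; rewrite integral_mkcond; apply: eq_integral => x _.
by rewrite patchE indicE; case: (x \in _); rewrite ?mul1e ?mul0e.
Qed.

Lemma ge0_integral_density (f : T -> \bar R) :
  measurable_fun setT f -> (forall x, 0 <= f x)%E ->
  (\int[nu]_x f x = \int[mu]_x (f x * (p x)%:E))%E.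
Proof.
move=> mf f0.
pose f_ := nnsfun_approx measurableT mf.
transitivity (lim (\int[nu]_x (f_ n x)%:E @[n --> \oo])%E).
  rewrite -monotone_convergence//=.
  - apply: eq_integral => ? /[!inE] xD; apply/esym/cvg_lim => //=.
    exact: cvg_nnsfun_approx.
  - by move=> n; exact/measurable_EFinP/measurable_funTS.
  - by move=> n ? _; rewrite lee_fin.
  - by move=> ? _ ? ? mn; rewrite lee_fin; exact/lefP/nd_nnsfun_approx.
rewrite [RHS](_ : _ = lim
    (\int[mu]_x ((f_ n x)%:E * (p x)%:E) @[n --> \oo])%E); last first.
  rewrite -monotone_convergence//=.
  - apply: eq_integral => x /[!inE] xD; apply/esym/cvg_lim => //.
    apply: cvgeZr => //; exact: cvg_nnsfun_approx.
  - by move=> n; apply: emeasurable_funM => //; exact/measurable_EFinP/measurable_funTS.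
  - by move=> n x _; rewrite mule_ge0 // lee_fin.
  - move=> x _ a b ab; rewrite lee_wpmul2r ?lee_fin //.
    exact/lefP/nd_nnsfun_approx.
have E : (fun n => \int[nu]_x (f_ n x)%:E)%E = (fun n => \int[mu]_x ((f_ n x)%:E * (p x)%:E))%E.
  by apply/funext => n; exact: integral_density_nnsfun.
by rewrite E.
Qed.

Lemma integral_density (f : T -> R) : measurable_fun setT f ->
  (\int[nu]_x (f x)%:E = \int[mu]_x (f x * p x)%:E)%E.
Proof.
move=> mf; have mfE : measurable_fun setT (EFin \o f) by exact/measurable_EFinP.
rewrite integralE [RHS]integralE !ge0_integral_density //; last 2 first.
- exact: measurable_funeneg.
- exact: measurable_funepos.
have mx (a : R) x : (Num.max a 0 * p x = Num.max (a * p x) 0).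
  by rewrite maxr_pMl ?mul0r.
congr (_ - _)%E; apply: eq_integral => x _.
  by rewrite !funeposE /= -!EFin_max -EFinM mx.
by rewrite !funenegE /= -?EFinN -!EFin_max -EFinM mx mulNr.
Qed.

End density.

Section trigonometric_integrals.
Context {R : realType}.
Local Notation mu := (@lebesgue_measure R).
Implicit Types f g : R -> R.

Let integrable_pi f : continuous f -> mu.-integrable `[0, pi] (EFin \o f).
Proof.
move=> cf; apply: continuous_compact_integrable; first exact: segment_compact.
exact: continuous_subspaceT.
Qed.

Let continuous_mul (m : R) : continuous (fun x : R => m * x).
Proof. by move=> x; apply: cvgM; [exact: cst_continuous|exact: cvg_id]. Qed.

Let continuous_cosm (m : R) : continuous (fun x : R => cos (m * x)).
Proof. move=> x; apply: (@continuous_comp _ _ _ (fun x => m * x) (@cos R)); [exact: continuous_mul|exact: continuous_cos]. Qed.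

Let continuous_sinm (m : R) : continuous (fun x : R => sin (m * x)).
Proof. move=> x; apply: (@continuous_comp _ _ _ (fun x => m * x) (@sin R)); [exact: continuous_mul|exact: continuous_sin]. Qed.

Lemma sin_natpi (m : nat) : sin (m%:R * pi) = 0 :> R.
Proof.
elim: m => [|m IH]; first by rewrite mul0r sin0.
by rewrite -natr1 mulrDl mul1r sinD IH sinpi mulr0 mul0r addr0.
Qed.

Let is_derive_sinm (m x : R) : is_derive x 1 (fun y => sin (m * y)) (cos (m * x) * m).
Proof.
have dm : is_derive x 1 (fun y : R => m * y) m.
  have -> : (fun y : R => m * y) = m *: id by apply: funext => y.
  by apply: is_derive_eq; rewrite /GRing.scale /= mulr1.
exact: (@is_derive1_comp _ sin (fun y : R => m * y) x _ _ (is_derive_sin _) dm).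
Qed.

Lemma integral_cosm (m : nat) :
  \int[mu]_(x in `[0, pi]) cos (m%:R * x) = if m == 0%N then pi else 0.
Proof.
case: eqP => [->|/eqP m0].
  rewrite (@eq_Rintegral _ _ _ mu _ (fun=> 1)); last by move=> x _; rewrite /= mul0r cos0.
  by rewrite Rintegral_cst //= lebesgue_measure_itv /= lte_fin pi_gt0 mul1r /= subr0.
have mn : m%:R != 0 :> R by rewrite pnatr_eq0.
pose F := m%:R^-1 *: (fun x : R => sin (m%:R * x)).
have dF (x : R) : is_derive x 1 F (cos (m%:R * x)).
  have h := is_derive_sinm m%:R x.
  apply: is_derive_eq; rewrite /GRing.scale /=; field; done.
have cF : continuous F by move=> x; apply: cvgZr; exact: continuous_sinm.
rewrite /Rintegral (@continuous_FTC2 _ (fun x => cos (m%:R * x)) F) //.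
- have F0 : F 0 = 0 by rewrite /F fctE mulr0 sin0 scaler0.
  have Fpi : F pi = 0 by rewrite /F fctE sin_natpi scaler0.
  by rewrite F0 Fpi -EFinB subrr.
- exact: pi_gt0.
- exact: continuous_subspaceT.
- split.
  + by move=> x _; apply: ex_derive.
  + by apply: cvg_at_right_filter; exact: cF.
  + by apply: cvg_at_left_filter; exact: cF.
- by move=> x _; rewrite derive1E; apply: derive_val.
Qed.

Let Rintegral_piD f g : continuous f -> continuous g ->
  \int[mu]_(x in `[0, pi]) (f x + g x) =
  \int[mu]_(x in `[0, pi]) f x + \int[mu]_(x in `[0, pi]) g x.
Proof. by move=> cf cg; rewrite RintegralD //; exact: integrable_pi. Qed.

Lemma continuous_wallis (k h : nat) :
  continuous (fun x : R => (2 * cos x) ^+ k * (sin (h.+1%:R * x) * sin x)).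
Proof.
move=> x; apply: cvgM.
  apply: (@continuous_comp _ _ _ (fun x => 2 * cos x) (fun y => y ^+ k)); last exact: exprn_continuous.
  by apply: cvgM; [exact: cst_continuous | exact: continuous_cos].
by apply: cvgM; [exact: continuous_sinm | exact: continuous_sin].
Qed.

(** The recursion for ballot numbers mirrors the identity
[2 cos x sin ((h + 1) x) = sin ((h + 2) x) + sin (h x)], and the initial values
are the orthogonality relations of the sines. *)
Lemma integral_ballot k h :
  \int[mu]_(x in `[0, pi]) ((2 * cos x) ^+ k * (sin (h.+1%:R * x) * sin x)) =
  pi / 2 * (ballot k h)%:R.
Proof.
elim: k h => [|k IH] h /=.
  rewrite (@eq_Rintegral _ _ _ mu _ (fun x => 2^-1 * cos (h%:R * x) + (- 2^-1) * cos (h.+2%:R * x))); last first.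
    move=> x _; rewrite expr0 mul1r.
    have -> : h%:R * x = h.+1%:R * x - x by rewrite -[h.+1%:R]natr1; ring.
    have -> : h.+2%:R * x = h.+1%:R * x + x by rewrite -[h.+2%:R]natr1; ring.
    by rewrite cosB cosD; field.
  rewrite Rintegral_piD; last 2 first.
  - by move=> x; apply: cvgM; [exact: cst_continuous | exact: continuous_cosm].
  - by move=> x; apply: cvgM; [exact: cst_continuous | exact: continuous_cosm].
  rewrite !RintegralZl //; last 2 first.
  - exact: integrable_pi.
  - exact: integrable_pi.
  by rewrite !integral_cosm; case: eqP => _ /=; rewrite ?mulr0 ?addr0 ?mulr1 // mulrC.
rewrite (@eq_Rintegral _ _ _ mu _ (fun x => (2 * cos x) ^+ k * (sin (h.+2%:R * x) * sin x) +
   (2 * cos x) ^+ k * (sin (h%:R * x) * sin x))); last first.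
  move=> x _.
  have -> : h%:R * x = h.+1%:R * x - x by rewrite -[h.+1%:R]natr1; ring.
  have -> : h.+2%:R * x = h.+1%:R * x + x by rewrite -[h.+2%:R]natr1; ring.
  by rewrite sinB sinD exprS; ring.
case: h => [|h].
  rewrite (@eq_Rintegral _ _ _ mu _ (fun x => (2 * cos x) ^+ k * (sin (2%:R * x) * sin x))).
    by rewrite IH addn0.
  by move=> x _; rewrite mul0r sin0 mul0r mulr0 addr0.
by rewrite Rintegral_piD ?IH ?natrD ?mulrDr //; exact: continuous_wallis.
Qed.

End trigonometric_integrals.

Section semicircle_moments.
Context {R : realType}.
Local Notation mu := (@lebesgue_measure R).

Lemma continuous_semicircle_pdf (v : R) : continuous (semicircle_pdf v).
Proof.
have c1 : continuous (fun x : R => Num.max (4 * v - x ^+ 2) 0).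
  move=> x; apply: (@continuous_comp _ _ _ (fun x : R => 4 * v - x ^+ 2) (fun y => Num.max y 0)).
    by apply: cvgB; [exact: cst_continuous | exact: exprn_continuous].
  by apply: continuous_max; [exact: cvg_id | exact: cst_continuous].
have c2 : continuous (fun x : R => Num.sqrt (Num.max (4 * v - x ^+ 2) 0)).
  by move=> x; apply: (@continuous_comp _ _ _ (fun x : R => Num.max (4 * v - x ^+ 2) 0) (@Num.sqrt R)); [exact: c1 | exact: sqrt_continuous].
by move=> x; apply: cvgM; [exact: cst_continuous | exact: c2].
Qed.

Lemma semicircle_integral (v : R) (f : R -> R) : 0 < v -> continuous f ->
  (\int[semicircle_measure v]_x (f x)%:E =
   \int[mu]_(x in `[(- (2 * Num.sqrt v))%R, (2 * Num.sqrt v)%R]) (f x * semicircle_pdf v x)%:E)%E.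
Proof.
move=> v0 cf.
rewrite (@integral_density _ _ _ mu (semicircle_measure v) (semicircle_pdf v)); last 4 first.
- exact: measurable_semicircle_pdf.
- by move=> x; exact: semicircle_pdf_ge0.
- by move=> A mA; rewrite -[LHS]/(semicircle v A) /semicircle v0.
- exact: continuous_measurable_fun.
rewrite [RHS]integral_mkcond; apply: eq_integral => x _; rewrite patchE.
case: ifPn => //; rewrite notin_setE /= in_itv /= => /negP xr.
suff -> : semicircle_pdf v x = 0 by rewrite mulr0.
rewrite /semicircle_pdf; have -> : Num.max (4 * v - x ^+ 2) 0 = 0; last by rewrite sqrtr0 mulr0.
apply/max_idPr; rewrite subr_le0.
have -> : 4 * v = (2 * Num.sqrt v) ^+ 2 by rewrite exprMn sqr_sqrtr ?(ltW v0) //; ring.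
rewrite -[leRHS]real_normK ?num_real // lerXn2r ?nnegrE ?mulr_ge0 ?sqrtr_ge0 //.
by rewrite leNgt; apply: contra xr => /ltW; rewrite ler_norml.
Qed.

Let wallis_algebra (s c z p : R) k : s != 0 -> p != 0 ->
  s ^+ k * (2 * c) ^+ k * ((2 * p * s ^+ 2)^-1 * (2 * s * z)) * - (2 * s * - z) =
  2 / p * s ^+ k * ((2 * c) ^+ k * (z * z)).
Proof. by move=> s0 p0; field; rewrite s0 p0. Qed.

(** The substitution [x = 2 sqrt v cos y] leads to [integral_ballot] with [h = 0]. *)
Lemma semicircle_moment_gt0 (v : R) k : 0 < v ->
  \int[semicircle_measure v]_x (x ^+ k) = (ballot k 0)%:R * Num.sqrt v ^+ k.
Proof.
move=> v0; rewrite /Rintegral semicircle_integral //; last exact: exprn_continuous.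
set s := Num.sqrt v; have s0 : 0 < s by rewrite sqrtr_gt0.
have s2 : s ^+ 2 = v by rewrite sqr_sqrtr // ltW.
pose F : R -> R := (2 * s) *: (@cos R).
have dF (x : R) : is_derive x 1 F (2 * s * - sin x) by apply: is_derive_eq.
have F'E : derive1 F = (fun x => 2 * s * - sin x).
  by apply: funext => x; rewrite derive1E; apply: derive_val.
have cF : continuous F by move=> x; apply: cvgZr; exact: continuous_cos.
have cF' : continuous (fun x : R => 2 * s * - sin x).
  move=> x; apply: cvgM; first exact: cst_continuous.
  by apply: cvgN; exact: continuous_sin.
have F0 : F 0 = 2 * s by rewrite /F /= fctE cos0 /GRing.scale /= mulr1.
have Fpi : F pi = - (2 * s) by rewrite /F /= fctE cospi /GRing.scale /= mulrN1.
pose G x := x ^+ k * semicircle_pdf v x.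
have cG : continuous G.
  move=> x; apply: cvgM; first exact: exprn_continuous.
  exact: continuous_semicircle_pdf.
have := @integration_by_substitution_decreasing R F G 0 pi (pi_ge0 _).
rewrite F0 Fpi => ->; last 6 first.
- move=> x y x0 y0 xy; rewrite /F /= !fctE /GRing.scale /= ltr_pM2l ?mulr_gt0 //.
  by rewrite ltr_cos.
- by rewrite F'E => x _; exact: cF'.
- by rewrite F'E; apply/cvg_ex; exists (2 * s * - sin 0); apply: cvg_at_right_filter; exact: cF'.
- by rewrite F'E; apply/cvg_ex; exists (2 * s * - sin pi); apply: cvg_at_left_filter; exact: cF'.
- split; first by move=> x _; apply: ex_derive.
  + by apply: cvg_at_right_filter; exact: cF.
  + by apply: cvg_at_left_filter; exact: cF.
- exact: continuous_subspaceT.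
rewrite F'E -/(Rintegral mu `[0, pi] (fun x => ((G \o F) * - (fun x => 2 * s * - sin x)) x)).
rewrite (@eq_Rintegral _ _ _ mu _ (fun x => (2 / pi * s ^+ k) *
   ((2 * cos x) ^+ k * (sin (1%:R * x) * sin x)))); last first.
  move=> x; rewrite inE /= in_itv /= => /andP[x0 xpi].
  have sx : 0 <= sin x by rewrite sin_ge0_pi // x0.
  rewrite !fctE /G /F /= fctE /GRing.scale /= /semicircle_pdf mul1r.
  have -> : 4 * v - (2 * s * cos x) ^+ 2 = (2 * s * sin x) ^+ 2.
    by rewrite -s2 [in RHS]exprMn sin2cos2; ring.
  have -> : Num.max ((2 * s * sin x) ^+ 2) 0 = (2 * s * sin x) ^+ 2.
    by apply/max_idPl; exact: sqr_ge0.
  rewrite sqrtr_sqr ger0_norm ?mulr_ge0 ?(ltW s0) // -s2.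
  have -> : (2 * s * cos x) ^+ k = s ^+ k * (2 * cos x) ^+ k by rewrite -exprMn; congr (_ ^+ _); ring.
  have sn : s != 0 by rewrite gt_eqF.
  have pn : pi != 0 :> R by rewrite gt_eqF // pi_gt0.
  exact: wallis_algebra.
rewrite RintegralZl //; last first.
  apply: continuous_compact_integrable; first exact: segment_compact.
  exact/continuous_subspaceT/continuous_wallis.
rewrite (integral_ballot k 0).
have pn : pi != 0 :> R by rewrite gt_eqF // pi_gt0.
by move: (s ^+ k) (pi : R) pn => a p pn; field.
Qed.

Lemma ballot_odd k h : odd (k + h) -> ballot k h = 0%N.
Proof.
elim: k h => [|k IH] h /=; first by case: h.
move=> o; rewrite IH ?addnS //; case: h o => // h o; rewrite IH //.
by move: o; rewrite addnS /= negbK.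
Qed.

Lemma ballot_le k h : (ballot k h <= 2 ^ k)%N.
Proof.
elim: k h => [|k IH] h /=; first by case: h.
rewrite expnS mul2n -addnn leq_add //; case: h => // h; exact: IH.
Qed.

Lemma semicircle_moments (v : R) : 0 <= v ->
  has_moments (semicircle_measure v) /\
  forall k, \int[semicircle_measure v]_x (x ^+ k) = (ballot k 0)%:R * v ^+ k./2.
Proof.
rewrite le_eqVlt => /orP[/eqP <-|v0].
  have E (A : set (measurableTypeR R)) : semicircle_measure 0 A = \d_(0 : measurableTypeR R) A.
    by rewrite -[LHS]/(semicircle 0 A) /semicircle ltxx.
  have I k : (\int[semicircle_measure 0]_x (x ^+ k)%:E = (0 ^+ k)%:E :> \bar R)%E.
    rewrite (@eq_measure_integral _ _ _ setT (\d_(0 : measurableTypeR R))); last by move=> A _ _; rewrite E.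
    rewrite integral_dirac ?diracT ?mul1e //.
    by apply/measurable_EFinP; exact: exprn_measurable.
  split; first split.
  - by rewrite E diracT.
  - move=> k; apply/integrableP; split; first by apply/measurable_EFinP; exact: exprn_measurable.
    rewrite (@eq_measure_integral _ _ _ setT (\d_(0 : measurableTypeR R))); last by move=> A _ _; rewrite E.
    rewrite integral_dirac ?diracT ?mul1e ?ltry //.
    apply: measurableT_comp => //; by apply/measurable_EFinP; exact: exprn_measurable.
  - move=> k; rewrite /Rintegral I /=; case: k => [|[|k]] /=; rewrite ?expr0 ?mulr1 //.
    by rewrite !expr0n mulr0.
have m1 : semicircle_measure v setT = 1%E.
  have := semicircle_moment_gt0 0 v0; rewrite expr0 mulr1 /= /Rintegral.
  have -> : (\int[semicircle_measure v]_x (x ^+ 0)%:E = semicircle_measure v setT)%E.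
    by rewrite (eq_integral (cst 1%E)) ?integral_cst ?mul1e // => x _; rewrite expr0.
  have fin1 (x : \bar R) : fine x = 1 -> x = 1%E.
    by case: x => [r /= -> //|/= /eqP|/= /eqP]; rewrite eq_sym oner_eq0.
  exact: fin1.
have bnd (f : R -> R) : continuous f ->
    (semicircle_measure v).-integrable setT (EFin \o f).
  move=> cf; apply/integrableP; split; first by apply/measurable_EFinP; exact: continuous_measurable_fun.
  rewrite (@semicircle_integral v (fun x => `|f x|)) //; last first.
    by move=> x; apply: (@continuous_comp _ _ _ f (fun y => `|y|)); [exact: cf | exact: norm_continuous].
  have : mu.-integrable `[- (2 * Num.sqrt v), (2 * Num.sqrt v)] (EFin \o (fun x => `|f x| * semicircle_pdf v x)).
    apply: continuous_compact_integrable; first exact: segment_compact.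
    apply: continuous_subspaceT => x; apply: cvgM.
      by apply: (@continuous_comp _ _ _ f (fun y => `|y|)); [exact: cf | exact: norm_continuous].
    exact: continuous_semicircle_pdf.
  move/integrableP => [_]; apply: le_lt_trans; apply: ge0_le_integral => //.
  - by move=> x _; rewrite lee_fin mulr_ge0 // semicircle_pdf_ge0.
  - apply/measurable_EFinP/measurable_funTS; apply: measurable_funM; last exact: measurable_semicircle_pdf.
    by apply: measurableT_comp => //; exact: continuous_measurable_fun.
  - do 2 apply: measurableT_comp => //.
    apply/measurable_funTS; apply: measurable_funM; last exact: measurable_semicircle_pdf.
    by apply: measurableT_comp => //; exact: continuous_measurable_fun.
  - by move=> x _; rewrite lee_fin ler_norm.
split; first by split=> // k; apply: bnd; exact: exprn_continuous.
move=> k; rewrite semicircle_moment_gt0 //.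
case: (boolP (odd k)) => ok; first by rewrite ballot_odd ?addn0 // !mul0r.
congr (_ * _); rewrite -[in LHS](odd_double_half k) (negbTE ok) add0n -mul2n exprM.
by rewrite sqr_sqrtr // ltW.
Qed.

Lemma semicircle_growth (v : R) k : 0 <= v ->
  \int[semicircle_measure v]_x (x ^+ (2 * k)) <= (1 + 4 * v) ^+ (2 * k).
Proof.
move=> v0; rewrite (semicircle_moments v0).2 mul2n doubleK.
apply: (@le_trans _ _ (4 ^+ k * v ^+ k)).
  rewrite ler_wpM2r ?exprn_ge0 // -natrX ler_nat (leq_trans (ballot_le _ _)) //.
  by rewrite -mul2n expnM.
rewrite -exprMn -mul2n mulnC exprM; apply: (@le_trans _ _ ((1 + 4 * v) ^+ k)).
  by rewrite lerXn2r ?nnegrE ?addr_ge0 ?mulr_ge0 // lerDr.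
by rewrite expr2 ler_peMr ?exprn_ge0 ?exprn_ege1 ?lerDl ?addr_ge0 ?mulr_ge0.
Qed.

End semicircle_moments.

(** * Exchangeability as sampling *)
Lemma ffact_near_exp n k : (k ^ 2 <= n)%N -> (n ^ k * (n - k ^ 2) <= n * n ^_ k)%N.
Proof.
elim: k => [|k IH] kn; first by rewrite !ffactn0 mul1n subn0 muln1.
have k2 : (k ^ 2 <= n)%N by apply: leq_trans kn; rewrite leq_sqr.
rewrite ffactnSr expnSr -mulnA mulnA.
apply: (@leq_trans (n ^ k * ((n - k) * (n - k ^ 2)))).
  rewrite -mulnA leq_mul2l; apply/orP; right.
  have e : (k.+1 ^ 2 = k ^ 2 + 2 * k + 1)%N by rewrite -addn1 sqrnD; lia.
  have kk : (k <= n)%N by apply: leq_trans kn; rewrite e; nia.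
  rewrite e; move: kn k2 kk; rewrite e -!mulnn; nia.
by rewrite mulnCA [X in (_ <= X)%N]mulnA [X in (_ <= X)%N]mulnC leq_mul2l IH // orbT.
Qed.

(** The birthday estimate: at least half of the maps from [k] labels to [n] indices
are injective. *)
Lemma ffact_half n k : (0 < n)%N -> (2 * k ^ 2 <= n)%N -> (n ^ k <= 2 * n ^_ k)%N.
Proof.
move=> n0 kn; have k2 : (k ^ 2 <= n)%N by lia.
rewrite -(leq_pmul2l n0) mulnCA (leq_trans _ (leq_mul (leqnn 2) (ffact_near_exp k2))) //.
rewrite mulnCA mulnC leq_mul2l; apply/orP; right; lia.
Qed.

Lemma extend_to_perm (E : finType) n (f g : E -> 'I_n) : injective f -> injective g ->
  exists s : 'S_n, forall e, s (f e) = g e.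
Proof.
move=> fi gi.
pose l (h : E -> 'I_n) := codom h ++ [seq i <- enum 'I_n | i \notin codom h].
have ul h : injective h -> uniq (l h).
  move=> hi; rewrite cat_uniq map_inj_uniq ?enum_uniq ?filter_uniq ?enum_uniq //; last by rewrite -enumT enum_uniq.
  rewrite andbT /=.
  by apply/hasPn => x; rewrite mem_filter => /andP[].
have ml h i : i \in l h.
  by rewrite mem_cat mem_filter mem_enum andbT; case: (i \in codom h).
have sl h : injective h -> size (l h) = n.
  move=> hi; rewrite -[RHS](card_ord n) cardE; apply: perm_size.
  by apply: uniq_perm; rewrite ?ul ?enum_uniq // => i; rewrite ml mem_enum.
pose s0 (i : 'I_n) : 'I_n := nth i (l g) (index i (l f)).
have lt i : (index i (l f) < n)%N by rewrite -{2}(sl f fi) index_mem ml.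
have s0i : injective s0.
  move=> i j; rewrite /s0 (set_nth_default j) ?sl // => /eqP.
  rewrite nth_uniq ?sl ?ul // => /eqP e.
  by rewrite -(nth_index i (ml f i)) -(nth_index i (ml f j)) e.
exists (perm s0i) => e; rewrite permE /s0 /l !index_cat codom_f.
have ie : index (f e) (codom f) = index e (enum E) by rewrite index_map.
have sz (h : E -> 'I_n) : size (codom h) = #|E| by rewrite size_codom.
rewrite nth_cat sz ie.
have -> : (index e (enum E) < #|E|)%N by rewrite cardE index_mem mem_enum.
by rewrite (nth_map e) ?index_mem ?mem_enum // nth_index // mem_enum.
Qed.

Section exchangeability.
Context d (T : measurableType d) (R : realType) (P : probability T R).
Context (xi : nat -> {RV P >-> R}).
Hypothesis xi_exch : exchangeable xi.

Definition obs n w : n.-tuple R := [tuple xi i w | i < n].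

Lemma measurable_obs_comp n (s : 'I_n -> nat) :
  measurable_fun setT (fun w => [tuple xi (s i) w | i < n]).
Proof.
apply/measurable_fun_tnthP => i.
rewrite (_ : _ \o _ = (xi (s i) : T -> R)); first exact: measurable_funP.
by apply: funext => w /=; rewrite tnth_mktuple.
Qed.

Lemma exch_integral n (s : 'S_n) (g : n.-tuple R -> \bar R) :
  measurable_fun setT g -> (forall y, 0 <= g y)%E ->
  (\int[P]_w g (obs n w) = \int[P]_w g [tuple xi (s i) w | i < n])%E.
Proof.
move=> mg g0.
have m1 := measurable_obs_comp (@nat_of_ord n).
have m2 := measurable_obs_comp (fun i : 'I_n => s i : nat).
have h1 := ge0_integral_pushforward m1 P measurableT mg (fun y _ => g0 y).
have h2 := ge0_integral_pushforward m2 P measurableT mg (fun y _ => g0 y).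
rewrite !preimage_setT in h1 h2.
rewrite -[LHS]h1 -[RHS]h2.
apply: eq_measure_integral => A mA _; exact: xi_exch.
Qed.

Lemma exch_marginal (g : R -> R) i : measurable_fun setT g -> (forall x, 0 <= g x) ->
  (\int[P]_w (g (xi i w))%:E = \int[P]_w (g (xi 0%N w))%:E)%E.
Proof.
move=> mg g0.
pose G (y : i.+1.-tuple R) := (g (tnth y ord0))%:E.
have mG : measurable_fun setT G.
  by apply/measurable_EFinP; apply: measurableT_comp => //; exact: measurable_tnth.
have G0 y : (0 <= G y)%E by rewrite lee_fin.
have := exch_integral (tperm ord0 ord_max) mG G0.
rewrite /G /obs => E; transitivity (\int[P]_w (g (tnth [tuple xi (tperm ord0 (ord_max : 'I_i.+1) i0) w | i0 < i.+1] ord0))%:E)%E.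
  by apply: eq_integral => w _; rewrite tnth_mktuple tpermL.
by rewrite -E; apply: eq_integral => w _; rewrite tnth_mktuple.
Qed.

(** By exchangeability, each injective choice of indices gives the integral on the
left.  At least half of all choices are injective, and the other ones contribute
nonnegatively to the average on the right. *)
Lemma sampling_le (E : finType) n (iota : E -> 'I_n) (Phi : (E -> R) -> n.-tuple R -> R) :
  (0 < n)%N -> injective iota -> (2 * #|E| ^ 2 <= n)%N ->
  (forall a y, 0 <= Phi a y) ->
  (forall a y (s : 'S_n), Phi a [tuple tnth y (s i) | i < n] = Phi a y) ->
  (forall t : E -> 'I_n, measurable_fun setT (fun y => Phi (fun e => tnth y (t e)) y)) ->
  (\int[P]_w (Phi (fun e => xi (iota e) w) (obs n w))%:E <=
   2%:E * \int[P]_w (sample (fun t : {ffun E -> 'I_n} => Phi (fun e => xi (t e) w) (obs n w)))%:E)%E.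
Proof.
move=> n0 ii nE Phi0 Phis Phim.
set I0 := (\int[P]_w _)%E.
pose I (t : {ffun E -> 'I_n}) := (\int[P]_w (Phi (fun e => xi (t e) w) (obs n w))%:E)%E.
have mI (t : {ffun E -> 'I_n}) : measurable_fun setT (fun w => (Phi (fun e => xi (t e) w) (obs n w))%:E).
  apply/measurable_EFinP.
  have -> : (fun w => Phi (fun e => xi (t e) w) (obs n w)) =
     (fun y => Phi (fun e => tnth y (t e)) y) \o obs n.
    apply: funext => w /=; congr Phi; apply: funext => e; by rewrite tnth_mktuple.
  by apply: measurableT_comp; [exact: Phim|exact: measurable_obs_comp].
have I_inj (t : {ffun E -> 'I_n}) : injectiveb t -> I t = I0.
  move=> /injectiveP ti; have [s sE] := extend_to_perm ii ti.
  pose G y : \bar R := (Phi (fun e => tnth y (iota e)) y)%:E.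
  have -> : I0 = (\int[P]_w G (obs n w))%E.
    apply: eq_integral => w _; rewrite /G; congr (Phi _ _)%:E.
    by apply: funext => e; rewrite tnth_mktuple.
  rewrite (@exch_integral n s G); last 2 first.
  - by apply/measurable_EFinP; exact: Phim.
  - by move=> y; rewrite lee_fin.
  apply: eq_integral => w _; rewrite /G.
  have -> : [tuple xi (s i) w | i < n] = [tuple tnth (obs n w) (s i) | i < n].
    by apply: eq_mktuple => i; rewrite tnth_mktuple.
  rewrite Phis; congr (Phi _ _)%:E; apply: funext => e.
  by rewrite !tnth_mktuple sE.
have I0ge : (0 <= I0)%E by apply: integral_ge0 => w _; rewrite lee_fin.
have Ige t : (0 <= I t)%E by apply: integral_ge0 => w _; rewrite lee_fin.
have cE : ((n ^_ #|E|)%:R%:E * I0 <= \sum_(t : {ffun E -> 'I_n}) I t)%E.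
  rewrite (bigID (fun t : {ffun E -> 'I_n} => injectiveb t)) /=.
  rewrite -[leLHS]adde0; apply: leeD; last exact: sume_ge0.
  rewrite (eq_bigr (fun=> I0)) // sumr_const.
  rewrite [X in (_ <= (I0 *+ X)%R)%E](_ : _ = (n ^_ #|E|)%N); last first.
    rewrite -[n in RHS]card_ord -card_inj_ffuns cardsE.
    by [].
  by rewrite mule_natl.
have sE : (\int[P]_w (sample (fun t : {ffun E -> 'I_n} => Phi (fun e => xi (t e) w) (obs n w)))%:E =
   ((n ^ #|E|)%:R^-1)%:E * \sum_(t : {ffun E -> 'I_n}) I t)%E.
  rewrite /sample; under eq_integral do rewrite EFinM -sumEFin.
  rewrite ge0_integralZl //; last 2 first.
  - by apply: emeasurable_sum.
  - by move=> w _; apply: sume_ge0 => t _; rewrite lee_fin.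
  rewrite ge0_integral_sum //; last by move=> t w _; rewrite lee_fin.
  by rewrite natrX.
rewrite sE muleA -EFinM.
have f0 : (0 < n ^_ #|E|)%N.
  rewrite ffact_gt0 (leq_trans _ nE) // -mulnn; nia.
have := @ffact_half n #|E| n0 nE => half.
apply: (@le_trans _ _ ((n ^_ #|E|)%:R^-1%:E * \sum_(t : {ffun E -> 'I_n}) I t)%E).
  have -> : I0 = ((n ^_ #|E|)%:R^-1%:E * ((n ^_ #|E|)%:R%:E * I0))%E.
    by rewrite muleA -EFinM mulVf ?mul1e // pnatr_eq0 -lt0n.
  by apply: lee_wpmul2l => //; rewrite lee_fin invr_ge0.
apply: lee_wpmul2r; first exact: sume_ge0.
rewrite lee_fin ler_pdivlMr ?ltr0n ?expn_gt0 ?n0 //.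
by rewrite mulrC ler_pdivrMr ?ltr0n // -natrM ler_nat.
Qed.

(** The sum of the [Z j] is integrable by monotone convergence. *)
Lemma bounded_partial_sums (Z : nat -> T -> R) (c : nat -> R) (B : R) :
  (forall j, measurable_fun setT (Z j)) -> (forall j w, 0 <= Z j w) ->
  (forall j, \int[P]_w (Z j w)%:E <= (c j)%:E)%E ->
  (forall n, \sum_(j < n) c j <= B) ->
  {ae P, forall w, exists B' : R, forall n, \sum_(j < n) Z j w <= B'}.
Proof.
move=> mZ Z0 Zc cB.
have mZE j : measurable_fun setT (fun w => (Z j w)%:E) by exact/measurable_EFinP.
have H : (\int[P]_w (\sum_(j <oo) (Z j w)%:E) < +oo)%E.
  rewrite integral_nneseries //; last by move=> j w _; rewrite lee_fin.
  apply: (@le_lt_trans _ _ B%:E); last exact: ltry.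
  apply: lime_le; first by apply: is_cvg_nneseries => j _ _; apply: integral_ge0 => w _; rewrite lee_fin.
  apply: nearW => n; rewrite big_mkord; apply: (@le_trans _ _ (\sum_(j < n) (c j)%:E)%E).
    by apply: lee_sum => j _; exact: Zc.
  by rewrite sumEFin lee_fin.
have int : P.-integrable setT (fun w => \sum_(j <oo) (Z j w)%:E)%E.
  apply/integrableP; split.
    by apply: ge0_emeasurable_sum => // j w _ _; rewrite lee_fin.
  apply: le_lt_trans H; apply: ge0_le_integral => //.
  - by apply: measurableT_comp => //; apply: ge0_emeasurable_sum => // j w _ _; rewrite lee_fin.
  - by apply: ge0_emeasurable_sum => // j w _ _; rewrite lee_fin.
  - move=> w _; rewrite gee0_abs //.
    by apply: nneseries_ge0 => j _ _; rewrite lee_fin.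
have := integrable_ae measurableT int.
apply: filterS => w /(_ I) fin.
exists (fine (\sum_(j <oo) (Z j w)%:E)%E) => n.
rewrite -lee_fin fineK // -sumEFin -(big_mkord xpredT (fun j => (Z j w)%:E)).
by apply: nneseries_lim_ge => j _ _; rewrite lee_fin.
Qed.

End exchangeability.

(** * Power means and empirical moments *)
Section power_means.
Context (R : realFieldType).

Lemma sum_cst n (c : R) : \sum_(i < n) c = n%:R * c.
Proof. by rewrite sumr_const card_ord mulr_natl. Qed.

(** The graph of a power lies above its tangent at [c]. *)
Lemma tangent_le (c z : R) m : 0 <= c -> 0 <= z ->
  c ^+ m.+1 + m.+1%:R * c ^+ m * (z - c) <= z ^+ m.+1.
Proof.
move=> c0 z0; elim: m => [|m IH]; first by rewrite !expr1 expr0; lra.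
rewrite [z ^+ _]exprS; apply: le_trans (ler_wpM2l z0 IH).
rewrite -subr_ge0.
have -> : z * (c ^+ m.+1 + m.+1%:R * c ^+ m * (z - c)) -
   (c ^+ m.+2 + m.+2%:R * c ^+ m.+1 * (z - c)) = m.+1%:R * c ^+ m * (z - c) ^+ 2.
  by rewrite !exprS -!natr1; ring.
by rewrite mulr_ge0 ?sqr_ge0 // mulr_ge0 ?exprn_ge0.
Qed.

(** Jensen's inequality, by summing [tangent_le] at the mean. *)
Lemma power_mean n (y : 'I_n -> R) m : (0 < n)%N -> (forall i, 0 <= y i) ->
  (n%:R^-1 * \sum_i y i) ^+ m <= n%:R^-1 * \sum_i y i ^+ m.
Proof.
move=> n0 y0; case: m => [|m].
  by rewrite expr0 (eq_bigr (fun=> 1)) // sum_cst mulr1 mulVf // pnatr_eq0 -lt0n.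
have nn : n%:R != 0 :> R by rewrite pnatr_eq0 -lt0n.
have s0 : 0 <= \sum_i y i by apply: sumr_ge0.
set c := n%:R^-1 * _; have c0 : 0 <= c by rewrite mulr_ge0 ?invr_ge0.
have : \sum_(i < n) (c ^+ m.+1 + m.+1%:R * c ^+ m * (y i - c)) <= \sum_i y i ^+ m.+1.
  by apply: ler_sum => i _; exact: tangent_le.
rewrite big_split /= -mulr_sumr sumrB !sum_cst.
rewrite {3}/c mulVKf // subrr mulr0 addr0 => h.
rewrite -[leLHS](mulKf nn); apply: ler_wpM2l; last exact: h.
by rewrite invr_ge0.
Qed.

Lemma power_mean_even n (y : 'I_n -> R) m : (0 < n)%N -> ~~ odd m ->
  (n%:R^-1 * \sum_i y i) ^+ m <= n%:R^-1 * \sum_i y i ^+ m.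
Proof.
move=> n0 em; have ab (z : R) : `|z| ^+ m = z ^+ m.
  by rewrite -normrX ger0_norm // exprn_even_ge0.
rewrite -ab normrM ger0_norm ?invr_ge0 //.
rewrite -(eq_bigr _ (fun i _ => ab (y i))).
apply: le_trans (power_mean m n0 _) => //.
rewrite lerXn2r ?nnegrE ?mulr_ge0 ?invr_ge0 ?sumr_ge0 // ler_wpM2l ?invr_ge0 //.
exact: ler_norm_sum.
Qed.

Lemma exprD_le (a b : R) m : 0 <= a -> 0 <= b ->
  (a + b) ^+ m <= 2 ^+ m * (a ^+ m + b ^+ m).
Proof.
wlog ab : a b / a <= b => [h a0 b0|a0 b0].
  have [ab|/ltW ab] := leP a b; first exact: h.
  by rewrite addrC [a ^+ m + _]addrC; apply: h.
apply: (@le_trans _ _ ((2 * b) ^+ m)).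
  by rewrite lerXn2r ?nnegrE ?addr_ge0 ?mulr_ge0 //; lra.
by rewrite exprMn ler_wpM2l ?exprn_ge0 // lerDr exprn_ge0.
Qed.

Definition centred n (y : 'I_n -> R) i := y i - n%:R^-1 * \sum_j y j.

Lemma emp_moment_centred1 n (y : 'I_n -> R) : (0 < n)%N -> emp_moment (centred y) 1 = 0.
Proof.
move=> n0; have nn : n%:R != 0 :> R by rewrite pnatr_eq0 -lt0n.
rewrite /emp_moment (eq_bigr (centred y)); last by move=> i _; rewrite expr1.
by rewrite /centred sumrB sum_cst mulVKf // subrr mulr0.
Qed.

Lemma emp_moment_centred2 n (y : 'I_n -> R) : (0 < n)%N ->
  emp_moment (centred y) 2 = emp_moment y 2 - emp_moment y 1 ^+ 2.
Proof.
move=> n0; have nn : n%:R != 0 :> R by rewrite pnatr_eq0 -lt0n.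
have e1 : emp_moment y 1 = n%:R^-1 * \sum_j y j.
  by rewrite /emp_moment; congr (_ * _); apply: eq_bigr => i _; rewrite expr1.
rewrite {1}/emp_moment (eq_bigr (fun i => y i ^+ 2 + ((- 2 * emp_moment y 1) * y i + emp_moment y 1 ^+ 2))).
  rewrite big_split big_split /= -mulr_sumr sum_cst !mulrDr.
  rewrite mulKf // mulrCA -e1 -/(emp_moment y 2); ring.
by move=> i _; rewrite /centred -e1; ring.
Qed.

Lemma emp_moment_centred_even n (y : 'I_n -> R) m : (0 < n)%N -> ~~ odd m ->
  emp_moment (centred y) m <= 2 ^+ m.+1 * emp_moment y m.
Proof.
move=> n0 em; have ab (z : R) : `|z| ^+ m = z ^+ m.
  by rewrite -normrX ger0_norm // exprn_even_ge0.
have nn : n%:R != 0 :> R by rewrite pnatr_eq0 -lt0n.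
set M := n%:R^-1 * \sum_j y j.
apply: (@le_trans _ _ (n%:R^-1 * \sum_(i < n) (2 ^+ m * (y i ^+ m + M ^+ m)))).
  rewrite ler_wpM2l ?invr_ge0 // ler_sum // => i _.
  rewrite -ab -[y i ^+ m]ab -[M ^+ m]ab (le_trans _ (exprD_le m _ _)) //.
  by rewrite lerXn2r ?nnegrE ?addr_ge0 // ler_normB.
rewrite -mulr_sumr mulrCA exprSr -mulrA ler_wpM2l ?exprn_ge0 //.
rewrite big_split /= sum_cst mulrDr mulKf //.
by have := power_mean_even y n0 em; rewrite -/(emp_moment y m) -/M; lra.
Qed.

End power_means.

Section moments.
Context d (T : measurableType d) (R : realType) (P : probability T R).
Context (xi : nat -> {RV P >-> R}).
Hypothesis xi_exch : exchangeable xi.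
Hypothesis xi_mom : finite_moments xi.

Definition obs_moment n m w : R := emp_moment (fun i : 'I_n => xi i w) m.

Lemma measurable_obs_moment n m : measurable_fun setT (obs_moment n m).
Proof.
apply: measurable_funM => //; apply: measurable_sum => i.
exact: measurable_funX.
Qed.

Lemma obs_moment_ge0 n m w : ~~ odd m -> 0 <= obs_moment n m w.
Proof. exact: emp_moment_even_ge0. Qed.

Lemma integral_obs_moment m : ~~ odd m -> exists2 C : R, 0 <= C &
  forall n, (0 < n)%N -> (\int[P]_w (obs_moment n m w)%:E <= C%:E)%E.
Proof.
move=> em; pose C := fine (\int[P]_w (xi 0%N w ^+ m)%:E)%E.
have e0 w : (0 <= (xi 0%N w ^+ m)%:E)%E by rewrite lee_fin exprn_even_ge0.
have CE : (\int[P]_w (xi 0%N w ^+ m)%:E)%E = C%:E.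
  by rewrite /C fineK // integrable_fin_num.
exists C; first by apply: fine_ge0; apply: integral_ge0.
move=> n n0; rewrite /obs_moment /emp_moment.
under eq_integral do rewrite EFinM -sumEFin.
have mm i : measurable_fun setT (fun w => (xi i w ^+ m)%:E).
  by apply/measurable_EFinP; exact: measurable_funX.
rewrite ge0_integralZl //; last 2 first.
- exact: emeasurable_sum.
- by move=> w _; apply: sume_ge0 => i _; rewrite lee_fin exprn_even_ge0.
rewrite ge0_integral_sum //; last by move=> i w _; rewrite lee_fin exprn_even_ge0.
rewrite (eq_bigr (fun=> C%:E)).
  rewrite sumEFin sum_cst -EFinM lee_fin mulKf //.
  by rewrite pnatr_eq0 -lt0n.
move=> i _; rewrite (exch_marginal xi_exch (g := fun x => x ^+ m)) //.
by move=> x; exact: exprn_even_ge0.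
Qed.

(** By Jensen's inequality the power is dominated by a higher empirical moment, and
the expectation of this one does not depend on [n]. *)
Lemma integral_obs_moment_exp m r (c : R) : ~~ odd m -> 0 <= c -> exists2 C : R, 0 <= C &
  forall n, (0 < n)%N -> (\int[P]_w ((1 + c * obs_moment n m w) ^+ r)%:E <= C%:E)%E.
Proof.
move=> em c0; have [|C C0 CE] := @integral_obs_moment (m * r).
  by rewrite oddM (negbTE em).
exists (2 ^+ r * (1 + c ^+ r * C)).
  by rewrite mulr_ge0 ?exprn_ge0 // addr_ge0 // mulr_ge0 ?exprn_ge0.
move=> n n0.
apply: (@le_trans _ _ (\int[P]_w ((2 ^+ r)%:E * (1%:E + (c ^+ r)%:E * (obs_moment n (m * r) w)%:E)))%E).
  apply: ge0_le_integral => //.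
  - by move=> w _; rewrite lee_fin exprn_ge0 // addr_ge0 // mulr_ge0 // obs_moment_ge0.
  - apply/measurable_EFinP; apply: measurable_funX; apply: measurable_funD => //.
    by apply: measurable_funM => //; exact: measurable_obs_moment.
  - apply: measurable_funeM; apply: emeasurable_funD => //; apply: measurable_funeM.
    by apply/measurable_EFinP; exact: measurable_obs_moment.
  move=> w _; rewrite [leRHS](_ : _ = (2 ^+ r * (1 + c ^+ r * obs_moment n (m * r) w))%:E)%E; last first.
    by [].
  rewrite lee_fin.
  apply: le_trans (exprD_le _ _ _) _ => //; first by rewrite mulr_ge0 // obs_moment_ge0.
  rewrite expr1n exprMn ler_wpM2l ?exprn_ge0 // lerD2l ler_wpM2l ?exprn_ge0 //.
  rewrite /obs_moment; apply: le_trans (power_mean r n0 _) _; first by move=> i; exact: exprn_even_ge0.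
  rewrite ler_wpM2l ?invr_ge0 // ler_sum // => i _; by rewrite exprM.
have ge w : (0 <= (obs_moment n (m * r) w)%:E)%E by rewrite lee_fin obs_moment_ge0 // oddM (negbTE em).
have mE : measurable_fun setT (fun w => (obs_moment n (m * r) w)%:E).
  by apply/measurable_EFinP; exact: measurable_obs_moment.
rewrite ge0_integralZl //; last 2 first.
- by apply: emeasurable_funD => //; exact: measurable_funeM.
- by move=> w _; apply: adde_ge0 => //; apply: mule_ge0 => //; rewrite lee_fin exprn_ge0.
rewrite EFinM; apply: lee_wpmul2l; first by rewrite lee_fin exprn_ge0.
rewrite ge0_integralD //; last 2 first.
- by move=> w _; apply: mule_ge0 => //; rewrite lee_fin exprn_ge0.
- exact: measurable_funeM.
have -> : (\int[P]_w 1%:E = 1%:E)%E by rewrite integral_cst // mul1e; exact: probability_setT.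
rewrite EFinD; apply: leeD => //.
rewrite ge0_integralZl //; last by rewrite lee_fin exprn_ge0.
by rewrite EFinM; apply: lee_wpmul2l; rewrite ?lee_fin ?exprn_ge0 // CE.
Qed.

Lemma sample_centred_mean (k n : nat) (x : 'I_n -> R) : (0 < n)%N -> emp_moment x 1 = 0 -> (0 < k)%N ->
  sample (fun t : {ffun 'I_k -> 'I_n} => (k%:R^-1 * \sum_e x (t e)) ^+ 2) = k%:R^-1 * emp_moment x 2.
Proof.
move=> n0 x1 k0; have kk : k%:R != 0 :> R by rewrite pnatr_eq0 -lt0n.
rewrite (@eq_sample _ _ _ _ (fun t => k%:R^-1 ^+ 2 * (\sum_(e < k) \sum_(e' < k)
   @monomial R n x 'I_k [:: e; e'] t))); last first.
  move=> t; rewrite exprMn; congr (_ * _); rewrite expr2 mulr_suml; apply: eq_bigr => e _.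
  by rewrite mulr_sumr; apply: eq_bigr => e' _; rewrite /monomial !big_cons big_nil mulr1.
rewrite sampleZ sample_sum (eq_bigr (fun=> emp_moment x 2)); last first.
  move=> e _; rewrite sample_sum (bigD1 e) //= sample_monomial_double //.
    rewrite big1 ?addr0 //= => e' e'e; apply: sample_monomial_single => //.
    by apply/forallPn; exists e; rewrite /= eqxx (negbTE e'e).
  by move=> a /=; case: (e == a).
rewrite sum_cst expr2 -mulrA; congr (_ * _).
by rewrite mulKf.
Qed.

Lemma emp_moment_perm n (y : 'I_n -> R) (s : 'S_n) m : emp_moment (fun i => y (s i)) m = emp_moment y m.
Proof. by rewrite /emp_moment [in RHS](reindex_inj (@perm_inj _ s)). Qed.

(** When [k] indices are drawn from [n] with replacement, the variance of the
empirical moment is of order [1 / k]. *)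
Lemma obs_moment_step m : ~~ odd m -> exists2 C : R, 0 <= C & forall k n, (0 < k)%N -> (2 * k ^ 2 <= n)%N ->
  (\int[P]_w ((obs_moment k m w - obs_moment n m w) ^+ 2)%:E <= (C / k%:R)%:E)%E.
Proof.
move=> em; have [|C C0 CE] := @integral_obs_moment (m * 2); first by rewrite oddM andbF.
exists (2 * C) => [|k n k0 kn]; first by rewrite mulr_ge0.
have n0 : (0 < n)%N by apply: leq_trans kn; rewrite muln_gt0 expn_gt0 k0.
have le_kn : (k <= n)%N by rewrite (leq_trans _ kn) // -mulnn; nia.
pose Phi (a : 'I_k -> R) (y : n.-tuple R) : R := (emp_moment a m - emp_moment (tnth y) m) ^+ 2.
have mpow l (i : 'I_l) : measurable_fun setT (fun y : l.-tuple R => tnth y i ^+ m).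
  by apply: measurable_funX; exact: measurable_tnth.
have := @sampling_le _ _ _ P xi xi_exch _ n (widen_ord le_kn) Phi n0.
have tE w : tnth (obs xi n w) = (fun i => xi i w) by apply: funext => i; rewrite tnth_mktuple.
have sE w : sample (fun t : {ffun 'I_k -> 'I_n} => Phi (fun e => xi (t e) w) (obs xi n w)) <=
   k%:R^-1 * obs_moment n (m * 2) w.
  pose x (i : 'I_n) := xi i w ^+ m.
  have xa : n%:R^-1 * \sum_j x j = obs_moment n m w by [].
  rewrite (@eq_sample _ _ _ _ (fun t => (k%:R^-1 * \sum_e centred x (t e)) ^+ 2)); last first.
    move=> t; rewrite /Phi tE; congr (_ ^+ 2).
    rewrite /centred sumrB sum_cst mulrBr mulKf //.
    by rewrite pnatr_eq0 -lt0n.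
  rewrite sample_centred_mean // ?emp_moment_centred1 // ler_wpM2l ?invr_ge0 // emp_moment_centred2 //.
  apply: (@le_trans _ _ (emp_moment x 2)); first by rewrite gerBl sqr_ge0.
  by rewrite /obs_moment /emp_moment ler_wpM2l ?invr_ge0 // ler_sum // => i _; rewrite /x -exprM.
move=> h.
apply: (@le_trans _ _ (\int[P]_w (Phi (fun e => xi (widen_ord le_kn e) w) (obs xi n w))%:E)%E).
  rewrite le_eqVlt; apply/orP; left; apply/eqP.
  by apply: eq_integral => w _; rewrite /Phi tE.
apply: le_trans (h _ _ _ _ _) _.
- by move=> i j /(congr1 val) /= /ord_inj.
- by rewrite card_ord.
- by move=> a y; exact: sqr_ge0.
- move=> a y s; rewrite /Phi; congr ((_ - _) ^+ 2).
  rewrite -(emp_moment_perm (tnth y) s); congr (emp_moment _ m).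
  by apply: funext => i; rewrite tnth_mktuple.
- move=> t; apply: measurable_funX; apply: measurable_funB.
    by apply: measurable_funM => //; apply: measurable_sum => i; exact: mpow.
  by apply: measurable_funM => //; apply: measurable_sum => i; exact: mpow.
rewrite mulrAC -mulrA EFinM; apply: lee_wpmul2l; first by rewrite lee_fin.
apply: (@le_trans _ _ (\int[P]_w ((k%:R^-1)%:E * (obs_moment n (m * 2) w)%:E))%E).
  apply: ge0_le_integral => //.
  - move=> w _; rewrite lee_fin /sample mulr_ge0 ?invr_ge0 ?exprn_ge0 // sumr_ge0 // => t _.
    exact: sqr_ge0.
  - apply/measurable_EFinP; apply: measurable_funM => //; apply: measurable_sum => t.
    apply: measurable_funX; apply: measurable_funB.
      by apply: measurable_funM => //; apply: measurable_sum => i; exact: measurable_funX.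
    rewrite (_ : (fun w => _) = obs_moment n m); first exact: measurable_obs_moment.
    by apply: funext => w; rewrite tE.
  - by apply: measurable_funeM; apply/measurable_EFinP; exact: measurable_obs_moment.
  by move=> w _; rewrite -EFinM lee_fin.
rewrite ge0_integralZl //; last 2 first.
- by apply/measurable_EFinP; exact: measurable_obs_moment.
- by move=> w _; rewrite lee_fin obs_moment_ge0 // oddM andbF.
by rewrite EFinM; apply: lee_wpmul2l; rewrite ?lee_fin ?invr_ge0 // CE.
Qed.

Lemma sum_half n : \sum_(j < n) (2 ^+ j)^-1 <= 2 :> R.
Proof.
suff -> : \sum_(j < n) (2 ^+ j)^-1 = 2 - 2 * (2 ^+ n)^-1 :> R.
  by rewrite gerBl mulr_ge0 // invr_ge0 exprn_ge0.
elim: n => [|n IH]; first by rewrite big_ord0 expr0; field.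
by rewrite big_ord_recr /= IH exprS invfM; field; rewrite expf_neq0.
Qed.

(** Along a sequence that grows so fast the increments have summable second moments,
even after multiplication by [2 ^+ j]. *)
Lemma obs_moment_bounded (n_ : nat -> nat) m : ~~ odd m ->
  (forall j, 4 ^ j <= n_ j)%N -> (forall j, 2 * n_ j ^ 2 <= n_ j.+1)%N ->
  {ae P, forall w, exists C : R, forall j, obs_moment (n_ j) m w <= C}.
Proof.
move=> em n4 n2; have [C C0 CE] := obs_moment_step em.
have n0 j : (0 < n_ j)%N by rewrite (leq_trans _ (n4 j)) // expn_gt0.
pose Z j w : R := 2 ^+ j * (obs_moment (n_ j) m w - obs_moment (n_ j.+1) m w) ^+ 2.
have mD j : measurable_fun setT (fun w => (obs_moment (n_ j) m w - obs_moment (n_ j.+1) m w) ^+ 2).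
  by apply: measurable_funX; apply: measurable_funB; exact: measurable_obs_moment.
have p0 j : 0 <= 2 ^+ j :> R by rewrite exprn_ge0.
have := @bounded_partial_sums _ _ _ P Z (fun j => C * (2 ^+ j)^-1) (C * 2).
move=> /(_ _ _ _ _)/wrap[].
- by move=> j; apply: measurable_funM.
- by move=> j w; rewrite mulr_ge0 // sqr_ge0.
- move=> j; under eq_integral do rewrite EFinM.
  rewrite ge0_integralZl //; last 2 first.
  + by apply/measurable_EFinP.
  + by move=> w _; rewrite lee_fin sqr_ge0.
  apply: le_trans (lee_wpmul2l _ (CE _ _ (n0 j) (n2 j))) _; first by rewrite lee_fin.
  rewrite -EFinM lee_fin mulrCA ler_wpM2l // ler_pdivrMr ?ltr0n //.
  rewrite -[leLHS](mulKf (_ : 2 ^+ j != 0)) ?expf_neq0 // ler_wpM2l ?invr_ge0 //.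
  by rewrite -exprMn -natrM -natrX ler_nat.
- by move=> n; rewrite -mulr_sumr ler_wpM2l // sum_half.
apply: filterS => w [B' hB]; exists (obs_moment (n_ 0%N) m w + (2 + B')) => j.
suff : obs_moment (n_ j) m w <= obs_moment (n_ 0%N) m w + (\sum_(i < j) (2 ^+ i)^-1 + \sum_(i < j) Z i w).
  by have := sum_half j; have := hB j; lra.
elim: j => [|j IH]; first by rewrite !big_ord0 !addr0.
rewrite !big_ord_recr /=.
suff : obs_moment (n_ j.+1) m w <= obs_moment (n_ j) m w + ((2 ^+ j)^-1 + Z j w) by move: IH; lra.
rewrite /Z; set D := obs_moment _ _ _ - obs_moment _ _ _.
have -> : obs_moment (n_ j.+1) m w = obs_moment (n_ j) m w - D by rewrite /D; lra.
have q0 : 0 < 2 ^+ j :> R by rewrite exprn_gt0.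
suff : 0 <= (2 ^+ j)^-1 + 2 ^+ j * D ^+ 2 + D by lra.
(* Weighted arithmetic-geometric mean: the square is summable after multiplication by [2 ^+ j]. *)
have -> : (2 ^+ j)^-1 + 2 ^+ j * D ^+ 2 + D = (2 ^+ j)^-1 * ((2 ^+ j * D + 2^-1) ^+ 2 + 3 / 4).
  by move: (2 ^+ j) q0 => q q0; field; rewrite gt_eqF.
by apply: mulr_ge0; [rewrite invr_ge0 ltW|apply: addr_ge0; [exact: sqr_ge0|lra]].
Qed.

End moments.

(** * Fluctuations of traces *)
Section fluctuations.
Context d (T : measurableType d) (R : realType) (P : probability T R).
Context (xi : nat -> {RV P >-> R}).
Hypothesis xi_exch : exchangeable xi.
Hypothesis xi_mom : finite_moments xi.

Definition emp_mean n w : R := n%:R^-1 * \sum_(i < n) xi i w.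

Lemma measurable_walk_sum d' (T' : measurableType d') (V E : finType) (adj : rel V)
    (el : V -> V -> E) k (y : T' -> E -> R) :
  (forall e, measurable_fun setT (fun w => y w e)) ->
  measurable_fun setT (fun w => walk_sum adj el k (y w)).
Proof.
move=> my; apply: measurable_sum => i; apply: measurable_sum => p.
by apply: measurable_funM => //; apply: measurable_prod => l _.
Qed.

(** [sampling_le] carries the bound of [sample_var] over to the exchangeable sequence;
the empirical moments in that bound are integrated by [integral_obs_moment_exp]. *)
Lemma walk_fluctuation k : exists2 C : R, 0 <= C &
  forall (V E : finType) (x0 : V) (adj : rel V) (el : V -> V -> E) (r : R)
    (iota : E -> nat) (n : nat),
  symmetric adj -> (forall x y, el x y = el y x) ->
  (forall x y x' y', el x y = el x' y' -> (x = x' /\ y = y') \/ (x = y' /\ y = x')) ->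
  1 <= r -> (forall y, #|adj y|%:R <= r) ->
  injective iota -> (forall e, (iota e < n)%N) -> (0 < n)%N -> (2 * #|E| ^ 2 <= n)%N ->
  (\int[P]_w ((walk_sum adj el k.+1 (fun e => xi (iota e) w - emp_mean n w) -
      sample (fun t : {ffun E -> 'I_n} => walk_sum adj el k.+1
        (fun e => centred (fun i : 'I_n => xi i w) (t e)))) ^+ 2)%:E
   <= (C * (#|V|%:R * r ^+ k))%:E)%E.
Proof.
pose K := k.+1; pose m := (K + K)%N.
have em : ~~ odd m by rewrite /m addnn odd_double.
have [C C0 CE] := integral_obs_moment_exp xi_exch xi_mom m em (exprn_ge0 m.+1 (ler0n R 2)).
pose c : R := k.+2%:R ^+ 2 * m.+2%:R ^+ m.
have c0 : 0 <= c by rewrite mulr_ge0 ?exprn_ge0.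
exists (2 * (2 * C * c)); first by rewrite !mulr_ge0.
move=> V E x0 adj el r iota n adjC elC el_inj r1 degr ii iN n0 nE.
pose mean (y : n.-tuple R) : R := n%:R^-1 * \sum_j tnth y j.
pose W := walk_sum adj el K : (E -> R) -> R.
pose S (y : n.-tuple R) := sample (fun t : {ffun E -> 'I_n} => W (fun e => centred (tnth y) (t e))).
pose Phi (a : E -> R) (y : n.-tuple R) : R := (W (fun e => a e - mean y) - S y) ^+ 2.
have tE w : tnth (obs xi n w) = (fun i : 'I_n => xi i w :> R).
  by apply: funext => i; rewrite tnth_mktuple.
pose j e := Ordinal (iN e).
have meanP (y : n.-tuple R) (s : 'S_n) : mean [tuple tnth y (s i) | i < n] = mean y.
  rewrite /mean; congr (_ * _); rewrite [RHS](reindex_inj (@perm_inj _ s)).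
  by apply: eq_bigr => i _; rewrite tnth_mktuple.
have SP (y : n.-tuple R) (s : 'S_n) : S [tuple tnth y (s i) | i < n] = S y.
  rewrite /S /sample; congr (_ * _).
  pose h (t : {ffun E -> 'I_n}) := [ffun e => s (t e)].
  have hi : injective h.
    by move=> t t' /ffunP e; apply/ffunP => x; have := e x; rewrite !ffunE => /perm_inj.
  rewrite [RHS](reindex_inj hi); apply: eq_bigr => t _; congr W.
  apply: funext => e; rewrite /centred -/(mean _) -/(mean y) meanP.
  by rewrite tnth_mktuple ffunE.
have mtn i : measurable_fun setT (fun y : n.-tuple R => tnth y i) by exact: measurable_tnth.
have mmean : measurable_fun setT mean.
  by apply: measurable_funM => //; apply: measurable_sum => i.
have mS : measurable_fun setT S.
  apply: measurable_funM => //; apply: measurable_sum => t.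
  by apply: measurable_walk_sum => e; apply: measurable_funB.
have := @sampling_le _ _ _ P xi xi_exch _ n j Phi n0.
move=> /(_ _ nE _ _ _)/wrap[].
- by move=> e e' /(congr1 val) /= /ii.
- by move=> a y; exact: sqr_ge0.
- by move=> a y s; rewrite /Phi meanP SP.
- move=> t; apply: measurable_funX; apply: measurable_funB => //.
  by apply: measurable_walk_sum => e; apply: measurable_funB.
move=> h.
have -> : (\int[P]_w ((walk_sum adj el k.+1 (fun e => xi (iota e) w - emp_mean n w) -
      sample (fun t : {ffun E -> 'I_n} => walk_sum adj el k.+1
        (fun e => centred (fun i : 'I_n => xi i w) (t e)))) ^+ 2)%:E =
   \int[P]_w (Phi (fun e => xi (j e) w) (obs xi n w))%:E)%E.
  by apply: eq_integral => w _; rewrite /Phi /S /mean tE.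
apply: le_trans h _.
have -> : 2 * (2 * C * c) * (#|V|%:R * r ^+ k) = 2 * (2 * (c * (#|V|%:R * r ^+ k)) * C) by ring.
rewrite EFinM; apply: lee_wpmul2l; first by rewrite lee_fin.
have q1 w : emp_moment (centred (fun i : 'I_n => xi i w)) m <= 2 ^+ m.+1 * obs_moment xi n m w.
  exact: emp_moment_centred_even.
have D0 : 0 <= 2 * (c * (#|V|%:R * r ^+ k)).
  by rewrite !mulr_ge0 // exprn_ge0 // (le_trans ler01).
have mav : measurable_fun setT (fun w => ((1 + 2 ^+ m.+1 * obs_moment xi n m w) ^+ m)%:E).
  apply/measurable_EFinP; apply: measurable_funX; apply: measurable_funD => //.
  by apply: measurable_funM => //; exact: measurable_obs_moment.
have ge w : (0 <= ((1 + 2 ^+ m.+1 * obs_moment xi n m w) ^+ m)%:E)%E.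
  by rewrite lee_fin exprn_ge0 // addr_ge0 // mulr_ge0 ?exprn_ge0 // obs_moment_ge0.
apply: (@le_trans _ _ (\int[P]_w ((2 * (c * (#|V|%:R * r ^+ k)))%:E *
    ((1 + 2 ^+ m.+1 * obs_moment xi n m w) ^+ m)%:E))%E).
  apply: ge0_le_integral => //.
  - move=> w _; rewrite lee_fin /sample mulr_ge0 ?invr_ge0 ?exprn_ge0 // sumr_ge0 // => t _.
    exact: sqr_ge0.
  - apply/measurable_EFinP; apply: measurable_funM => //; apply: measurable_sum => t.
    apply: measurable_funX; apply: measurable_funB.
      apply: measurable_walk_sum => e; apply: measurable_funB => //.
      by apply: (measurableT_comp mmean); exact: measurable_obs_comp.
    by apply: (measurableT_comp mS); exact: measurable_obs_comp.
  - exact: measurable_funeM.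
  move=> w _; rewrite -EFinM lee_fin.
  pose x := centred (fun i : 'I_n => xi i w).
  have := @sample_var V adj x0 E el elC el_inj R r r1 degr n x n0 (emp_moment_centred1 _ n0) k m em (leqnn _).
  rewrite (@eq_sample _ _ _ _ (fun t => Phi (fun e => xi (t e) w) (obs xi n w))); last first.
    by move=> t; rewrite /Phi /S /mean tE.
  move/le_trans; apply.
  have -> : 2 * (c * (#|V|%:R * r ^+ k)) * (1 + 2 ^+ m.+1 * obs_moment xi n m w) ^+ m =
    2 * (1 + 2 ^+ m.+1 * obs_moment xi n m w) ^+ m * (k.+2%:R ^+ 2 * (#|V|%:R * (r ^+ k * m.+2%:R ^+ m))).
    by rewrite /c; ring.
  apply: ler_wpM2r.
    by rewrite !mulr_ge0 ?exprn_ge0 // (le_trans ler01).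
  apply: ler_wpM2l => //; apply: lerXn2r; rewrite ?nnegrE.
  - by rewrite addr_ge0 // emp_moment_even_ge0.
  - by rewrite addr_ge0 // mulr_ge0 ?exprn_ge0 // obs_moment_ge0.
  - by rewrite lerD2l; exact: q1.
rewrite ge0_integralZl //.
apply: le_trans (lee_wpmul2l _ (CE n n0)) _; first by rewrite lee_fin.
by rewrite -EFinM.
Qed.

End fluctuations.

Lemma sample_sizes (L : nat -> nat) : exists n_ : nat -> nat,
  forall j, [/\ (4 ^ j <= n_ j)%N, (2 * n_ j ^ 2 <= n_ j.+1)%N & (L j <= n_ j)%N].
Proof.
pose fix n_ j := if j is i.+1 then (2 * n_ i ^ 2 + 4 ^ i.+1 + L i.+1)%N else (1 + L 0)%N.
exists n_ => j; split; last by case: j => [|j] /=; rewrite ?leq_addl.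
  by case: j => [|j] /=; [rewrite leq_addr|rewrite addnAC leq_addl].
by rewrite /= -addnA leq_addr.
Qed.

Section scaled_pattern.
Context (R : rcfType) (n : nat) (adj : rel 'I_n.+1) (w r : nat).
Hypothesis w0 : (0 < w)%N.
Hypothesis wn : (w <= n.+1)%N.
Hypothesis r0 : (0 < r)%N.
Hypothesis degw : forall i, (#|adj i| <= w)%N.
Hypothesis flat : forall i i' : 'I_n.+1, (i' <= i)%N ->
  (#|[pred j | adj i j != adj i' j]| <= 4 * (i - i'))%N.

(** With blocks of [r ^ 2] rows the part of low rank costs [n / r], and the error costs
[r * n / sqrt w]. *)
Lemma trace_norm_scaled_pattern :
  trace_norm_le ((Num.sqrt w%:R)^-1 *: pattern_mx R adj)
    (n.+1%:R * (r%:R^-1 + 3 * r%:R / Num.sqrt w%:R)).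
Proof.
have r2 : (0 < r ^ 2)%N by rewrite expn_gt0 r0.
have H := trace_norm_leZ (Num.sqrt w%:R)^-1
  (@trace_norm_pattern R n adj w 4 (r ^ 2) w0 isT r2 degw flat).
apply: trace_norm_le_trans H.
set s := Num.sqrt _; have s2 : s ^+ 2 = w%:R by rewrite sqr_sqrtr.
have s1 : 1 <= s by rewrite -[leLHS]sqrtr1 ler_wsqrtr // ler1n.
have s0 : 0 < s by apply: lt_le_trans s1.
have rr : 0 < r%:R :> R by rewrite ltr0n.
have -> : Num.sqrt (r ^ 2 * w)%:R = r%:R * s :> R.
  by rewrite natrM sqrtrM // natrX sqrtr_sqr ger0_norm.
have -> : Num.sqrt (n.+1 * (n.+1 * (4 * r ^ 2)))%:R = n.+1%:R * (2 * r%:R) :> R.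
  rewrite (_ : (_ * _)%N = ((n.+1 * (2 * r)) ^ 2)%N); last by rewrite -!mulnn; lia.
  by rewrite natrX sqrtr_sqr ger0_norm // natrM natrM.
rewrite ger0_norm ?invr_ge0 ?(ltW s0) //.
have n1 : 0 < n.+1%:R :> R by rewrite ltr0n.
have hq : (n.+1 %/ r ^ 2).+1%:R <= n.+1%:R / r%:R ^+ 2 + 1 :> R.
  rewrite -natr1 lerD2r ler_pdivlMr ?exprn_gt0 // -natrX -natrM ler_nat.
  exact: leq_trunc_div.
apply: (@le_trans _ _ (s^-1 * ((n.+1%:R / r%:R ^+ 2 + 1) * (r%:R * s) + n.+1%:R * (2 * r%:R)))).
  apply: ler_wpM2l; first by rewrite invr_ge0 ltW.
  by rewrite lerD2r; apply: ler_wpM2r hq; rewrite mulr_ge0 // ltW.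
have -> : s^-1 * ((n.+1%:R / r%:R ^+ 2 + 1) * (r%:R * s) + n.+1%:R * (2 * r%:R)) =
  n.+1%:R / r%:R + (r%:R + 2 * (n.+1%:R * r%:R / s)).
  by field; rewrite !gt_eqF.
rewrite mulrDr lerD2l.
have -> : n.+1%:R * (3 * r%:R / s) = n.+1%:R * r%:R / s + 2 * (n.+1%:R * r%:R / s) by ring.
rewrite lerD2r ler_pdivlMr // mulrC ler_wpM2r // (le_trans _ (_ : w%:R <= _)) ?ler_nat //.
by rewrite -s2 expr2; apply: ler_peMl => //; exact: ltW.
Qed.

End scaled_pattern.

(** * Almost sure convergence for a sequence of band patterns *)
Definition edge n (x y : 'I_n) : 'I_n * 'I_n := if (x <= y)%N then (x, y) else (y, x).

Lemma edgeC n (x y : 'I_n) : edge x y = edge y x.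
Proof.
rewrite /edge; case: (ltngtP x y) => // e.
by rewrite (val_inj e).
Qed.

Lemma edge_inj n (x y x' y' : 'I_n) : edge x y = edge x' y' ->
  (x = x' /\ y = y') \/ (x = y' /\ y = x').
Proof. by rewrite /edge; case: ifP => _; case: ifP => _ [-> ->]; auto. Qed.

Lemma square_summable_cvg0 (R : realType) (z : nat -> R) (B : R) :
  (forall n, \sum_(j < n) z j ^+ 2 <= B) -> z j @[j --> \oo] --> 0.
Proof.
move=> zB; have cz : cvgn (series (fun j => z j ^+ 2)).
  apply: nondecreasing_is_cvgn.
    by apply/nondecreasing_seqP => n; rewrite /series /= big_nat_recr //= lerDl sqr_ge0.
  by exists B => _ [n _ <-]; rewrite /series /= big_mkord.
have z2 := cvg_series_cvg_0 cz.
apply/cvgrPdist_lt => e e0; move/cvgrPdist_lt: z2 => /(_ (e ^+ 2) (exprn_gt0 2 e0)).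
apply: filterS => j; rewrite !sub0r !normrN normrX => h.
by rewrite ltr_pXn2r // ?nnegrE ?(ltW e0) in h.
Qed.

Lemma sqrt_large (R : realType) (w_ : nat -> nat) : w_ j @[j --> \oo] --> \oo ->
  forall a : R, \forall j \near \oo, a <= Num.sqrt (w_ j)%:R.
Proof.
move=> w_oo a; have [a0|a0] := leP a 0.
  by apply: nearW => j; rewrite (le_trans a0) ?sqrtr_ge0.
move/cvgnyPge: w_oo => /(_ (Num.bound (a ^+ 2))).
apply: filterS => j h; rewrite -[a]ger0_norm ?(ltW a0) // -sqrtr_sqr ler_wsqrtr //.
rewrite (le_trans (ltW (archi_boundP (sqr_ge0 a)))) // ler_nat //.
Qed.

Lemma small_over_large (R : realType) (s z : nat -> R) (C : R) :
  (forall a : R, \forall j \near \oo, a <= s j) ->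
  (\forall j \near \oo, `|z j| <= C / s j) -> z j @[j --> \oo] --> 0.
Proof.
move=> s_oo zC; apply/cvgrPdist_le => e e0; near=> j.
rewrite sub0r normrN (le_trans (_ : _ <= C / s j)) //; first by near: j.
have sj : 1 <= s j by near: j.
have sC : C / e <= s j by near: j.
rewrite ler_pdivrMr; last exact: lt_le_trans sj.
by rewrite mulrC -ler_pdivrMr.
Unshelve. all: by end_near. Qed.

Lemma empirical_varianceE d (T : measurableType d) (R : realType) (P : probability T R)
    (xi : nat -> {RV P >-> R}) n w : (0 < n)%N ->
  empirical_variance xi n w = emp_moment (centred (fun i : 'I_n => xi i w)) 2.
Proof.
by move=> n0; rewrite emp_moment_centred2.
Qed.

Section almost_sure.
Context d (T : measurableType d) (R : realType) (P : probability T R).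
Context (xi : nat -> {RV P >-> R}) (V : {RV P >-> R}).
Hypothesis xi_exch : exchangeable xi.
Hypothesis xi_mom : finite_moments xi.
Hypothesis V_lim : limiting_empirical_variance xi V.
Context (q_ : nat -> nat) (adj_ : forall j, rel 'I_(q_ j).+1) (w_ : nat -> nat).
Context (iota_ : forall j, 'I_(q_ j).+1 * 'I_(q_ j).+1 -> nat).
Arguments adj_ : clear implicits.
Arguments iota_ : clear implicits.
Hypothesis adjC : forall j, symmetric (adj_ j).
Hypothesis w0 : forall j, (0 < w_ j)%N.
Hypothesis wq : forall j, (w_ j <= (q_ j).+1)%N.
Hypothesis degw : forall j i, (#|adj_ j i| <= w_ j)%N.
Hypothesis flat : forall j (i i' : 'I_(q_ j).+1), (i' <= i)%N ->
  (#|[pred k | adj_ j i k != adj_ j i' k]| <= 4 * (i - i'))%N.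
Hypothesis w_oo : w_ j @[j --> \oo] --> \oo.
Hypothesis summable_bands : exists B : R, forall n,
  \sum_(j < n) ((q_ j).+1%:R * (w_ j)%:R)^-1 <= B.
Hypothesis tree_walk_cvg : forall k,
  tree_walk_total (adj_ j) R k / ((q_ j).+1%:R * Num.sqrt (w_ j)%:R ^+ k) @[j --> \oo] --> ((ballot k 0)%:R : R).
Hypothesis iota_inj : forall j, injective (iota_ j).

Definition band_mx j (w : T) : 'M[R]_((q_ j).+1) :=
  \matrix_(x, y) ((adj_ j x y)%:R * xi (iota_ j (edge x y)) w).

Let s_ j : R := Num.sqrt (w_ j)%:R.

Let s2 j : s_ j ^+ 2 = (w_ j)%:R. Proof. by rewrite sqr_sqrtr. Qed.
Let s1 j : 1 <= s_ j. Proof. by rewrite -[leLHS]sqrtr1 ler_wsqrtr // ler1n. Qed.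
Let s0 j : 0 < s_ j. Proof. exact: lt_le_trans (s1 j). Qed.
Let N0 j : 0 < (q_ j).+1%:R :> R. Proof. by rewrite ltr0n. Qed.
Let w1 j : 1 <= (w_ j)%:R :> R. Proof. by rewrite ler1n. Qed.
Let degR j y : #|adj_ j y|%:R <= (w_ j)%:R :> R. Proof. by rewrite ler_nat. Qed.

Section sizes.
Context (n_ : nat -> nat).
Hypothesis n4 : forall j, (4 ^ j <= n_ j)%N.
Hypothesis n2 : forall j, (2 * n_ j ^ 2 <= n_ j.+1)%N.
Hypothesis nE : forall j, (2 * #|{: 'I_(q_ j).+1 * 'I_(q_ j).+1}| ^ 2 <= n_ j)%N.
Hypothesis n_iota : forall j e, (iota_ j e < n_ j)%N.

Let n0 j : (0 < n_ j)%N. Proof. by rewrite (leq_trans _ (n4 j)) // expn_gt0. Qed.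

Let X k j w := walk_sum (adj_ j) (@edge _) k
  (fun e => xi (iota_ j e) w - emp_mean xi (n_ j) w).
Let S k j w := sample (fun t : {ffun 'I_(q_ j).+1 * 'I_(q_ j).+1 -> 'I_(n_ j)} =>
  walk_sum (adj_ j) (@edge _) k (fun e => centred (fun i : 'I_(n_ j) => xi i w) (t e))).

(** The second moments are bounded by a multiple of the summable sequence of the
inverses of size times width. *)
Lemma fluctuation_cvg k :
  {ae P, forall w, (X k.+1 j w - S k.+1 j w) / ((q_ j).+1%:R * s_ j ^+ k.+1) @[j --> \oo] --> 0}.
Proof.
have [C C0 CE] := walk_fluctuation xi_exch xi_mom k.
have [B HB] := summable_bands.
pose Z j w := ((X k.+1 j w - S k.+1 j w) / ((q_ j).+1%:R * s_ j ^+ k.+1)) ^+ 2.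
have mXS j : measurable_fun setT (fun w => X k.+1 j w - S k.+1 j w).
  have mm : measurable_fun setT (fun w => emp_mean xi (n_ j) w).
    by apply: measurable_funM => //; apply: measurable_sum.
  apply: measurable_funB; first by apply: measurable_walk_sum => e; apply: measurable_funB.
  apply: measurable_funM => //; apply: measurable_sum => t.
  by apply: measurable_walk_sum => e; apply: measurable_funB.
have := @bounded_partial_sums _ _ _ P Z (fun j => C * ((q_ j).+1%:R * (w_ j)%:R)^-1) (C * B).
move=> /(_ _ _ _ _)/wrap[].
- by move=> j; apply: measurable_funX; apply: measurable_funM.
- by move=> j w; exact: sqr_ge0.
- move=> j.
  pose a : R := (((q_ j).+1%:R * s_ j ^+ k.+1) ^+ 2)^-1.
  have a0 : 0 <= a by rewrite invr_ge0 sqr_ge0.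
  rewrite (_ : (\int[P]_w (Z j w)%:E)%E = (\int[P]_w (a%:E * ((X k.+1 j w - S k.+1 j w) ^+ 2)%:E))%E); last first.
    by apply: eq_integral => w _; rewrite -EFinM /Z /a exprMn exprVn mulrC.
  rewrite ge0_integralZl //; last 2 first.
  + by apply/measurable_EFinP; exact: measurable_funX.
  + by move=> w _; rewrite lee_fin sqr_ge0.
  have := CE _ _ ord0 (adj_ j) (@edge _) (w_ j)%:R (iota_ j) (n_ j) (@adjC j) (@edgeC _) (@edge_inj _)
    (w1 j) (@degR j) (@iota_inj j) (@n_iota j) (n0 j) (nE j).
  move=> /(lee_wpmul2l _) h; apply: le_trans (h _ _) _; first by rewrite lee_fin.
  rewrite -EFinM lee_fin card_ord /a exprMn -exprM mulnC exprM s2.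
  rewrite le_eqVlt; apply/orP; left; apply/eqP.
  rewrite [(w_ j)%:R ^+ k.+1]exprS; have := N0 j; have : 0 < (w_ j)%:R ^+ k :> R by rewrite exprn_gt0 // ltr0n.
  have : 0 < (w_ j)%:R :> R by rewrite ltr0n.
  move: ((w_ j)%:R ^+ k : R) ((w_ j)%:R : R) ((q_ j).+1%:R : R) => u v t v0 u0 t0.
  by field; rewrite !gt_eqF.
- by move=> n; rewrite -mulr_sumr ler_wpM2l.
by apply: filterS => w [B' h]; apply: square_summable_cvg0 h.
Qed.

Lemma sample_limit k w (v : R) : (exists C : R, forall j, obs_moment xi (n_ j) (k.+1 + k.+1) w <= C) ->
  empirical_variance xi (n_ j) w @[j --> \oo] --> v ->
  S k.+1 j w / ((q_ j).+1%:R * s_ j ^+ k.+1) @[j --> \oo] --> (ballot k.+1 0)%:R * v ^+ (k.+1)./2.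
Proof.
move=> [C HC] Vv; set m := (k.+1 + k.+1)%N in HC.
have em : ~~ odd m by rewrite /m addnn odd_double.
pose x j := centred (fun i : 'I_(n_ j) => xi i w : R).
have p2 j : emp_moment (x j) 2 = empirical_variance xi (n_ j) w.
  by rewrite empirical_varianceE.
pose G j := tree_walk_total (adj_ j) R k.+1 / ((q_ j).+1%:R * s_ j ^+ k.+1).
pose D j := S k.+1 j w / ((q_ j).+1%:R * s_ j ^+ k.+1) - G j * empirical_variance xi (n_ j) w ^+ (k.+1)./2.
have D0 : D j @[j --> \oo] --> 0.
  pose Q := 1 + 2 ^+ m.+1 * C.
  apply: (@small_over_large _ s_ D (Q ^+ k.+1 * k.+3%:R ^+ k.+1)); first exact: sqrt_large.
  apply: nearW => j.
  have := @sample_mean 'I_(q_ j).+1 (adj_ j) _ (@edge _) (@edgeC _) (@edge_inj _) R (w_ j)%:R (w1 j) (@degR j)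
     (n_ j) (x j) (n0 j) (emp_moment_centred1 _ (n0 j)) k.+1 m isT em (leq_addr _ _).
  rewrite -/(s_ j) p2 card_ord /= => h.
  have e : D j = (S k.+1 j w - tree_walk_total (adj_ j) R k.+1 * empirical_variance xi (n_ j) w ^+ (k.+1)./2) /
     ((q_ j).+1%:R * s_ j ^+ k.+1).
    have gen (a g p den : R) : a / den - g / den * p = (a - g * p) / den.
      by rewrite mulrBl mulrAC.
    exact: gen.
  have den : 0 < (q_ j).+1%:R * s_ j ^+ k.+1 by rewrite mulr_gt0 // exprn_gt0.
  rewrite e normrM [`|_^-1|]gtr0_norm ?invr_gt0 // ler_pdivrMr //.
  apply: le_trans h _.
  have -> : Q ^+ k.+1 * k.+3%:R ^+ k.+1 / s_ j * ((q_ j).+1%:R * s_ j ^+ k.+1) =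
    Q ^+ k.+1 * ((q_ j).+1%:R * (s_ j ^+ k * k.+3%:R ^+ k.+1)).
    rewrite [s_ j ^+ k.+1]exprS; move: (s0 j).
    move: (s_ j ^+ k) (s_ j) (Q ^+ _) (k.+3%:R ^+ _ : R) ((q_ j).+1%:R : R) => a b e' f g b0.
    by field; rewrite gt_eqF.
  apply: ler_wpM2r.
    by rewrite mulr_ge0 // mulr_ge0 // exprn_ge0 // ltW.
  have pm : 0 <= emp_moment (x j) m by apply: emp_moment_even_ge0.
  have le1 : emp_moment (x j) m <= 2 ^+ m.+1 * C.
    apply: le_trans (emp_moment_centred_even _ (n0 j) em) _.
    by rewrite ler_wpM2l ?exprn_ge0 //; exact: HC.
  by rewrite lerXn2r ?nnegrE ?lerD2l // addr_ge0 // (le_trans pm).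
have -> : (fun j => S k.+1 j w / ((q_ j).+1%:R * s_ j ^+ k.+1)) =
  (fun j => G j * empirical_variance xi (n_ j) w ^+ (k.+1)./2 + D j).
  by apply: funext => j; rewrite /D addrC subrK.
rewrite -[X in _ --> X]addr0; apply: cvgD D0; apply: cvgM; first exact: tree_walk_cvg.
apply: (@cvg_comp _ _ _ _ (fun z : R => z ^+ (k.+1)./2) _ _ _ Vv).
exact: exprn_continuous.
Qed.

Lemma trace_limit w (v : R) : (forall k, exists C : R, forall j, obs_moment xi (n_ j) (k.+1 + k.+1) w <= C) ->
  (forall k, (X k.+1 j w - S k.+1 j w) / ((q_ j).+1%:R * s_ j ^+ k.+1) @[j --> \oo] --> 0) ->
  empirical_variance xi (n_ j) w @[j --> \oo] --> v ->
  forall k, (q_ j).+1%:R^-1 * \tr (((s_ j)^-1 *: (band_mx j w - emp_mean xi (n_ j) w *: pattern_mx R (adj_ j))) ^+ k)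
    @[j --> \oo] --> (ballot k 0)%:R * v ^+ k./2.
Proof.
move=> bnd fl Vv [|k].
  rewrite (_ : (fun j => _) = fun=> 1); first by rewrite /= expr0 mulr1; exact: cvg_cst.
  by apply: funext => j; rewrite expr0 mxtrace1 mulVf // gt_eqF.
have -> : (fun j => (q_ j).+1%:R^-1 * \tr (((s_ j)^-1 *: (band_mx j w - emp_mean xi (n_ j) w *: pattern_mx R (adj_ j))) ^+ k.+1)) =
  (fun j => S k.+1 j w / ((q_ j).+1%:R * s_ j ^+ k.+1) +
    (X k.+1 j w - S k.+1 j w) / ((q_ j).+1%:R * s_ j ^+ k.+1)).
  apply: funext => j; rewrite -mulrDl [S _ _ _ + _]addrC subrK exprZn mxtraceZ.
  rewrite (trace_pow_walk (adj := adj_ j) (el := @edge _)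
     (y := fun e => xi (iota_ j e) w - emp_mean xi (n_ j) w)).
    by rewrite invfM mulrA exprVn mulrC.
  by move=> x y; rewrite !mxE; case: (adj_ j x y); rewrite ?mul1r ?mulr1 // !mul0r mulr0 subrr.
by rewrite -[X in _ --> X]addr0; apply: cvgD; [exact: sample_limit|exact: fl].
Qed.

End sizes.

(** The block size [r ^ 2] is fixed first and makes the part of low rank small; the
width, going to infinity, then makes the error small. *)
Lemma trace_norm_mean (mean : nat -> R) (C : R) : (forall j, `|mean j| <= C) ->
  forall e : R, 0 < e -> \forall j \near \oo,
    trace_norm_le ((s_ j)^-1 *: (mean j *: pattern_mx R (adj_ j))) (e * (q_ j).+1%:R).
Proof.
move=> mC e e0.
have C0 : 0 <= C by apply: le_trans (mC 0%N).
pose r := (Num.bound (2 * (C + 1) / e)).+1.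
have re : 2 * (C + 1) / e <= r%:R.
  apply: (le_trans (ltW (archi_boundP _))); last by rewrite ler_nat.
  by rewrite divr_ge0 ?(ltW e0) // mulr_ge0 // addr_ge0.
have r0 : 0 < r%:R :> R by rewrite ltr0n.
near=> j.
have sj : 6 * r%:R * (C + 1) / e <= s_ j by near: j; exact: sqrt_large.
have H := trace_norm_leZ (mean j) (@trace_norm_scaled_pattern R _ (adj_ j) (w_ j) r (w0 j) (wq j) isT
  (degw (j := j)) (@flat j)).
rewrite scalerA [_ * mean j]mulrC -scalerA; apply: trace_norm_le_trans H.
apply: (@le_trans _ _ ((C + 1) * ((q_ j).+1%:R * (r%:R^-1 + 3 * r%:R / s_ j)))).
  apply: ler_wpM2r; last by rewrite (le_trans (mC j)) // lerDl.
  by rewrite mulr_ge0 // addr_ge0 ?invr_ge0 // divr_ge0 ?mulr_ge0 // ltW.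
rewrite mulrCA [e * _]mulrC ler_wpM2l // mulrDr.
have h1 : (C + 1) / r%:R <= e / 2.
  rewrite ler_pdivrMr //; move: re; rewrite ler_pdivrMr //; lra.
have h2 : (C + 1) * (3 * r%:R / s_ j) <= e / 2.
  rewrite mulrA ler_pdivrMr //; move: sj; rewrite ler_pdivrMr //; lra.
by lra.
Unshelve. all: by end_near. Qed.

(** The sample sizes [n_ j] exceed the numbers of entries so much that
[sampling_le] applies to the entries at stage [j] and that the empirical moments
stay bounded.  The entries are centred by the empirical mean of [n_ j]
observations, which is undone by [trace_moments_weak_cvg]. *)
Theorem band_weak_cvg :
  {ae P, forall w, weak_cvg (fun j => eigenvalue_measure ((Num.sqrt (w_ j)%:R)^-1 *: band_mx j w))
     (semicircle_measure (V w))}.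
Proof.
pose L j := (2 * #|{: 'I_(q_ j).+1 * 'I_(q_ j).+1}| ^ 2 + \sum_e (iota_ j e).+1)%N.
have [n_ nP] := sample_sizes L.
have n4 j : (4 ^ j <= n_ j)%N by case: (nP j).
have n2 j : (2 * n_ j ^ 2 <= n_ j.+1)%N by case: (nP j).
have nL j : (L j <= n_ j)%N by case: (nP j).
have nE j : (2 * #|{: 'I_(q_ j).+1 * 'I_(q_ j).+1}| ^ 2 <= n_ j)%N.
  by rewrite (leq_trans _ (nL j)) // leq_addr.
have n_iota j e : (iota_ j e < n_ j)%N.
  by rewrite (leq_trans _ (nL j)) // /L (bigD1 e) //= addnCA leq_addr.
have n0 j : (0 < n_ j)%N by rewrite (leq_trans _ (n4 j)) // expn_gt0.
have n_oo : n_ j @[j --> \oo] --> \oo.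
  apply/cvgnyPge => A; exists A => // j /= Aj; apply: leq_trans (n4 j).
  by rewrite (leq_trans Aj) // ltnW // ltn_expl.
have A1 : {ae P, forall w, forall k, exists C : R, forall j, obs_moment xi (n_ j) (k.+1 + k.+1) w <= C}.
  by apply: ae_foralln => k; apply: obs_moment_bounded => //; rewrite addnn odd_double.
have A2 := ae_foralln (fun k => fluctuation_cvg n4 nE n_iota k).
have A3 := V_lim.
apply: filterS3 A1 A2 A3 => w bnd fl Vw f cf bf.
have Vn : empirical_variance xi (n_ j) w @[j --> \oo] --> V w.
  exact: (@cvg_comp _ _ _ n_ (fun n => empirical_variance xi n w) _ _ _ n_oo Vw).
have V0 : 0 <= V w.
  rewrite -(cvg_lim _ Vn) //; apply: limr_ge; first by apply/cvg_ex; exists (V w).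
  apply: nearW => j.
  by rewrite empirical_varianceE //; exact: emp_moment_even_ge0.
have [hm mE] := semicircle_moments V0.
have [C HC] := bnd 0%N.
have mC j : `|emp_mean xi (n_ j) w| <= 1 + C.
  have := power_mean_even (fun i : 'I_(n_ j) => xi i w : R) (n0 j) (isT : ~~ odd 2).
  have := HC j; rewrite /obs_moment /emp_moment -/(emp_mean xi (n_ j) w) => h1 h2.
  have h := le_trans h2 h1; rewrite ler_norml; move: (emp_mean _ _ _) h => z h.
  by apply/andP; split; nra.
have [M HM] : exists M, bounded_by f M.
  case: bf => M [_ HM]; exists (M + 1) => x; apply: HM => //; by rewrite ltrDl.
apply: (@trace_moments_weak_cvg R (fun j => (q_ j).+1)
  (fun j => (s_ j)^-1 *: (band_mx j w - emp_mean xi (n_ j) w *: pattern_mx R (adj_ j)))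
  (fun j => (s_ j)^-1 *: band_mx j w) (semicircle_measure (V w)) (1 + 4 * V w)) HM => //.
- move=> j; apply/matrixP => x y; rewrite !mxE (@adjC j y x).
  by rewrite (edgeC y x).
- move=> j; apply/matrixP => x y; rewrite !mxE (@adjC j y x).
  by rewrite (edgeC y x).
- by rewrite lerDl mulr_ge0.
- by move=> k; apply: semicircle_growth.
- by move=> k; rewrite mE; apply: trace_limit.
move=> e e0; apply: filterS (trace_norm_mean mC e0) => j.
by rewrite -scalerBr opprB addrC subrK.
Qed.

End almost_sure.

(** * The geometry of bands *)
Lemma near_succ (Q : nat -> Prop) : (\forall N \near \oo, Q N) -> \forall q \near \oo, Q q.+1.
Proof. by case=> M _ h; exists M => // n /= Mn; apply: h; rewrite /= ltnW. Qed.

Section counting.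
Context (N : nat).

Lemma card_le_seq (A : pred 'I_N) (s : seq nat) : (forall j : 'I_N, A j -> (j : nat) \in s) ->
  (#|A| <= size s)%N.
Proof.
move=> As; rewrite cardE -(size_map val); apply: uniq_leq_size.
  by rewrite map_inj_uniq ?enum_uniq //; exact: val_inj.
by move=> x /mapP[j]; rewrite mem_enum => /As js ->.
Qed.

Lemma card_ge_window (A : pred 'I_N) lo len : (lo + len <= N)%N ->
  (forall j : 'I_N, (lo <= j < lo + len)%N -> A j) -> (len <= #|A|)%N.
Proof.
move=> hN hA.
have lt (t : 'I_len) : (lo + t < N)%N by rewrite (leq_trans _ hN) // ltn_add2l.
pose f (t : 'I_len) := Ordinal (lt t).
have fi : injective f by move=> t t' /(congr1 val) /= /addnI /val_inj.
rewrite -[len]card_ord -(card_imset _ fi); apply: subset_leq_card.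
by apply/fintype.subsetP => _ /imsetP[t _ ->]; apply: hA; rewrite /= leq_addr ltn_add2l ltn_ord.
Qed.

End counting.

Lemma flat_of_unit_shift q (adj : rel 'I_q.+1) c :
  (forall i i' : 'I_q.+1, i = i'.+1 :> nat -> (#|[pred j | adj i j != adj i' j]| <= c)%N) ->
  forall i i' : 'I_q.+1, (i' <= i)%N -> (#|[pred j | adj i j != adj i' j]| <= c * (i - i'))%N.
Proof.
move=> h i i' le_i; have [n ni] : exists n, i = (i' + n)%N :> nat.
  by exists (i - i')%N; rewrite subnKC.
elim: n i {le_i} ni => [|n IH] i ni.
  have -> : i = i' by apply: val_inj; rewrite /= ni addn0.
  by rewrite fintype.eq_card0 // => j; rewrite !inE eqxx.
have ltn1 : (i' + n < q.+1)%N by rewrite (leq_trans _ (ltn_ord i)) // ni addnS.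
have := h i (Ordinal ltn1) _; rewrite ni /= addnS => /(_ erefl) h1.
have := IH (Ordinal ltn1) erefl; rewrite /= addKn => h2.
have -> : (c * ((i' + n).+1 - i') = c + c * n)%N by rewrite -addnS addKn mulnS.
apply: leq_trans (leq_add h1 h2); rewrite -cardUI; apply: leq_trans (leq_addr _ _).
apply: subset_leq_card; apply/fintype.subsetP => j; rewrite !inE.
by case: (adj i j); case: (adj i' j); case: (adj _ j).
Qed.

Section band_geometry.
Context (b : nat -> nat) (q : nat).
Local Notation N := q.+1.
Local Notation B := (b N).

Lemma strict_bandE (i j : 'I_N) : strict_band b i j = (i <= j + B)%N && (j <= i + B)%N.
Proof. by rewrite /strict_band; apply/idP/andP; lia. Qed.

Lemma strict_bandC : symmetric (strict_band b (N := N)).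
Proof. by move=> i j; rewrite !strict_bandE andbC. Qed.

Lemma strict_degree (i : 'I_N) : (#|strict_band b i| <= band_scale b N)%N.
Proof.
rewrite /band_scale leq_min; apply/andP; split; first by rewrite -[leqRHS]card_ord max_card.
rewrite -(size_iota (i - B) (2 * B + 1)); apply: card_le_seq => j.
by rewrite strict_bandE mem_iota; lia.
Qed.

Lemma strict_flat (i i' : 'I_N) : (i' <= i)%N ->
  (#|[pred j | strict_band b i j != strict_band b i' j]| <= 4 * (i - i'))%N.
Proof.
apply: flat_of_unit_shift i i' => i i' ii.
apply: (@leq_trans (size [:: (i - B.+1)%N; (i + B)%N; 0%N; 0%N])) => //; apply: card_le_seq => j.
rewrite !inE !strict_bandE => h; lia.
Qed.

Lemma strict_degree_interior (i : 'I_N) : (B <= i)%N -> (i + B < N)%N ->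
  (2 * B + 1 <= #|strict_band b i|)%N.
Proof.
move=> h1 h2; apply: (card_ge_window (lo := (i - B)%N)); first lia.
by move=> j; rewrite strict_bandE; lia.
Qed.

Hypothesis b_le : (B <= q)%N.

Lemma strict_degree_ge (i : 'I_N) : (B <= #|strict_band b i|)%N.
Proof.
have := ltn_ord i => iN; have [h|h] := leqP B i.
  by apply: (card_ge_window (lo := (i - B)%N)) => [|j]; rewrite ?strict_bandE; lia.
by apply: (card_ge_window (lo := 0%N)) => [|j]; rewrite ?strict_bandE; lia.
Qed.

Lemma periodic_bandE (i j : 'I_N) : periodic_band b i j =
  ((i <= j + B) && (j <= i + B) || (i + B >= j + N) || (j + B >= i + N))%N.
Proof.
rewrite /periodic_band /periodic_abs; have := ltn_ord i; have := ltn_ord j.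
move=> iN jN; apply/idP/idP; lia.
Qed.

Lemma periodic_bandC : symmetric (periodic_band b (N := N)).
Proof. by move=> i j; rewrite !periodic_bandE; apply/idP/idP; lia. Qed.

Lemma periodic_degree (i : 'I_N) : #|periodic_band b i| = band_scale b N.
Proof.
rewrite /band_scale; have [h|h] := leqP N (2 * B + 1).
  rewrite -[RHS]card_ord; apply: fintype.eq_card => j.
  rewrite [RHS]inE; apply: etrans (periodic_bandE i j) _;  have := ltn_ord i; have := ltn_ord j; lia.
(* The neighbours of [i] in cyclic order, starting with [i - B]. *)
pose y (t : nat) := (if i + t < B then i + t + N - B else if i + t < B + N then i + t - B else i + t - B - N)%N.
have yN (t : 'I_(2 * B + 1)) : (y t < N)%N.
  by rewrite /y; have := ltn_ord i; have := ltn_ord t; case: ifP; [|case: ifP]; lia.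
pose f (t : 'I_(2 * B + 1)) := Ordinal (yN t).
have fi : injective f.
  move=> t t' /(congr1 val) /=; rewrite /y => e; apply: val_inj => /=.
  have := ltn_ord i; have := ltn_ord t; have := ltn_ord t'; move: e.
  by do 2 (case: ifP; [|case: ifP]); lia.
rewrite -[RHS]card_ord -(card_codom fi); apply: fintype.eq_card => j.
apply: etrans (periodic_bandE i j) _; have := ltn_ord i; have := ltn_ord j => jN iN.
apply/idP/codomP => [h1|[t ->]]; last first.
  rewrite /= /y; have := ltn_ord t.
  by case: ifP; [|case: ifP]; lia.
pose t := (if i + B >= j + N then j + N + B - i else if j + B >= i + N then j + B - i - N else j + B - i)%N.
have tl : (t < 2 * B + 1)%N by rewrite /t; case: ifP; [|case: ifP]; lia.
exists (Ordinal tl); apply: val_inj; rewrite /= /y /t.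
by case: (leqP (j + N) (i + B)) => h2; [|case: (leqP (i + N) (j + B)) => h3];
  (case: ifP; [|case: ifP]); lia.
Qed.

Lemma periodic_flat (i i' : 'I_N) : (i' <= i)%N ->
  (#|[pred j | periodic_band b i j != periodic_band b i' j]| <= 4 * (i - i'))%N.
Proof.
apply: flat_of_unit_shift i i' => i i' ii.
apply: (@leq_trans (size [:: (i - B.+1)%N; (i + B)%N; (i + B - N)%N; (i + N - B.+1)%N])) => //.
apply: card_le_seq => j; have := ltn_ord i; have := ltn_ord j.
rewrite !inE !periodic_bandE => h; lia.
Qed.

End band_geometry.

Section regular_bands.
Context (R : realType) (b : nat -> nat).
Hypothesis b_lt : forall N, (0 < N)%N -> (b N <= N.-1)%N.
Hypothesis b_oo : b N @[N --> \oo] --> \oo.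

Let b_le q : (b q.+1 <= q)%N. Proof. exact: b_lt. Qed.

(** Contour walks of length [k] that start in [G] stay in the sets [H r], where almost
all choices allowed by the maximal degree are available. *)
Definition nearly_regular (band : forall N, rel 'I_N) := forall k (eta : R), 0 < eta ->
  \forall q \near \oo, exists (G : pred 'I_q.+1) (H : 'I_q.+1 -> nat -> pred 'I_q.+1),
   [/\ (forall r, r \in G -> H r 0%N r),
       (forall r h x y, H r h x -> band q.+1 x y -> H r h.+1 y),
       (forall r h x, r \in G -> H r h x -> (h <= k)%N ->
          (1 - eta) * (band_scale b q.+1)%:R <= #|band q.+1 x|%:R) &
       (1 - eta) * q.+1%:R <= #|G|%:R].

Lemma periodic_regular : nearly_regular (@periodic_band b).
Proof.
move=> k eta eta0; apply: nearW => q; exists predT, (fun _ _ => predT); split=> //.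
  by move=> r h x _ _ _; rewrite periodic_degree // ler_piMl // gerBl ltW.
by rewrite card_ord ler_piMl // gerBl ltW.
Qed.

(** [G] consists of the points farther than [k.+1 * b] from both ends, which are most
points. *)
Lemma strict_regular_narrow : (b N)%:R / N%:R @[N --> \oo] --> (0 : R) ->
  nearly_regular (@strict_band b).
Proof.
move=> b0 k eta eta0.
pose c : R := eta / (2 * k.+1%:R).
have c0 : 0 < c by rewrite divr_gt0 // mulr_gt0.
have : \forall N \near \oo, (b N)%:R / N%:R <= c.
  move/cvgrPdist_le: b0 => /(_ c c0); apply: filterS => N.
  by rewrite sub0r normrN ger0_norm // divr_ge0.
move=> /near_succ ; apply: filterS => q hc.
pose B := b q.+1.
pose G := [pred r : 'I_q.+1 | (k.+1 * B <= r)%N && (r + k.+1 * B < q.+1)%N].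
exists G, (fun (r : 'I_q.+1) h => [pred x : 'I_q.+1 | (x <= r + h * B)%N && (r <= x + h * B)%N]); split.
- by move=> r _; rewrite /= mul0n !addn0 leqnn.
- move=> r h x y /andP[h1 h2]; rewrite strict_bandE -/B => /andP[h3 h4].
  by apply/andP; rewrite mulSn; lia.
- move=> r h x /=; rewrite inE /= => rG xr hk.
  have hB : (h * B <= k * B)%N by rewrite leq_mul2r hk orbT.
  apply: (@le_trans _ _ (band_scale b q.+1)%:R); first by rewrite ler_piMl // gerBl ltW.
  rewrite ler_nat; apply: leq_trans (geq_minr _ _) _.
  by apply: strict_degree_interior; move: rG; rewrite mulSn -/B; lia.
- have : (q.+1 - 2 * (k.+1 * B) <= #|G|)%N.
    have [h|h] := leqP q.+1 (2 * (k.+1 * B)); first by rewrite (eqP h).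
    apply: (card_ge_window (lo := (k.+1 * B)%N)); first lia.
    by move=> j /=; lia.
  rewrite -(ler_nat R); apply: le_trans.
  have h : 2 * k.+1%:R * B%:R <= eta * q.+1%:R :> R.
    move: hc; rewrite ler_pdivrMr ?ltr0n // /c mulrAC ler_pdivlMr ?mulr_gt0 //; rewrite -/B; lra.
  have : q.+1%:R - (2 * (k.+1 * B))%:R <= (q.+1 - 2 * (k.+1 * B))%N%:R :> R.
    by rewrite lerBlDr -natrD ler_nat; lia.
  apply: le_trans; rewrite mulrBl mul1r lerD2l lerN2 natrM natrM; lra.
Qed.

(** Every point has at least [b] neighbours, and [b] is close to the number of points. *)
Lemma strict_regular_wide : (b N)%:R / N%:R @[N --> \oo] --> (1 : R) ->
  nearly_regular (@strict_band b).
Proof.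
move=> b1 k eta eta0.
have : \forall N \near \oo, 1 - eta <= (b N)%:R / N%:R.
  move/cvgrPdist_le: b1 => /(_ eta eta0); apply: filterS => N.
  by rewrite ler_norml => /andP[_]; lra.
move=> /near_succ; apply: filterS => q; rewrite ler_pdivlMr ?ltr0n // => h.
exists predT, (fun _ _ => predT); split=> //; last first.
  by rewrite card_ord ler_piMl // gerBl ltW.
move=> r l x _ _ _; apply: (@le_trans _ _ (b q.+1)%:R); last first.
  by rewrite ler_nat; exact: strict_degree_ge.
have [e1|e1] := leP eta 1; last first.
  by rewrite (@le_trans _ _ 0) // mulr_le0_ge0 // subr_le0 ltW.
apply: le_trans h; apply: ler_wpM2l; first by rewrite subr_ge0.
by rewrite ler_nat geq_minl.
Qed.

End regular_bands.

(** * Band ensembles along subsequences *)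
Lemma bernoulli_le (R : realFieldType) (x : R) k : 0 <= x <= 1 -> 1 - k%:R * x <= (1 - x) ^+ k.
Proof.
move=> /andP[x0 x1]; elim: k => [|k IH]; first by rewrite expr0; lra.
rewrite exprS; apply: le_trans (ler_wpM2l _ IH); last by rewrite subr_ge0.
have : 0 <= k%:R * x ^+ 2 by rewrite mulr_ge0 ?sqr_ge0.
rewrite -natr1; lra.
Qed.

Lemma band_scale_gt0 (N B : nat) : (0 < minn N (2 * B + 1))%N = (0 < N)%N.
Proof. by rewrite leq_min addn1 andbT. Qed.

Section subsequences.
Context (R : realType) (b : nat -> nat).
Hypothesis b_lt : forall N, (0 < N)%N -> (b N <= N.-1)%N.
Hypothesis b_oo : b N @[N --> \oo] --> \oo.

Lemma band_scale_large A : \forall N \near \oo, (A <= band_scale b N)%N.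
Proof.
move/cvgnyPge: b_oo => /(_ A) [M _ hM]; exists (maxn A M) => // N /=.
rewrite geq_max => /andP[AN MN]; rewrite leq_min AN /=.
by have := hM N MN; rewrite /=; lia.
Qed.

Context (q_ : nat -> nat).
Hypothesis q_oo : q_ j @[j --> \oo] --> \oo.
Local Notation w_ j := (band_scale b (q_ j).+1).

Lemma near_along (Q : nat -> Prop) : (\forall q \near \oo, Q q) -> \forall j \near \oo, Q (q_ j).
Proof. by move=> h; exact: q_oo h. Qed.

Lemma band_scale_oo : w_ j @[j --> \oo] --> \oo.
Proof.
apply/cvgnyPge => A; apply: (near_along (Q := fun q => (A <= band_scale b q.+1)%N)).
exact: (near_succ (band_scale_large A)).
Qed.

(** The number of contour walks is squeezed between the bounds with [s] and with
[t = (1 - eta) * s], on all points and on a fraction [1 - eta] of them. *)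
Lemma tree_walk_total_cvg (band : forall N, rel 'I_N) :
  (forall q, symmetric (band q.+1)) ->
  (forall q i, (#|band q.+1 i| <= band_scale b q.+1)%N) ->
  nearly_regular R b band -> forall k,
  tree_walk_total (band (q_ j).+1) R k / ((q_ j).+1%:R * Num.sqrt (w_ j)%:R ^+ k) @[j --> \oo]
    --> ((ballot k 0)%:R : R).
Proof.
move=> bandC deg reg k; set K : R := (ballot k 0)%:R.
have K0 : 0 <= K by rewrite ler0n.
apply/cvgrPdist_le => e e0.
(* This gives [K * (k.+1 * eta) <= e], for Bernoulli's inequality, and [eta <= 1 / 2]. *)
pose eta := e / (2 * (K + 1) * k.+1%:R * (e + 1)).
have den : 0 < 2 * (K + 1) * k.+1%:R * (e + 1).
  by apply: mulr_gt0; [apply: mulr_gt0 => //; apply: mulr_gt0 => //|]; lra.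
have eta0 : 0 < eta by rewrite divr_gt0.
have k1 : 1 <= k.+1%:R :> R by rewrite ler1n.
have etaP : eta * (2 * (K + 1) * k.+1%:R * (e + 1)) = e by rewrite divfK // gt_eqF.
have p1 : 0 <= K * k.+1%:R by rewrite mulr_ge0.
have eta1 : eta <= 1 / 2.
  have : eta * (2 * (e + 1)) <= e.
    rewrite -[leRHS]etaP ler_pM2l // ler_pM2r; last lra.
    by nra.
  by nra.
have etae : K * (k.+1%:R * eta) <= e.
  have h : eta * ((K * k.+1%:R) * 1) <= e.
    rewrite -[leRHS]etaP ler_pM2l // ler_pM //; last lra.
    by nra.
  lra.
have eta20 : 0 < eta / 2 by rewrite divr_gt0.
near=> j.
have [G [H [H0 HS Hd HG]]] : exists (G : pred 'I_(q_ j).+1) (H : 'I_(q_ j).+1 -> nat -> pred 'I_(q_ j).+1),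
   [/\ (forall r, r \in G -> H r 0%N r),
       (forall r h x y, H r h x -> band (q_ j).+1 x y -> H r h.+1 y),
       (forall r h x, r \in G -> H r h x -> (h <= k)%N ->
          (1 - eta / 2) * (w_ j)%:R <= #|band (q_ j).+1 x|%:R) &
       (1 - eta / 2) * (q_ j).+1%:R <= #|G|%:R].
  by near: j; exact: near_along (reg k _ eta20).
have wk : 2 * k%:R / eta + 1 <= (w_ j)%:R.
  near: j; have [M hM] : exists M : nat, 2 * k%:R / eta + 1 <= M%:R.
    exists (Num.bound (2 * k%:R / eta + 1)); apply/ltW/archi_boundP.
    by apply: addr_ge0 => //; apply: divr_ge0; [exact: mulr_ge0|exact: ltW].
  move/cvgnyPge: band_scale_oo => /(_ M); apply: filterS => j Mw.
  by apply: le_trans hM _; rewrite ler_nat.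
set N := (q_ j).+1%:R; have N0 : 0 < N :> R by rewrite ltr0n.
have w1 : 1 <= (w_ j)%:R :> R.
  have : 0 <= 2 * k%:R / eta by apply: divr_ge0; [exact: mulr_ge0|exact: ltW].
  by move: wk; lra.
have w0 : 0 < (w_ j)%:R :> R by lra.
set s := Num.sqrt _; have s0 : 0 < s by rewrite sqrtr_gt0.
have s2 : s ^+ 2 = (w_ j)%:R by rewrite sqr_sqrtr // ltW.
have Ns : 0 < N * s ^+ k by rewrite mulr_gt0 // exprn_gt0.
rewrite distrC ler_distl; apply/andP; split; last first.
  rewrite ler_pdivrMr //.
  have := @tree_walk_total_ub _ (band (q_ j).+1) R (w_ j)%:R w1 _ k; rewrite -/K -/s card_ord -/N.
  move=> /(_ _)/wrap[]; first by move=> y; rewrite ler_nat.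
  move=> h; apply: le_trans h _; rewrite mulrDl.
  have : 0 <= e * (N * s ^+ k) by rewrite mulr_ge0 // ltW.
  by rewrite mulrAC -mulrA; lra.
pose t := (1 - eta) * s.
have t0 : 0 < t by rewrite mulr_gt0 //; lra.
have := @tree_walk_total_lb _ (band (q_ j).+1) (bandC _) R k t G H t0 H0 HS.
move=> /(_ _)/wrap[].
  move=> r h x rG xr hk; apply: le_trans (Hd r h x rG xr hk).
  rewrite exprMn s2.
  have h2 : (1 - eta) ^+ 2 <= 1 - eta.
    by rewrite expr2; nra.
  have h3 : (1 - eta) ^+ 2 * (w_ j)%:R <= (1 - eta) * (w_ j)%:R by rewrite ler_wpM2r // ltW.
  have h4 : k%:R <= eta / 2 * (w_ j)%:R.
    have : 2 * k%:R / eta <= (w_ j)%:R by lra.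
    by rewrite ler_pdivrMr //; lra.
  lra.
move=> lb; rewrite ler_pdivlMr //; apply: le_trans lb.
have tk : t ^+ k = (1 - eta) ^+ k * s ^+ k by rewrite exprMn.
have G1 : (1 - eta) * N <= #|G|%:R.
  apply: le_trans HG; rewrite -/N ler_wpM2r ?(ltW N0) //; lra.
apply: (@le_trans _ _ (K * t ^+ k * ((1 - eta) * N))); last first.
  by rewrite ler_wpM2l // mulr_ge0 // exprn_ge0 // ltW.
have -> : K * t ^+ k * ((1 - eta) * N) = K * (1 - eta) ^+ k.+1 * (N * s ^+ k).
  by rewrite tk exprS; ring.
rewrite ler_wpM2r ?(ltW Ns) //.
have := @bernoulli_le R eta k.+1; move=> /(_ _)/wrap[]; first by apply/andP; split; lra.
move=> /(ler_wpM2l K0); lra.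
Unshelve. all: by end_near. Qed.

Context d (T : measurableType d) (P : probability T R).
Context (xi : nat -> {RV P >-> R}) (V : {RV P >-> R}).
Hypothesis xi_exch : exchangeable xi.
Hypothesis xi_mom : finite_moments xi.
Hypothesis V_lim : limiting_empirical_variance xi V.

(** The enumeration of the upper band is extended to an injection on all pairs by
using the numbers from [L] on for the other pairs. *)
Lemma band_ensembleE (band : forall N, rel 'I_N) (F : forall N, T -> 'M[R]_N) :
  band_ensemble xi band F -> (forall q, symmetric (band q.+1)) -> forall q,
  exists2 iota : 'I_q.+1 * 'I_q.+1 -> nat, injective iota &
    forall w, F q.+1 w = \matrix_(x, y) ((band q.+1 x y)%:R * xi (iota (edge x y)) w).
Proof.
move=> Fb bandC q; have [e [eL einj _] eF] := Fb q.+1.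
set L := #|_| in eL.
pose up p := p \in upper_band band (N := q.+1).
have eL' p : up p -> (e p < L)%N by move=> pu; exact: eL.
have einj' p p' : up p -> up p' -> e p = e p' -> p = p'.
  by move=> pu pu' /einj; apply; rewrite inE.
pose iota p : nat := if up p then e p else (L + enum_rank p)%N.
exists iota => [p p'|w].
  rewrite /iota; case: ifP => u; case: ifP => u'.
  - exact: einj'.
  - by move=> h; have := eL' p u; rewrite h ltnNge leq_addr.
  - by move=> h; have := eL' p' u'; rewrite -h ltnNge leq_addr.
  - by move/addnI => /val_inj /enum_rank_inj.
apply/matrixP => x y; rewrite mxE; have [h1 h2 h3] := eF w x y.
case: (boolP (band q.+1 x y)) => xy; last by rewrite mul0r h1.
rewrite mul1r /edge; case: (leqP x y) => [le_xy|/ltnW le_yx].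
  have u : up (x, y) by rewrite /up inE /= le_xy xy.
  by rewrite /iota u h2.
have u : up (y, x) by rewrite /up inE /= le_yx bandC xy.
have [_ h2' _] := eF w y x.
by rewrite /iota u -h2' // h3.
Qed.

Theorem subsequence_cvg (band : forall N, rel 'I_N) (F : forall N, T -> 'M[R]_N) :
  (forall q, symmetric (band q.+1)) ->
  (forall q i, (#|band q.+1 i| <= band_scale b q.+1)%N) ->
  (forall q (i i' : 'I_q.+1), (i' <= i)%N ->
     (#|[pred j | band q.+1 i j != band q.+1 i' j]| <= 4 * (i - i'))%N) ->
  nearly_regular R b band -> band_ensemble xi band F ->
  (exists B : R, forall n, \sum_(j < n) ((q_ j).+1%:R * (w_ j)%:R)^-1 <= B) ->
  {ae P, forall w, weak_cvg
     (fun j => eigenvalue_measure ((Num.sqrt (w_ j)%:R)^-1 *: F (q_ j).+1 w))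
     (semicircle_measure (V w))}.
Proof.
move=> bandC deg flat reg Fb sB.
have hF j : {iota : 'I_(q_ j).+1 * 'I_(q_ j).+1 -> nat | injective iota /\
    forall w, F (q_ j).+1 w = \matrix_(x, y) ((band (q_ j).+1 x y)%:R * xi (iota (edge x y)) w)}.
  by apply: cid; have [iota h1 h2] := band_ensembleE Fb bandC (q_ j); exists iota.
pose iota j := sval (hF j).
have FE j w : F (q_ j).+1 w = band_mx xi (fun j => band (q_ j).+1) iota j w.
  by have [_ ->] := svalP (hF j).
have w0 j : (0 < w_ j)%N by rewrite band_scale_gt0.
have wq j : (w_ j <= (q_ j).+1)%N by rewrite geq_minl.
have ii j : injective (iota j) by case: (svalP (hF j)).
have := @band_weak_cvg d T R P xi V xi_exch xi_mom V_lim q_ (fun j => band (q_ j).+1)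
  (fun j => w_ j) iota (fun j => bandC _) w0 wq (fun j => deg _) (fun j => flat _)
  band_scale_oo sB (tree_walk_total_cvg bandC deg reg) ii.
have E w : (fun j => eigenvalue_measure ((Num.sqrt (w_ j)%:R)^-1 *: F (q_ j).+1 w)) =
  (fun j => eigenvalue_measure ((Num.sqrt (w_ j)%:R)^-1 *: band_mx xi (fun j => band (q_ j).+1) iota j w)).
  by apply: funext => j; rewrite FE.
apply: filterS => w h.
exact: (eq_ind_r (fun mu_ => weak_cvg mu_ (semicircle_measure (V w))) h (E w)).
Qed.

End subsequences.

(** * Measurability and convergence in probability *)
Section measurability.
Context d (T : measurableType d) (R : realType).

Lemma polynomial_approximation (f : R -> R) M : continuous f -> bounded_by f M ->
  exists p_ : nat -> {poly R}, forall l x, `|x| <= l.+1%:R -> `|f x - (p_ l).[x]| <= l.+1%:R^-1.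
Proof.
move=> cf fM.
have h l : {p : {poly R} | forall x, `|x| <= l.+1%:R -> `|f x - p.[x]| <= l.+1%:R^-1}.
  by apply: cid; apply: (weierstrass cf fM); rewrite ?invr_gt0 ltr0n.
by exists (fun l => sval (h l)) => l; exact: svalP (h l).
Qed.

Lemma cvg_of_inv_bound (a : nat -> R) (x : R) (L : nat) :
  (forall l, (L <= l)%N -> `|x - a l| <= l.+1%:R^-1) -> a l @[l --> \oo] --> x.
Proof.
move=> h; apply/cvgrPdist_le => e e0.
near=> l; apply: le_trans (h l _) _; first by near: l; exists L.
rewrite -[e]invrK lef_pV2 ?posrE ?ltr0n ?invr_gt0 //.
apply: (@le_trans _ _ l%:R); last by rewrite ler_nat.
near: l; exists (Num.bound e^-1) => // l /= hl.
by rewrite (le_trans (ltW (archi_boundP _))) ?ler_nat // invr_ge0 ltW.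
Unshelve. all: by end_near. Qed.

Lemma measurable_mx_exp N (A : T -> 'M[R]_N.+1) :
  (forall x y, measurable_fun setT (fun w => A w x y)) ->
  forall k x y, measurable_fun setT (fun w => (A w ^+ k) x y).
Proof.
move=> mA; elim=> [|k IH] x y; first by apply: measurable_cst.
rewrite (_ : (fun w => _) = (fun w => \sum_z A w x z * (A w ^+ k) z y)).
  by apply: measurable_sum => z; apply: measurable_funM.
by apply: funext => w; rewrite exprS mxE.
Qed.

(** The integral of a polynomial is a polynomial in the entries of the matrix.  The
integral of [f] is a limit of such integrals, since the approximation is uniform on
[-l, l], which eventually contains the spectrum. *)
Lemma measurable_eigenvalue_integral N (A : T -> 'M[R]_N.+1) (f : R -> R) M :
  (forall w, (A w)^T = A w) -> (forall x y, measurable_fun setT (fun w => A w x y)) ->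
  continuous f -> bounded_by f M ->
  measurable_fun setT (fun w => \int[eigenvalue_measure (A w)]_x f x).
Proof.
move=> As mA cf fM; have [p_ pP] := polynomial_approximation cf fM.
pose g l w := \sum_(i < size (p_ l)) (p_ l)`_i * (N.+1%:R^-1 * \tr (A w ^+ i)).
have gE l w : g l w = \int[eigenvalue_measure (A w)]_x (p_ l).[x].
  have [_ ->] := Rintegral_horner (p_ l) (has_moments_eigenvalue (A w) isT).
  by apply: eq_bigr => i _; rewrite moment_eigenvalue.
apply: (@measurable_fun_cvg _ _ _ _ g).
  move=> l; apply: measurable_sum => i; apply: measurable_funM => //.
  apply: measurable_funM => //; apply: measurable_sum => x.
  exact: measurable_mx_exp.
move=> w _.
pose K := \sum_(j < N.+1) `|(eigenvalues (A w))`_j|.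
have K0 : 0 <= K by apply: sumr_ge0.
apply: (@cvg_of_inv_bound _ _ (Num.bound K)) => l Kl.
rewrite gE !Rintegral_eigenvalue; last 2 first.
- by apply: continuous_measurable_fun; exact: continuous_horner.
- exact: continuous_measurable_fun.
rewrite -mulrBr -sumrB normrM ger0_norm ?invr_ge0 // ler_pdivrMl ?ltr0n //.
apply: le_trans (ler_norm_sum _ _ _) _.
rewrite -[X in X%:R * _]card_ord mulr_natl -sumr_const ler_sum // => j _; apply: pP.
apply: (@le_trans _ _ K); first by rewrite /K (bigD1 j) //= lerDl sumr_ge0.
by rewrite (le_trans (ltW (archi_boundP K0))) // ler_nat (leq_trans Kl).
Qed.

Lemma semicircle_close (v : R) (f g : R -> R) e : 0 < v -> continuous f -> continuous g ->
  (semicircle_measure v).-integrable setT (EFin \o f) ->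
  (semicircle_measure v).-integrable setT (EFin \o g) ->
  (forall x, `|x| <= 2 * Num.sqrt v -> `|f x - g x| <= e) ->
  `|\int[semicircle_measure v]_x f x - \int[semicircle_measure v]_x g x| <= e.
Proof.
move=> v0 cf cg jf jg fg.
have ifg : (semicircle_measure v).-integrable setT (EFin \o (fun x => f x - g x)).
  have := integrableB measurableT jf jg; apply: eq_integrable => // x _.
have cfg : continuous (fun x => `|f x - g x|).
  by move=> x; apply: cvg_norm; apply: cvgB; [exact: cf|exact: cg].
rewrite -RintegralB //; apply: le_trans (le_normr_Rintegral measurableT ifg) _.
have [[m1 _] _] := semicircle_moments (ltW v0).
have e0 : 0 <= e.
  by apply: le_trans (fg 0 _); rewrite ?normr0 // mulr_ge0 ?sqrtr_ge0.
rewrite -[leRHS]/(fine e%:E) /Rintegral; apply: fine_le => //.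
  by apply: integrable_fin_num => //; exact: (integrable_norm ifg).
have <- : (\int[semicircle_measure v]_x (cst e x)%:E = e%:E)%E.
  transitivity (\int[semicircle_measure v]_x e%:E)%E; first by [].
  by rewrite integral_cst //; rewrite [X in (_ * X)%E](m1 : _ = 1%E) mule1.
rewrite !semicircle_integral //; last exact: cst_continuous.
have mp : measurable_fun setT (semicircle_pdf v) by exact: measurable_semicircle_pdf.
apply: ge0_le_integral => //.
- by move=> x _; rewrite lee_fin mulr_ge0 // semicircle_pdf_ge0.
- apply/measurable_EFinP; apply: measurable_funTS; apply: measurable_funM => //.
  exact: continuous_measurable_fun.
- by apply/measurable_EFinP; apply: measurable_funTS; apply: measurable_funM.
move=> x; rewrite /= in_itv /= => /andP[x1 x2]; rewrite lee_fin ler_wpM2r ?semicircle_pdf_ge0 //.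
by apply: fg; rewrite ler_norml x1.
Qed.

(** As in [measurable_eigenvalue_integral]: the support of the semicircle law is
compact and its moments are polynomials in the positive part of the variance. *)
Lemma measurable_semicircle_integral (V : T -> R) (f : R -> R) M : measurable_fun setT V ->
  continuous f -> bounded_by f M ->
  measurable_fun setT (fun w => \int[semicircle_measure (V w)]_x f x).
Proof.
move=> mV cf fM; have [p_ pP] := polynomial_approximation cf fM.
pose g l w := \sum_(i < size (p_ l)) (p_ l)`_i * ((ballot i 0)%:R * (Num.max (V w) 0) ^+ i./2).
apply: (@measurable_fun_cvg _ _ _ _ g).
  move=> l; apply: measurable_sum => i; apply: measurable_funM => //.
  apply: measurable_funM => //; apply: measurable_funX.
  exact: measurable_maxr.
move=> w _; have [v0|v0] := ltP 0 (V w).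
  have mx : Num.max (V w) 0 = V w by apply/max_idPl/ltW.
  have [hm mE] := semicircle_moments (ltW v0).
  apply: (@cvg_of_inv_bound _ _ (Num.bound (2 * Num.sqrt (V w)))) => l Kl.
  have [ip pE] := Rintegral_horner (p_ l) hm.
  have -> : g l w = \int[semicircle_measure (V w)]_x (p_ l).[x].
    by rewrite pE; apply: eq_bigr => i _; rewrite mE mx.
  apply: semicircle_close => //.
  - exact: continuous_horner.
  - by case: hm => m1 _; exact: integrable_bounded fM.
  move=> x hx; apply: pP; apply: (le_trans hx).
  have K0 : 0 <= 2 * Num.sqrt (V w) by rewrite mulr_ge0 ?sqrtr_ge0.
  by rewrite (le_trans (ltW (archi_boundP K0))) // ler_nat (leq_trans Kl).
have mx : Num.max (V w) 0 = 0 by apply/max_idPr.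
have s0 A : semicircle_measure (V w) A = semicircle_measure 0 A.
  by rewrite /semicircle_measure /= /semicircle ltNge v0 /= ltxx.
have -> : \int[semicircle_measure (V w)]_x f x = f 0.
  rewrite /Rintegral (eq_measure_integral (\d_(0 : measurableTypeR R))).
    rewrite integral_dirac //.
      by rewrite diracT mul1e.
    by apply/measurable_EFinP; exact: continuous_measurable_fun.
  by move=> A mA _; rewrite /= /semicircle_measure /= /semicircle ltNge v0.
apply: (@cvg_of_inv_bound _ _ 0) => l _.
have -> : g l w = (p_ l).[0].
  rewrite /g mx horner_coef; apply: eq_bigr => -[[|[|i]] hi] _ //=.
  - by rewrite mul1r.
  - by rewrite addn0 mul0r expr1.
  - by rewrite !expr0n /= mulr0.
by apply: pP; rewrite normr0.
Qed.

End measurability.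

Section in_probability.
Context d (T : measurableType d) (R : realType) (P : probability T R).

Lemma measurable_deviation (X Y : T -> R) (eps : R) : measurable_fun setT X -> measurable_fun setT Y ->
  measurable [set w | eps < `|X w - Y w|].
Proof.
move=> mX mY.
have mZ : measurable_fun setT (fun w => `|X w - Y w|).
  by apply: measurableT_comp => //; exact: measurable_funB.
have := mZ measurableT `]eps, +oo[%classic (measurable_itv _).
rewrite setTI; congr measurable; apply/seteqP; split => w /=; by rewrite in_itv /= andbT.
Qed.

(** If the probabilities did not tend to 0, one could choose indices along which they
stay above some [e].  By Egorov's theorem the convergence along these indices is
uniform outside a set of probability less than [e], a contradiction. *)
Lemma in_probability_of_subsequences (X : nat -> T -> R) (Y : T -> R) (good : nat -> nat -> Prop) (eps : R) :
  (forall N, measurable_fun setT (X N)) -> measurable_fun setT Y -> 0 < eps ->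
  (forall j, \forall N \near \oo, good j N) ->
  (forall q_ : nat -> nat, (forall j, good j (q_ j).+1) -> {ae P, forall w, X (q_ j).+1 w @[j --> \oo] --> Y w}) ->
  P [set w | eps < `|X N w - Y w|] @[N --> \oo] --> 0%E.
Proof.
move=> mX mY eps0 gN sub.
set p := fun N => P [set w | eps < `|X N w - Y w|].
have mdev N : measurable [set w | eps < `|X N w - Y w|] by exact: measurable_deviation.
suff h (e : R) : 0 < e -> \forall N \near \oo, (p N < e%:E)%E.
  have p0 N : (0 <= p N)%E by exact: measure_ge0.
  have pf N : p N \is a fin_num by exact: fin_num_measure.
  apply/fine_cvgP; split; first by apply: nearW.
  apply/cvgrPdist_lt => e e0; apply: filterS (h e e0) => N pN.
  rewrite sub0r normrN ger0_norm ?fine_ge0 //.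
  by rewrite -lte_fin fineK.
move=> e0; apply: contrapT => nh.
have ex j : exists q, good j q.+1 /\ (e%:E <= p q.+1)%E.
  apply: contrapT => hj; apply: nh.
  have [L _ hL] := gN j; exists L.+1 => // -[//|N] /= LN.
  rewrite ltNge; apply/negP => pN; apply: hj; exists N; split=> //.
  by apply: hL; rewrite /= ltnW.
pose q_ j := sval (cid (ex j)).
have qg j : good j (q_ j).+1 by have [] := svalP (cid (ex j)).
have qp j : (e%:E <= p (q_ j).+1)%E by have [] := svalP (cid (ex j)).
have fin : (P setT < +oo)%E by rewrite probability_setT ltry.
have [] := @ae_pointwise_almost_uniform _ R T P (fun j => X (q_ j).+1) Y setT e _ mY measurableT fin _ e0.
- by move=> n; exact: mX.
- by apply: filterS (sub q_ qg) => w h _.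
move=> B [mB PB unif].
have : \forall j \near \oo, forall w, (setT `\` B) w -> `|X (q_ j).+1 w - Y w| < eps.
  apply: (unif [set h | forall w, (setT `\` B) w -> `|h w - Y w| < eps]); apply/uniform_nbhs.
  exists [set xy | ball xy.1 eps xy.2]; split; first exact: entourage_ball (PosNum eps0).
  by move=> h /= hE w Bw; rewrite distrC; exact: hE.
case=> L _ hL; have := hL L (leqnn _) => /= hw.
have : (p (q_ L).+1 <= P B)%E.
  apply: le_measure; rewrite ?inE // => w /= wd; apply: contrapT => nB.
  by have := hw w (conj I nB); rewrite ltNge (ltW wd).
by move=> /(le_trans (qp L)); rewrite leNgt PB.
Qed.

End in_probability.

(** * The limit theorems *)
Section band_limits.
Context d (T : measurableType d) (R : realType) (P : probability T R) (b : nat -> nat).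
Hypothesis b_lt : forall N, (0 < N)%N -> (b N <= N.-1)%N.
Hypothesis b_oo : b N @[N --> \oo] --> \oo.
Context (xi : nat -> {RV P >-> R}) (V : {RV P >-> R}).
Hypothesis xi_exch : exchangeable xi.
Hypothesis xi_mom : finite_moments xi.
Hypothesis V_lim : limiting_empirical_variance xi V.
Context (band : forall N, rel 'I_N) (F : forall N, T -> 'M[R]_N).
Arguments band : clear implicits.
Hypothesis bandC : forall q, symmetric (band q.+1).
Hypothesis deg : forall q i, (#|band q.+1 i| <= band_scale b q.+1)%N.
Hypothesis flat : forall q (i i' : 'I_q.+1), (i' <= i)%N ->
  (#|[pred j | band q.+1 i j != band q.+1 i' j]| <= 4 * (i - i'))%N.
Hypothesis reg : nearly_regular R b band.
Hypothesis Fb : band_ensemble xi band F.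

Let mu_ N w := eigenvalue_measure ((Num.sqrt (band_scale b N)%:R)^-1 *: F N w).

Lemma measurable_spectral_integral f M N : continuous f -> bounded_by f M ->
  measurable_fun setT (fun w => \int[mu_ N w]_x f x).
Proof.
move=> cf fM; case: N => [|q].
  have E w : (Num.sqrt (band_scale b 0)%:R)^-1 *: F 0%N w = 0 by exact: flatmx0.
  have H := funext (fun w => congr1 (fun B => \int[eigenvalue_measure B]_x f x) (E w)).
  apply: (eq_ind_r (fun g => measurable_fun setT g) _ H); exact: measurable_cst.
have [iota _ FE] := band_ensembleE Fb bandC q.
apply: (measurable_eigenvalue_integral _ _ cf fM) => [w|x y].
  by apply/matrixP => x y; rewrite FE !mxE bandC edgeC.
rewrite (_ : (fun w => _) = (fun w => (Num.sqrt (band_scale b q.+1)%:R)^-1 *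
   ((band q.+1 x y)%:R * xi (iota (edge x y)) w))).
  by apply: measurable_funM => //; apply: measurable_funM.
by apply: funext => w; rewrite FE !mxE.
Qed.

Lemma bounded_funE (f : R -> R) : bounded_fun f -> exists M, bounded_by f M.
Proof. by case=> M [_ HM]; exists (M + 1) => x; apply: HM => //; rewrite ltrDl. Qed.

(** Indices at which the width is at least [2 ^ j] make the sum of the inverses of size
times width converge. *)
Theorem in_probability_limit :
  weak_cvg_in_probability P mu_ (fun w => semicircle_measure (V w)).
Proof.
move=> f cf /bounded_funE[M fM] eps eps0.
(* The bound [j < N] makes the chosen indices tend to infinity. *)
pose good j N := (2 ^ j <= band_scale b N)%N && (j < N)%N.
apply: (@in_probability_of_subsequences _ _ _ P (fun N w => \int[mu_ N w]_x f x) _ good) => //.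
- by move=> N; exact: measurable_spectral_integral cf fM.
- by apply: measurable_semicircle_integral cf fM; exact: measurable_funP.
- move=> j; near=> N; apply/andP; split.
    by near: N; exact: band_scale_large.
  by near: N; exists j.+1.
move=> q_ hq.
have q_oo : q_ j @[j --> \oo] --> \oo.
  apply/cvgnyPge => A; exists A => // j /= Aj; apply: leq_trans Aj _.
  by have /andP[_] := hq j.
have sB : exists B : R, forall n, \sum_(j < n) ((q_ j).+1%:R * (band_scale b (q_ j).+1)%:R)^-1 <= B.
  exists 2 => n; apply: le_trans (sum_half R n); apply: ler_sum => j _.
  have /andP[h _] := hq j.
  have p2 : 0 < 2 ^+ j :> R by rewrite exprn_gt0.
  have h' : 2 ^+ j <= (band_scale b (q_ j).+1)%:R :> R by rewrite -natrX ler_nat.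
  have pw : 0 < (q_ j).+1%:R * (band_scale b (q_ j).+1)%:R :> R.
    by apply: mulr_gt0; [rewrite ltr0n|exact: lt_le_trans h'].
  rewrite lef_pV2 ?posrE //.
  by rewrite (le_trans h') // ler_peMl // ler1n.
have := subsequence_cvg b_oo q_oo xi_exch xi_mom V_lim bandC deg flat reg Fb sB.
apply: filterS => w; apply => //.
by exists M; split; [exact: num_real|move=> M' MM' x _; exact: le_trans (fM x) (ltW MM')].
Unshelve. all: by end_near. Qed.

Theorem almost_sure_limit :
  (\sum_(1 <= N <oo | (1 <= b N)%N) (((N * b N)%:R : R)^-1)%:E < +oo)%E ->
  weak_cvg_almost_surely P mu_ (fun w => semicircle_measure (V w)).
Proof.
move=> sum_fin.
have [n0 _ hn0] : \forall N \near \oo, (1 <= b N)%N by move/cvgnyPge: b_oo; apply.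
pose q_ j := (j + n0)%N.
have q_oo : q_ j @[j --> \oo] --> \oo.
  by apply/cvgnyPge => A; exists A => // j /= Aj; rewrite (leq_trans Aj) // leq_addr.
have g0 N : (1 <= N)%N -> (1 <= b N)%N -> (0 <= (((N * b N)%:R : R)^-1)%:E)%E.
  by move=> _ _; rewrite lee_fin invr_ge0.
have sB : exists B : R, forall n, \sum_(j < n) ((q_ j).+1%:R * (band_scale b (q_ j).+1)%:R)^-1 <= B.
  exists (fine (\sum_(1 <= N <oo | (1 <= b N)%N) (((N * b N)%:R : R)^-1)%:E)) => n.
  have pos : (0 <= \sum_(1 <= N <oo | (1 <= b N)%N) (((N * b N)%:R : R)^-1)%:E)%E.
    exact: nneseries_ge0.
  rewrite -lee_fin fineK; last by rewrite ge0_fin_numE.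
  apply: le_trans (nneseries_lim_ge (n + n0.+1) g0).
  rewrite (big_cat_nat_idem _ _ _ (n := n0.+1)) //=; last 2 first.
  - by rewrite adde0.
  - by rewrite leq_addl.
  rewrite -sumEFin -[leLHS]add0e; apply: leeD.
    by rewrite big_nat_cond; apply: sume_ge0 => N _; rewrite lee_fin invr_ge0.
  rewrite -{1}[n0.+1]add0n big_addn addnK big_mkord [leRHS]big_mkcond.
  apply: lee_sum => j _.
  have h : (1 <= b (j + n0.+1))%N by apply: hn0; rewrite /= addnS ltnW // ltnS leq_addl.
  rewrite h /q_ -addnS lee_fin -natrM lef_pV2 ?posrE ?ltr0n ?ler_nat.
  - rewrite leq_mul2l leq_min; apply/orP; right.
    have := b_lt (_ : (0 < j + n0.+1)%N); rewrite addnS => /(_ isT) /= b1.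
    by rewrite (leq_trans b1) //=; lia.
  - by rewrite muln_gt0 addnS /= band_scale_gt0.
  - by rewrite muln_gt0 h andbT addnS.
have [A [mA PA hA]] := subsequence_cvg b_oo q_oo xi_exch xi_mom V_lim bandC deg flat reg Fb sB.
exists (~` A); split; first exact: measurableC.
  by rewrite probability_setC // PA sube0.
move=> w Aw f cf bf.
have h : weak_cvg (fun j => mu_ (q_ j).+1 w) (semicircle_measure (V w)).
  by apply: contrapT => nh; apply: Aw; exact: hA.
rewrite -(cvg_shiftn n0.+1 (fun N => \int[mu_ N w]_x f x)).
rewrite (_ : [sequence _]_n = (fun j => \int[mu_ (q_ j).+1 w]_x f x)); first exact: h.
by apply: funext => j; rewrite /= addnS.
Qed.

End band_limits.

Theorem theorem23 (d : measure_display) (T : measurableType d) (R : realType)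
    (P : probability T R) (b : nat -> nat)
    (b_lt : forall N, (0 < N)%N -> (b N <= N.-1)%N)
    (b_oo : b N @[N --> \oo] --> \oo)
    (xi : nat -> {RV P >-> R})
    (xi_exch : exchangeable xi) (xi_mom : finite_moments xi)
    (V : {RV P >-> R}) (V_lim : limiting_empirical_variance xi V)
    (F Fper : forall N : nat, T -> 'M[R]_N)
    (F_band : strict_de_finetti_band_ensemble xi b F)
    (Fper_band : periodic_de_finetti_band_ensemble xi b Fper) :
  let muF (N : nat) (w : T) :=
    eigenvalue_measure ((Num.sqrt (band_scale b N)%:R)^-1 *: F N w) in
  let muFper (N : nat) (w : T) :=
    eigenvalue_measure ((Num.sqrt (band_scale b N)%:R)^-1 *: Fper N w) in
  let sigmaV (w : T) := semicircle_measure (V w) in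
  let scaled_half_widths_cvg :=
    ((b N)%:R / N%:R : R) @[N --> \oo] --> (0 : R) \/
    ((b N)%:R / N%:R : R) @[N --> \oo] --> (1 : R) in
  (weak_cvg_in_probability P muFper sigmaV /\
   (scaled_half_widths_cvg -> weak_cvg_in_probability P muF sigmaV)) /\
  ((\sum_(1 <= N <oo | (1 <= b N)%N) (((N * b N)%:R : R)^-1)%:E < +oo)%E ->
   weak_cvg_almost_surely P muFper sigmaV /\
   (scaled_half_widths_cvg -> weak_cvg_almost_surely P muF sigmaV)).
Proof.
move=> muF muFper sigmaV scaled.
have b_le q : (b q.+1 <= q)%N by exact: b_lt.
have sC q := strict_bandC b (q := q).
have sd q := strict_degree b (q := q).
have sf q := strict_flat b (q := q).
have pC q := periodic_bandC (b_le q).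
have pd q i : (#|periodic_band b (N := q.+1) i| <= band_scale b q.+1)%N by rewrite periodic_degree.
have pf q := periodic_flat (b_le q).
have pr : nearly_regular R b (@periodic_band b) by exact: periodic_regular.
have sr : scaled -> nearly_regular R b (@strict_band b).
  by case=> [/strict_regular_narrow|/strict_regular_wide]; apply.
split; [split=> [|/sr reg]|move=> sum_fin; split=> [|/sr reg]].
- exact: (in_probability_limit (band := @periodic_band b) b_oo xi_exch xi_mom V_lim pC pd pf pr Fper_band).
- exact: (in_probability_limit (band := @strict_band b) b_oo xi_exch xi_mom V_lim sC sd sf reg F_band).
- exact: (almost_sure_limit (band := @periodic_band b) b_lt b_oo xi_exch xi_mom V_lim pC pd pf pr Fper_band sum_fin).
- exact: (almost_sure_limit (band := @strict_band b) b_lt b_oo xi_exch xi_mom V_lim sC sd sf reg F_band sum_fin).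
Qed.
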